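(* Let $n\geq 1$ be an integer, let $A$ be a $2n\times 2n$ real symmetric matrix, let $0<\gamma<2n$, and let $\nu_\gamma$ be the measure on $\mathbb{H}^n$ given by $\nu_\gamma(E) = \int_{\mathbb{R}^{2n}} \chi_E(y, y^{t}Ay)\,\eta(y)\,|y|^{-\gamma}\, dy$ for Borel sets $E\subset\mathbb{H}^n$. Put $$D=\left(\frac{4n^{2}+2n+\gamma}{2n(2n+2)},\ \frac{2n+(2n+1)\gamma}{2n(2n+2)}\right)=\left(\frac{1}{p_D},\frac{1}{q_D}\right),\qquad D'=\left(1-\frac{1}{q_D},\,1-\frac{1}{p_D}\right).$$ If $\det(2A\pm J)\neq 0$, then the type set $E_{\nu_\gamma}$ coincides with the closed trapezoid with vertices $(0,0)$, $(1,1)$, $D$ and $D'$, with the only possible exception of the closed segment joining the two points $D$ and $D'$. That is, $E_{\nu_\gamma}$ is contained in this closed trapezoid, and every point of the closed trapezoid that does not lie on the closed segment joining $D$ and $D'$ belongs to $E_{\nu_\gamma}$.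
   Context: $I_n$ is the $n\times n$ identity matrix and $J = \begin{pmatrix} 0 & I_n \\ -I_n & 0 \end{pmatrix}$ (a $2n\times 2n$ matrix). The Heisenberg group is $\mathbb{H}^{n} = \mathbb{R}^{2n}\times\mathbb{R}$ with group law $(x,t)\cdot(y,s) = (x+y,\, t+s+\langle x,y\rangle)$, where $\langle x,y\rangle = x^{t}Jy$; the neutral element is $(0,0)$ and $(x,t)^{-1}=(-x,-t)$. Its topology and Borel sets are those of $\mathbb{R}^{2n+1}$, and its Haar measure is Lebesgue measure on $\mathbb{R}^{2n+1}$, so $L^{p}(\mathbb{H}^{n}) = L^{p}(\mathbb{R}^{2n+1})$. $\eta:\mathbb{R}^{2n}\to[0,1]$ is a fixed smooth cut-off function with $\eta(y)=1$ if $|y|\leq 1$ and $\eta(y)=0$ if $|y|\geq 2$. For a Borel measure $\nu$ on $\mathbb{H}^n$ and a Borel function $f:\mathbb{H}^n\to\mathbb{C}$, $(f\ast\nu)(x,t) = \int_{\mathbb{H}^n} f((x,t)\cdot(y,s)^{-1})\, d\nu(y,s)$, provided the integral exists, and $T_\nu f = f\ast\nu$. $\|T_\nu\|_{p,q}<\infty$ means there is a constant $c<\infty$ such that, for every Borel $f\in L^p(\mathbb{H}^n)$, $f\ast\nu$ is defined almost everywhere and $\|f\ast\nu\|_q\leq c\|f\|_p$. The type set of $\nu$ is $$E_\nu = \left\{\left(\tfrac1p,\tfrac1q\right)\in[0,1]\times[0,1] : \|T_\nu\|_{p,q}<\infty\right\},$$ with the convention $1/\infty = 0$. Since $A$ is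 symmetric, $\det(2A+J)=\det(2A-J)$, so $\det(2A\pm J)\neq 0$ is a single condition. *)

(* Defs.v *)
From HB Require Import structures.
From mathcomp Require Import all_boot all_order all_algebra.
From mathcomp Require Import all_classical all_reals all_analysis.
From mathcomp Require Import measurable_realfun complex.
Import numFieldNormedType.Exports.
Import Order.TTheory GRing.Theory Num.Theory.

Set Implicit Arguments.
Unset Strict Implicit.
Unset Printing Implicit Defensive.

Local Open Scope classical_set_scope.
Local Open Scope ring_scope.

Section borel_mx.
Context {R : realType} {m n : nat}.
Implicit Type A : set 'M[R]_(m, n).

Definition borel_mx : set (set 'M[R]_(m, n)) := <<s open >>.

Let borel_mx0 : borel_mx set0. Proof. exact: sigma_algebra0. Qed.

Let borel_mxC A : borel_mx A -> borel_mx (~` A).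
Proof. exact: sigma_algebraC. Qed.

Let borel_mx_bigcup (F : (set 'M[R]_(m, n))^nat) :
  (forall i, borel_mx (F i)) -> borel_mx (\bigcup_i (F i)).
Proof. exact: sigma_algebra_bigcup. Qed.

HB.instance Definition _ := @isMeasurable.Build default_measure_display
  'M[R]_(m, n) borel_mx borel_mx0 borel_mxC borel_mx_bigcup.

End borel_mx.

Section measurable_mx.
Context {R : realType}.

Lemma open_measurable_mx m n (U : set 'M[R]_(m, n)) : open U -> measurable U.
Proof. by move=> oU; apply: sub_sigma_algebra. Qed.

Lemma continuous_measurable_mx m n (f : 'M[R]_(m, n) -> R) :
  continuous f -> measurable_fun [set: 'M[R]_(m, n)] f.
Proof.
move=> /continuousP cf; apply: (measurability _ (RGenOInfty.measurableE R)).
move=> _ [_ [a ->] <-]; rewrite setTI; apply: open_measurable_mx.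
by apply: cf; exact: interval_open.
Qed.

Lemma measurable_coord m n (i : 'I_m) (j : 'I_n) :
  measurable_fun [set: 'M[R]_(m, n)] (fun y : 'M[R]_(m, n) => y i j).
Proof. by apply: continuous_measurable_mx; exact: coord_continuous. Qed.

Lemma measurable_fun_mxP d (T : measurableType d) m n (f : T -> 'M[R]_(m, n)) :
  (forall i j, measurable_fun [set: T] (fun t => f t i j)) ->
  measurable_fun [set: T] f.
Proof.
move=> mf; apply: (@measurability _ _ _ _ _ _ (@open 'M[R]_(m, n))) => //.
move=> _ [U oU <-]; rewrite setTI.
pose cube (q : 'M[rat]_(m, n) * nat) : set 'M[R]_(m, n) :=
  ball (map_mx (ratr : rat -> R) q.1) q.2.+1%:R^-1.
have cubeE q : cube q =
    \bigcap_(ij in [set: 'I_m * 'I_n])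
      [set M | ball (ratr (q.1 ij.1 ij.2) : R) q.2.+1%:R^-1 (M ij.1 ij.2)].
  apply/seteqP; split => M /=.
    by move=> [_ Mq] [i j] _ /=; have := Mq i j; rewrite mxE.
  move=> Mq; split; first by rewrite invr_gt0 ltr0n.
  by move=> i j; rewrite mxE; exact: (Mq (i, j)).
have -> : U = \bigcup_q (if `[< cube q `<=` U >] then cube q else set0).
  apply/seteqP; split => [M UM|M [q _]]; last by case: asboolP => // qU /qU.
  have /nbhs_ballP[e /= e0 eU] : nbhs M U by exact: open_nbhs_nbhs.
  have [k ke] : exists k, (k.+1%:R^-1 : R) < e / 2.
    have /ltr_add_invr[k] : (0 : R) < e / 2 by rewrite divr_gt0.
    by rewrite add0r => ke; exists k.
  have k0 : (0 : R) < k.+1%:R^-1 by rewrite invr_gt0 ltr0n.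
  have qM i j : exists q : rat, `|ratr q - M i j| < (k.+1%:R^-1 : R).
    have : M i j - k.+1%:R^-1 < M i j + k.+1%:R^-1.
      by rewrite ltrD2l gtrN.
    move=> /rat_in_itvoo[q]; rewrite in_itv/= => /andP[q1 q2].
    by exists q; rewrite ltr_distl q1 q2.
  pose Q : 'M[rat]_(m, n) := \matrix_(i, j) sval (cid (qM i j)).
  exists (Q, k) => //; case: asboolP => [_|].
    split => //= i j; rewrite !mxE /ball/=.
    by case: cid => /= q.
  case=> N [_ /= QN]; apply: eU; split => // i j.
  have := QN i j; rewrite !mxE /ball/=; case: cid => /= q qMij qN.
  rewrite distrC in qMij.
  rewrite (_ : M i j - N i j = (M i j - ratr q) + (ratr q - N i j)); last first.
    by rewrite addrA subrK.
  by apply: le_lt_trans (ler_normD _ _) _; rewrite [e]splitr ltrD// ?(lt_trans _ ke).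
rewrite preimage_bigcup; apply: countable_bigcupT_measurable => //.
move=> q; case: asboolP => _; last by rewrite preimage_set0.
rewrite cubeE preimage_bigcap; apply: fin_bigcap_measurable => //.
move=> [i j] _ /=.
rewrite -[X in measurable X]setTI; apply: (mf i j) => //.
by apply: open_measurable; exact: ball_open.
Qed.

End measurable_mx.

Section lebesgue_cV.
Context {R : realType}.

Definition consV m (p : measurableTypeR R * 'cV[R]_m) : 'cV[R]_(1 + m) :=
  col_mx (p.1 : R)%:M p.2.

Definition unconsV m (y : 'cV[R]_(1 + m)) : measurableTypeR R * 'cV[R]_m :=
  (usubmx y 0 0, dsubmx y).

Lemma consVK m : cancel (@consV m) (@unconsV m).
Proof.
by case=> x y; rewrite /unconsV /consV col_mxKu col_mxKd mxE.
Qed.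

Lemma consV0 m (p : measurableTypeR R * 'cV[R]_m) :
  consV p (ord0 : 'I_m.+1) 0 = p.1.
Proof.
rewrite (_ : ord0 = lshift m ord0 :> 'I_(1 + m)); last exact/val_inj.
by rewrite col_mxEu mxE.
Qed.

Lemma consVS m (p : measurableTypeR R * 'cV[R]_m) i :
  consV p (lift ord0 i : 'I_m.+1) 0 = p.2 i 0.
Proof.
rewrite (_ : lift ord0 i = rshift 1 i :> 'I_(1 + m)); last exact/val_inj.
by rewrite col_mxEd.
Qed.

Lemma measurable_consV m : measurable_fun setT (@consV m).
Proof.
apply: measurable_fun_mxP => i j; rewrite [j]ord1 /consV.
case: (@split_ordP 1 m i) => k ->.
  under eq_fun do rewrite col_mxEu mxE [k]ord1 eqxx mulr1n.
  exact: measurable_fst.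
under eq_fun do rewrite col_mxEd.
by apply: (measurableT_comp (measurable_coord k 0)); exact: measurable_snd.
Qed.

Lemma measurable_unconsV m : measurable_fun setT (@unconsV m).
Proof.
apply: measurable_fun_pair.
  under eq_fun do rewrite mxE.
  exact: measurable_coord.
apply: measurable_fun_mxP => i j; under eq_fun do rewrite mxE.
exact: measurable_coord.
Qed.

Section step.
Variables (m : nat) (mu : {sigma_finite_measure set 'cV[R]_m -> \bar R}).

Definition lebesgue_step : set 'cV[R]_(1 + m) -> \bar R :=
  pushforward (lebesgue_measure \x mu)%E (@consV m).

Let preimage_consV (A : set 'cV[R]_(1 + m)) :
  measurable A -> measurable (@consV m @^-1` A).
Proof.
by move=> mA; rewrite -[X in measurable X]setTI; exact: measurable_consV.
Qed.

Let step0 : lebesgue_step set0 = 0%E.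
Proof. by rewrite /lebesgue_step /pushforward preimage_set0 measure0. Qed.

Let step_ge0 A : (0 <= lebesgue_step A)%E.
Proof. by rewrite /lebesgue_step /pushforward measure_ge0. Qed.

Let step_sigma_additive : semi_sigma_additive lebesgue_step.
Proof.
move=> F mF tF mUF; rewrite /lebesgue_step /pushforward preimage_bigcup.
apply: measure_semi_sigma_additive.
- by move=> k; exact: preimage_consV.
- apply/trivIsetP => /= i j _ _ ij; rewrite -preimage_setI.
  by move/trivIsetP : tF => /(_ _ _ _ _ ij) ->//; rewrite preimage_set0.
- by rewrite -preimage_bigcup; exact: preimage_consV.
Qed.

HB.instance Definition _ := isMeasure.Build _ _ _ lebesgue_step
  step0 step_ge0 step_sigma_additive.

Let step_sigma_finite : sigma_finite setT lebesgue_step.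
Proof.
have /sigma_finiteP[F [TF ndF Foo]] := sigma_finiteT (@lebesgue_measure R).
have /sigma_finiteP[G [TG ndG Goo]] := sigma_finiteT mu.
exists (fun k => @unconsV m @^-1` (F k `*` G k)).
  rewrite -preimage_bigcup (_ : \bigcup_k _ = setT) ?preimage_setT//.
  rewrite -setXTT TF TG predeqE => -[x y]; split.
    by move=> [k _ []/= ? ?]; split; exists k.
  move=> [/= [k _ Fkx] [l _ Gly]]; exists (maxn k l) => //; split.
  - by move: x Fkx; exact/subsetPset/ndF/leq_maxl.
  - by move: y Gly; exact/subsetPset/ndG/leq_maxr.
move=> k; have [? ?] := Foo k; have [? ?] := Goo k; split.
  rewrite -[X in measurable X]setTI; apply: measurable_unconsV => //.
  exact: measurableX.
rewrite /lebesgue_step /pushforward -comp_preimage.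
rewrite (_ : _ \o _ = id) ?preimage_id; last by apply/funext => p; exact: consVK.
by rewrite product_measure1E// lte_mul_pinfty// ge0_fin_numE.
Qed.

HB.instance Definition _ := Measure_isSigmaFinite.Build _ _ _ lebesgue_step
  step_sigma_finite.

End step.

(* Lebesgue measure on R^m as an iterated product of the one on R. *)
Fixpoint lebesgue_cV m : {sigma_finite_measure set 'cV[R]_m -> \bar R} :=
  if m is m'.+1 then lebesgue_step (lebesgue_cV m')
  else \d_(0 : 'cV[R]_0).

Lemma lebesgue_cV_box m (B : 'I_m -> set (measurableTypeR R)) :
  (forall i, measurable (B i)) ->
  lebesgue_cV m [set y | forall i, B i (y i 0)] =
  (\prod_(i < m) lebesgue_measure (B i))%E.
Proof.
elim: m B => [|m IHm] B mB.
  rewrite big_ord0 /= diracE mem_set//.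
  by case.
rewrite big_ord_recl -(IHm (fun i => B (lift ord0 i)))// -product_measure1E//.
  congr (product_measure1 _ _ _); apply/seteqP; split => -[x y] /=.
    move=> By; split=> [|i]; first by have := By ord0; rewrite consV0.
    by have := By (lift ord0 i); rewrite consVS.
  move=> [Bx By] i; have [k ->|->] := unliftP ord0 i; first by rewrite consVS.
  by rewrite consV0.
rewrite [X in measurable X](_ : _ = \bigcap_(i in [set: 'I_m])
    ((fun y : 'cV[R]_m => y i 0) @^-1` B (lift ord0 i))); last first.
  by apply/seteqP; split => y /= By i; [move=> _; exact: By|exact: (By i)].
apply: fin_bigcap_measurable => // i _; rewrite -[X in measurable X]setTI.
by apply: measurable_coord => //; exact: mB.
Qed.

End lebesgue_cV.

Section smooth.
Context {R : realType} {m : nat}.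

Fixpoint iter_partial (s : seq 'I_m) (f : 'cV[R]_m -> R) : 'cV[R]_m -> R :=
  if s is i :: s' then 'D_(delta_mx i 0) (iter_partial s' f) else f.

(* All iterated partial derivatives exist and are continuous. *)
Definition smooth (f : 'cV[R]_m -> R) : Prop :=
  forall s : seq 'I_m, continuous (iter_partial s f) /\
    forall i x, derivable (iter_partial s f) x (delta_mx i 0).

(* The library norm `|y| on matrices is the sup norm, hence this definition. *)
Definition euclid_norm (y : 'cV[R]_m) : R := Num.sqrt (\sum_i y i 0 ^+ 2).

Record cutoff := Cutoff {
  cutoff_fun :> 'cV[R]_m -> R;
  cutoff_smooth : smooth cutoff_fun;
  cutoff_itv : forall y, 0 <= cutoff_fun y <= 1;
  cutoff1 : forall y, euclid_norm y <= 1 -> cutoff_fun y = 1;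
  cutoff0 : forall y, 2 <= euclid_norm y -> cutoff_fun y = 0 }.

Lemma measurable_cutoff (eta : cutoff) : measurable_fun setT eta.
Proof.
by apply: continuous_measurable_mx; have [] := cutoff_smooth eta [::].
Qed.

Lemma measurable_euclid_norm : measurable_fun setT euclid_norm.
Proof.
apply: (measurableT_comp (f := @Num.sqrt R)).
  by apply: continuous_measurable_fun; exact: sqrt_continuous.
by apply: measurable_sum => i; apply: measurable_funX; exact: measurable_coord.
Qed.

End smooth.
Arguments cutoff : clear implicits.

Section complex_fun.
Context {d : measure_display} {T : measurableType d} {R : realType}.
Implicit Type f : T -> R[i].

Definition cmeasurable f : Prop :=
  measurable_fun setT (fun x => complex.Re (f x)) /\
  measurable_fun setT (fun x => complex.Im (f x)).

Variable mu : {measure set T -> \bar R}.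

Definition cintegrable f : Prop :=
  mu.-integrable setT (fun x => (complex.Re (f x))%:E) /\
  mu.-integrable setT (fun x => (complex.Im (f x))%:E).

Definition cintegral f : R[i] :=
  Complex (\int[mu]_x complex.Re (f x)) (\int[mu]_x complex.Im (f x)).

Definition cLnorm (p : \bar R) f : \bar R :=
  Lnorm mu p (fun x => (ComplexField.Normc.normc (f x))%:E).

End complex_fun.

(* measurableTypeR R is R with the Borel sets on which lebesgue_measure is
   defined; the product sigma-algebra is the Borel one of R^(2n+1). *)
Definition heisenberg (R : realType) (n : nat) : Type :=
  ('cV[R]_(n + n) * measurableTypeR R)%type.

Section heisenberg.
Context {R : realType} {n : nat}.
Local Notation H := (heisenberg R n).

Definition symp_mx : 'M[R]_(n + n) := block_mx 0 1%:M (- 1%:M) 0.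

Definition symp (x y : 'cV[R]_(n + n)) : R := (x^T *m symp_mx *m y) 0 0.

Definition heis_mul (g h : H) : H :=
  (g.1 + h.1, (g.2 : R) + (h.2 : R) + symp g.1 h.1).

Definition heis_inv (g : H) : H := (- g.1, - (g.2 : R)).

Definition haar : {measure set H -> \bar R} :=
  (lebesgue_cV (n + n) \x lebesgue_measure)%E.

Section convolution.
Variable nu : {measure set H -> \bar R}.
Implicit Type f : H -> R[i].

Definition conv_defined f (g : H) : Prop :=
  cintegrable nu (fun h => f (heis_mul g (heis_inv h))).

(* Meaningful only where conv_defined f g holds. *)
Definition heis_conv f (g : H) : R[i] :=
  cintegral nu (fun h => f (heis_mul g (heis_inv h))).

(* ||T_nu||_{p,q} < oo *)
Definition conv_bounded (p q : \bar R) : Prop :=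
  exists c : R, forall f, cmeasurable f -> (cLnorm haar p f < +oo)%E ->
    {ae haar, forall g, conv_defined f g} /\
    (cLnorm haar q (heis_conv f) <= c%:E * cLnorm haar p f)%E.

(* Points are (1/p, 1/q); the inverse of \bar R sends 0 to +oo. *)
Definition type_set : set (R * R) :=
  [set uv | [/\ 0 <= uv.1 <= 1, 0 <= uv.2 <= 1 &
                conv_bounded (uv.1%:E^-1)%E (uv.2%:E^-1)%E]].

End convolution.

Section nu_gamma.
Variables (A : 'M[R]_(n + n)) (gamma : R) (eta : cutoff R (n + n)).

Definition quad (y : 'cV[R]_(n + n)) : R := (y^T *m A *m y) 0 0.

Definition quad_graph (y : 'cV[R]_(n + n)) : H := (y, quad y).

(* powR sends 0 `^ (- gamma) to 0 for gamma != 0; {0} is a null set when n > 0. *)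
Definition density (y : 'cV[R]_(n + n)) : R :=
  eta y * euclid_norm y `^ (- gamma).

Definition nu_gamma (E : set H) : \bar R :=
  (\int[lebesgue_cV (n + n)]_y (\1_E (quad_graph y) * density y)%:E)%E.

Lemma measurable_quad : measurable_fun setT quad.
Proof.
rewrite /quad; under eq_fun do rewrite mxE.
apply: measurable_sum => j; apply: measurable_funM; last exact: measurable_coord.
under eq_fun do rewrite mxE.
apply: measurable_sum => k; apply: measurable_funM; last exact: measurable_cst.
under eq_fun do rewrite mxE.
exact: measurable_coord.
Qed.

Lemma measurable_quad_graph : measurable_fun setT quad_graph.
Proof. by apply: measurable_fun_pair => //; exact: measurable_quad. Qed.

Lemma measurable_density : measurable_fun setT density.
Proof.
apply: measurable_funM; first exact: measurable_cutoff.
apply: (measurableT_comp (f := @powR R ^~ (- gamma))).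
  exact: measurable_powR.
exact: measurable_euclid_norm.
Qed.

Lemma density_ge0 y : 0 <= density y.
Proof.
by apply: mulr_ge0; [have /andP[] := cutoff_itv eta y|exact: powR_ge0].
Qed.

Lemma nu_gammaE E : nu_gamma E =
  (\int[lebesgue_cV (n + n)]_(y in quad_graph @^-1` E) (density y)%:E)%E.
Proof.
rewrite [RHS]integral_mkcond; apply: eq_integral => y _.
rewrite patchE indicE.
rewrite (_ : (y \in quad_graph @^-1` E) = (quad_graph y \in E)); last first.
  by apply/idP/idP; rewrite !inE.
by case: ifPn => _; rewrite ?mul1r ?mul0r.
Qed.

Let nu_gamma0 : nu_gamma set0 = 0%E.
Proof. by rewrite nu_gammaE preimage_set0 integral_set0. Qed.

Let nu_gamma_ge0 E : (0 <= nu_gamma E)%E.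
Proof.
by rewrite nu_gammaE; apply: integral_ge0 => y _; rewrite lee_fin density_ge0.
Qed.

Let nu_gamma_sigma_additive : semi_sigma_additive nu_gamma.
Proof.
have mg E : measurable E -> measurable (quad_graph @^-1` E).
  by move=> mE; rewrite -[X in measurable X]setTI; exact: measurable_quad_graph.
move=> F mF tF mUF; rewrite nu_gammaE preimage_bigcup.
rewrite ge0_integral_bigcup//.
- under [X in _ --> X]eq_eseriesr do rewrite -nu_gammaE.
  apply/cvg_closeP; split; last by rewrite closeE.
  by apply: is_cvg_nneseries => k _ _; exact: nu_gamma_ge0.
- by move=> k; exact: mg.
- apply/measurable_EFinP/measurable_funTS; exact: measurable_density.
- by move=> y _; rewrite lee_fin density_ge0.
- apply/trivIsetP => i j _ _ ij; rewrite -preimage_setI.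
  by move/trivIsetP : tF => /(_ _ _ _ _ ij) ->//; rewrite preimage_set0.
Qed.

HB.instance Definition _ := isMeasure.Build _ _ _ nu_gamma
  nu_gamma0 nu_gamma_ge0 nu_gamma_sigma_additive.

End nu_gamma.
End heisenberg.
Arguments symp_mx : clear implicits.

Section plane.
Context {R : realType}.

Definition segment (a b : R * R) : set (R * R) :=
  [set (1 - t) *: a + t *: b | t in `[0, 1]].

Definition convex_hull4 (a b c e : R * R) : set (R * R) :=
  [set x | exists t : 'I_4 -> R, [/\ forall i, 0 <= t i, \sum_i t i = 1 &
    x = \sum_i t i *: tnth [tuple a; b; c; e] i]].

End plane.

Section vertices.
Context {R : realType}.
Variables (n : nat) (gamma : R).

Definition vertexD : R * R :=
  ((4 * n%:R ^+ 2 + 2 * n%:R + gamma) / (2 * n%:R * (2 * n%:R + 2)),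
   (2 * n%:R + (2 * n%:R + 1) * gamma) / (2 * n%:R * (2 * n%:R + 2))).

Definition vertexD' : R * R := (1 - vertexD.2, 1 - vertexD.1).

Definition trapezoid : set (R * R) :=
  convex_hull4 (0, 0) (1, 1) vertexD vertexD'.

End vertices.

(* Main.v *)
From HB Require Import structures.
Require Import Defs.
From mathcomp Require Import all_boot all_order all_algebra.
From mathcomp Require Import all_classical all_reals all_analysis.
From mathcomp Require Import measurable_realfun ess_sup_inf complex ring lra.
Import numFieldNormedType.Exports.
Import Order.TTheory GRing.Theory Num.Theory.
Set Implicit Arguments.
Unset Strict Implicit.
Unset Printing Implicit Defensive.
Local Open Scope classical_set_scope.
Local Open Scope ring_scope.

(** Write [m = 2n], [Q] for the quadratic form of [A], and [V] for the point
    [(v, 1 - v)] with [v = (m+1)/(m+2)].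

    _Upper bounds_.  For [f >= 0] the convolution at [(x, t)] is the integral of
    [f (x - y, t - Q y - <x, y>)] against a density which is at most
    [|y|^-gamma] and is supported in [|y| < 2].  Two operators of this form are
    easy to control.  With a weight of finite mass, such as [|y|^-b] on
    [|y| < 2] for [b < m], the integral of the average of [F] is the mass times
    the integral of [F] ([integral_average]).  With weight [1] on the whole of
    [R^m], the substitution [y = x - z] turns the average into the Radon
    transform [int f(z, t + x.z) dz], up to shears that preserve the measure and
    the linear map [(2A + J)^T], which is invertible by assumption
    ([full_average_bound]).  The Radon transform maps [L^((m+2)/(m+1))] to
    [L^(m+2)] ([radon_bound]), which is the estimate at [V].  A point of the
    trapezoid off the segment is [(1 - theta)(c, c) + theta V] with
    [0 <= c <= 1] and [0 <= theta < 1 - gamma/m] ([trapezoid_parameters]).  For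
    such [theta] the weight [|y|^-gamma] is the power [1 - theta] of [|y|^-b],
    where [b = gamma/(1 - theta) < m], so that Hoelder's inequality, in [y] and
    then in [(x, t)], interpolates by hand between the two operators
    ([average_le_geometric_mean], [average_bound]).

    _The Radon transform_.  Powers are cleared by writing the function as
    [G ^ (m+1)].  For a density [f], the power [k+1] of the integral of [f] is at
    most a constant times the integral over [z0] of [f z0] times the power [k]
    of the mass of the points that lie below the level of [z0]
    ([power_le_lower_mass]).  With [k = m+1] and [z0] fixed, all hyperplanes that
    occur pass through one point, and the function is bounded by its value there
    ([radon_through_origin]).  That case rests on a determinant inequality: if
    [0 <= G <= S], the integral of [G ^ (m+1)], to the power [m+1], is at most
    [C S] times the integral of [prod_i G(z_i)^(m+2) |det (z_1, ..., z_m)|]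
    ([det_inequality]).  When [G] is evaluated on the hyperplane of slope [x] and
    [x] is integrated out, the determinant is the Jacobian of
    [x |-> (x.z_i)_i] and the product separates.  The determinant inequality is
    proved with linear forms [l_1, ..., l_m] that nearly maximise
    [|det (l_i)|] under the constraints [int G^(m+2) |l_i z| dz <= 1]
    ([det_le_of_moments], [exists_auerbach_basis], [iint_det_ge]).

    _Lower bounds_.  Indicators of small cubes, of neighbourhoods of the
    reflected graph, and of small and large parabolic boxes give four linear
    inequalities between [1/p] and [1/q] ([test_sets]), and these cut out the
    trapezoid ([trapezoid_of_inequalities]). *)

(** * Curried functions on products *)

Lemma measurable_fun_comp2 (d d1 d2 d3 : measure_display) (S : measurableType d)
    (T1 : measurableType d1) (T2 : measurableType d2) (T3 : measurableType d3)
    (F : T1 -> T2 -> T3) (a : S -> T1) (b : S -> T2) :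
  measurable_fun setT (fun p => F p.1 p.2) ->
  measurable_fun setT a -> measurable_fun setT b ->
  measurable_fun setT (fun s => F (a s) (b s)).
Proof.
move=> mF ma mb; pose g s := (a s, b s).
apply: (measurableT_comp (f := fun p => F p.1 p.2) (g := g)) => //.
exact: measurable_fun_pair.
Qed.

Section projections.
Context {d1 d2 d3 : measure_display}.
Context {T1 : measurableType d1} {T2 : measurableType d2} {T3 : measurableType d3}.

Lemma measurable_fst_fst : measurable_fun setT (fun p : (T1 * T2) * T3 => p.1.1).
Proof. by apply: (measurableT_comp measurable_fst); exact: measurable_fst. Qed.

Lemma measurable_snd_fst : measurable_fun setT (fun p : (T1 * T2) * T3 => p.1.2).
Proof. by apply: (measurableT_comp measurable_snd); exact: measurable_fst. Qed.

End projections.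

Lemma eq_lexx (disp : Order.disp_t) (T : porderType disp) (x y : T) :
  x = y -> (x <= y)%O.
Proof. by move=> ->. Qed.

Section tonelli.
Context {R : realType} {d1 d2 : measure_display}.
Context {T1 : measurableType d1} {T2 : measurableType d2}.
Variables (m1 : {sigma_finite_measure set T1 -> \bar R}).
Variables (m2 : {sigma_finite_measure set T2 -> \bar R}).
Variable f : T1 -> T2 -> \bar R.
Hypotheses (mf : measurable_fun setT (fun p => f p.1 p.2)).
Hypothesis f0 : forall x y, (0 <= f x y)%E.

Lemma measurable_integral_snd : measurable_fun setT (fun x => \int[m2]_y f x y)%E.
Proof. exact: (measurable_fun_fubini_tonelli_F (m2 := m2) _ mf (fun=> f0 _ _)). Qed.

Lemma measurable_integral_fst : measurable_fun setT (fun y => \int[m1]_x f x y)%E.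
Proof. exact: (measurable_fun_fubini_tonelli_G (m1 := m1) _ mf (fun=> f0 _ _)). Qed.

Lemma tonelli :
  (\int[m1]_x \int[m2]_y f x y = \int[m2]_y \int[m1]_x f x y)%E.
Proof. exact: (fubini_tonelli _ mf (fun=> f0 _ _)). Qed.

Lemma tonelli_prod :
  (\int[(m1 \x m2)%E]_p f p.1 p.2 = \int[m1]_x \int[m2]_y f x y)%E.
Proof. exact: (fubini_tonelli1 _ mf (fun=> f0 _ _)). Qed.

End tonelli.

Section slices.
Context {d1 d2 d3 : measure_display}.
Context {T1 : measurableType d1} {T2 : measurableType d2}.
Context {T3 : measurableType d3} {F : T1 -> T2 -> T3}.
Hypothesis mF : measurable_fun setT (fun p => F p.1 p.2).

Lemma measurable_slice_snd x : measurable_fun setT (F x).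
Proof. by apply: (measurable_fun_comp2 mF). Qed.

Lemma measurable_slice_fst y : measurable_fun setT (F ^~ y).
Proof. by apply: (measurable_fun_comp2 mF). Qed.

End slices.

Lemma emeasurable_funX (d : measure_display) (T : measurableType d)
    (R : realType) (f : T -> \bar R) n :
  measurable_fun setT f -> measurable_fun setT (fun x => f x ^+ n)%E.
Proof.
move=> mf; elim: n => [|n IHn]; first exact: measurable_cst.
by under eq_fun do rewrite expeS; exact: emeasurable_funM.
Qed.

(** * Translations and dilations of the line *)

Section lebesgue_line.
Context {R : realType}.
Local Notation mu := (@lebesgue_measure R).
Local Notation RT := (measurableTypeR R).

(** Lebesgue measure is determined by its values on half-open intervals, so the
    image measure has to be compared with it there only. *)
Lemma ge0_integral_lebesgue_comp (phi : RT -> RT) (k : R) : 0 < k ->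
  measurable_fun [set: RT] phi ->
  (forall x y : R, (x < y)%R ->
    mu (phi @^-1` `]x, y]%classic) = (k^-1 * (y - x))%:E) ->
  forall f : RT -> \bar R, measurable_fun [set: RT] f ->
  (forall r, 0 <= f r)%E ->
  (k%:E * \int[mu]_r f (phi r) = \int[mu]_r f r)%E.
Proof.
move=> k0 mphi H f mf f0.
pose nu : {measure set (measurableTypeR R) -> \bar R} :=
  mscale (NngNum (ltW k0)) (pushforward mu phi).
transitivity (\int[nu mphi]_r f r)%E.
  by rewrite /nu ge0_integral_mscale// ge0_integral_pushforward.
apply: eq_measure_integral => A mA _; apply/esym.
apply: (@lebesgue_measure_unique R (nu mphi)) => // _ [[x y]] _ <-.
transitivity (k%:E * mu (phi @^-1` `]x, y]%classic))%E; last by [].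
have [xy|yx] := ltP x y.
  by rewrite H// lebesgue_measure_itv /= lte_fin xy -EFinM mulVKf ?gt_eqF.
by rewrite set_itv_ge ?preimage_set0 ?measure0 ?mule0// bnd_simp -leNgt.
Qed.

Lemma ge0_integral_shift (f : RT -> \bar R) (a : R) :
  measurable_fun [set: RT] f -> (forall r, 0 <= f r)%E ->
  (\int[mu]_r f (r + a)%R = \int[mu]_r f r)%E.
Proof.
move=> mf f0; rewrite -(ge0_integral_lebesgue_comp (phi := fun r => r + a) ltr01 _ _ mf f0).
- by rewrite mul1e.
- exact: measurable_funD.
move=> x y xy; rewrite (_ : _ @^-1` _ = `]x - a, y - a]%classic); last first.
  by apply/seteqP; split => r /=; rewrite !in_itv/= ltrBlDr lerBrDr.
rewrite lebesgue_measure_itv /= !lte_fin ltrD2r xy -EFinB invr1 mul1r.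
by congr EFin; ring.
Qed.

Lemma ge0_integral_dilate (f : RT -> \bar R) (a : R) : a != 0 ->
  measurable_fun [set: RT] f -> (forall r, 0 <= f r)%E ->
  (`|a|%:E * \int[mu]_r f (a * r)%R = \int[mu]_r f r)%E.
Proof.
move=> a0 mf f0; rewrite -normr_gt0 in a0.
apply: (ge0_integral_lebesgue_comp (phi := fun r => a * r) a0) => //.
  exact: measurable_funM.
move=> x y xy; move: a0; rewrite normr_gt0 neq_lt => /orP[an|ap]; last first.
  rewrite (_ : _ @^-1` _ = `](x / a), (y / a)]%classic); last first.
    by apply/seteqP; split => r /=;
      rewrite !in_itv/= ltr_pdivrMr// ler_pdivlMr// mulrC.
  rewrite lebesgue_measure_itv /= !lte_fin ltr_pM2r ?invr_gt0// xy -EFinB.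
  by rewrite gtr0_norm// [in RHS]mulrC mulrBl.
rewrite (_ : _ @^-1` _ = `[(y / a), (x / a)[%classic); last first.
  by apply/seteqP; split => r /=;
    rewrite !in_itv/= ltr_ndivlMr// ler_ndivrMr// mulrC andbC.
rewrite lebesgue_measure_itv /= !lte_fin ltr_nM2r ?invr_lt0// xy -EFinB.
by rewrite ltr0_norm// invrN mulNr -mulrN opprB [in RHS]mulrC mulrBl.
Qed.

End lebesgue_line.

(** * Linear changes of variables *)

Section measurable_matrices.
Context {R : realType} {d : measure_display} {T : measurableType d}.

Lemma measurable_mxE m n (f : T -> 'M[R]_(m, n)) i j :
  measurable_fun setT f -> measurable_fun setT (fun t => f t i j).
Proof. exact: (measurableT_comp (measurable_coord i j)). Qed.

Lemma measurable_addmx m n (f g : T -> 'M[R]_(m, n)) :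
  measurable_fun setT f -> measurable_fun setT g ->
  measurable_fun setT (fun t => f t + g t).
Proof.
move=> mf mg; apply: measurable_fun_mxP => i j; under eq_fun do rewrite mxE.
by apply: measurable_funD; exact: measurable_mxE.
Qed.

Lemma measurable_oppmx m n (f : T -> 'M[R]_(m, n)) :
  measurable_fun setT f -> measurable_fun setT (fun t => - f t).
Proof.
move=> mf; apply: measurable_fun_mxP => i j; under eq_fun do rewrite mxE.
by apply: measurableT_comp => //; exact: measurable_mxE.
Qed.

Lemma measurable_mulmx m n p (f : T -> 'M[R]_(m, n)) (g : T -> 'M[R]_(n, p)) :
  measurable_fun setT f -> measurable_fun setT g ->
  measurable_fun setT (fun t => f t *m g t).
Proof.
move=> mf mg; apply: measurable_fun_mxP => i j; under eq_fun do rewrite mxE.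
apply: measurable_sum => k.
by apply: measurable_funM; exact: measurable_mxE.
Qed.

Lemma measurable_trmx m n (f : T -> 'M[R]_(m, n)) :
  measurable_fun setT f -> measurable_fun setT (fun t => (f t)^T).
Proof.
move=> mf; apply: measurable_fun_mxP => i j; under eq_fun do rewrite mxE.
exact: measurable_mxE.
Qed.

Lemma measurable_row_mx m n p (f : T -> 'M[R]_(m, n)) (g : T -> 'M[R]_(m, p)) :
  measurable_fun setT f -> measurable_fun setT g ->
  measurable_fun setT (fun t => row_mx (f t) (g t)).
Proof.
move=> mf mg; apply: measurable_fun_mxP => i j; under eq_fun do rewrite mxE.
by case: (fintype.split j) => k; exact: measurable_mxE.
Qed.

Lemma measurable_consV_comp m (f : T -> measurableTypeR R)
    (g : T -> 'cV[R]_m) :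
  measurable_fun setT f -> measurable_fun setT g ->
  measurable_fun setT (fun t => consV (f t, g t)).
Proof.
move=> mf mg; apply: (measurableT_comp (@measurable_consV R m)).
exact: measurable_fun_pair.
Qed.

End measurable_matrices.

Section lebesgue_cV_theory.
Context {R : realType}.
Local Notation mu := (@lebesgue_measure R).
Local Notation RT := (measurableTypeR R).
Local Notation leb := (@lebesgue_cV R _).

Lemma ge0_integral_cVS m (f : 'cV[R]_m.+1 -> \bar R) :
  measurable_fun setT f -> (forall y, 0 <= f y)%E ->
  (\int[leb]_y f y = \int[mu]_r \int[leb]_y f (consV (r, y)))%E.
Proof.
move=> mf f0.
have mc := @measurable_consV R m.
rewrite [LHS](_ : _ = \int[(mu \x @lebesgue_cV R m)%E]_p f (consV p))%E.
  by rewrite fubini_tonelli1//; exact: measurableT_comp.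
rewrite /= /lebesgue_step.
by rewrite ge0_integral_pushforward.
Qed.

Lemma consV_split m (a : 'cV[R]_m.+1) :
  a = consV (a 0 0, @dsubmx _ 1 m 1 a).
Proof.
transitivity (@col_mx _ 1 m 1 (@usubmx _ 1 m 1 a) (@dsubmx _ 1 m 1 a)).
  by rewrite vsubmxK.
rewrite /consV; congr (@col_mx _ 1 m 1 _ _).
by rewrite [LHS]mx11_scalar mxE; congr (a _ _)%:M; exact/val_inj.
Qed.

Lemma consVD m (p q : RT * 'cV[R]_m) :
  consV p + consV q = consV ((p.1 : R) + (q.1 : R), p.2 + q.2).
Proof. by rewrite /consV add_col_mx -raddfD. Qed.

Lemma ge0_integral_cV_shift m (f : 'cV[R]_m -> \bar R) (a : 'cV[R]_m) :
  measurable_fun setT f -> (forall y, 0 <= f y)%E ->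
  (\int[leb]_y f (y + a)%R = \int[leb]_y f y)%E.
Proof.
elim: m f a => [|m IHm] f a mf f0.
  by apply: eq_integral => y _; rewrite [y]flatmx0 [a]flatmx0 addr0.
have mfa : measurable_fun setT (fun y : 'cV[R]_m.+1 => f (y + a)).
  by apply: measurableT_comp => //; exact: measurable_addmx.
rewrite ge0_integral_cVS// [RHS](ge0_integral_cVS mf f0).
pose F (r : RT) : \bar R := (\int[leb]_y f (consV (r, y)))%E.
have mc : measurable_fun setT (f \o @consV R m).
  by apply: measurableT_comp => //; exact: measurable_consV.
have mF : measurable_fun setT F by exact: (measurable_integral_snd _ (f := fun r y => f (consV (r, y)))).
have F0 r : (0 <= F r)%E by exact: integral_ge0.
rewrite -(ge0_integral_shift (a 0 0) mF F0); apply: eq_integral => r _.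
rewrite /F -(IHm (fun y => f (consV (_, y))) (@dsubmx _ 1 m 1 a))//; last first.
  by apply: (measurableT_comp mf); exact: measurable_consV_comp.
apply: eq_integral => y _; congr f.
by rewrite {1}(consV_split a) consVD.
Qed.

Definition change_of_vars m (M : 'M[R]_m) :=
  forall f : 'cV[R]_m -> \bar R, measurable_fun setT f ->
  (forall y, 0 <= f y)%E ->
  (`|\det M|%:E * \int[leb]_y f (M *m y) = \int[leb]_y f y)%E.

Lemma change_of_vars_mul m (M N : 'M[R]_m) :
  change_of_vars M -> change_of_vars N -> change_of_vars (M *m N).
Proof.
move=> cM cN f mf f0; rewrite det_mulmx normrM EFinM -muleA -(cM f)//.
congr (_ * _)%E.
rewrite -(cN (fun y => f (M *m y)))//; last first.
  by apply: (measurableT_comp mf); exact: measurable_mulmx.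
by under eq_integral do rewrite -mulmxA.
Qed.

Lemma change_of_vars_block_ur m (a : R) (b : 'rV[R]_m) (D : 'M[R]_m) :
  a != 0 -> change_of_vars D -> @change_of_vars m.+1 (block_mx a%:M b 0 D).
Proof.
move=> a0 cD f mf f0.
have E r y : block_mx a%:M b 0 D *m consV (r, y) =
    consV (a * r + (b *m y) 0 0, D *m y).
  rewrite /consV mul_block_col mul0mx add0r; congr col_mx.
  by rewrite -scalar_mxM raddfD/= [X in _ + X]mx11_scalar.
rewrite ge0_integral_cVS//; last first.
  by apply: (measurableT_comp mf); exact: measurable_mulmx.
under eq_integral do under eq_integral do rewrite E.
have mby : measurable_fun setT (fun y : 'cV[R]_m => (b *m y) 0 0).
  by apply: measurable_mxE; exact: measurable_mulmx.
have mDy : measurable_fun setT (fun y : 'cV[R]_m => D *m y).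
  exact: measurable_mulmx.
pose g (r : RT) (y : 'cV[R]_m) :=
  f (consV (a * (r : R) + (b *m y) 0 0, D *m y)).
have mg : measurable_fun setT (fun p => g p.1 p.2).
  apply: (measurableT_comp mf); apply: measurable_consV_comp.
    apply: measurable_funD; first exact: measurable_funM.
    exact: measurableT_comp mby _.
  exact: measurableT_comp mDy _.
have g0 r y : (0 <= g r y)%E by exact: f0.
rewrite (tonelli mu leb mg g0).
rewrite (@det_ublock _ 1 m) det_scalar1 normrM mulrC EFinM -muleA.
rewrite -ge0_integralZl//; last 2 first.
  exact: (measurable_integral_fst mu mg g0).
  by move=> y _; exact: integral_ge0.
rewrite ge0_integral_cVS//.
transitivity (`|\det D|%:E * \int[leb]_y \int[mu]_r f (consV (r, D *m y)))%E.
  congr (_ * _)%E; apply: eq_integral => y _; rewrite /g /=.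
  pose h (r : RT) := f (consV (r, D *m y)).
  have mh : measurable_fun setT h.
    by apply: (measurableT_comp mf); exact: measurable_consV_comp.
  have h0 r : (0 <= h r)%E by exact: f0.
  rewrite -(ge0_integral_shift ((b *m y) 0 0) mh)//.
  rewrite -(ge0_integral_dilate (f := fun r => h (r + _)) a0)//.
  by apply: (measurableT_comp mh); exact: measurable_funD.
pose k (r : RT) (y : 'cV[R]_m) := f (consV (r, y)).
have mk : measurable_fun setT (fun p => k p.1 p.2).
  by apply: (measurableT_comp mf); exact: measurable_consV_comp.
have k0 r y : (0 <= k r y)%E by exact: f0.
rewrite [RHS](tonelli mu leb mk k0).
rewrite -[RHS](cD (fun y => \int[mu]_r k r y))%E//.
  exact: (measurable_integral_fst mu mk k0).
by move=> y; exact: integral_ge0.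
Qed.

Lemma change_of_vars_block_ll m (c : 'cV[R]_m) :
  @change_of_vars m.+1 (block_mx 1%:M 0 c 1%:M).
Proof.
move=> f mf f0.
have E r y : block_mx 1%:M 0 c 1%:M *m consV (r, y) = consV (r, y + r *: c).
  rewrite /consV mul_block_col mul0mx addr0 !mul1mx; congr col_mx.
  by rewrite addrC mul_mx_scalar.
rewrite ge0_integral_cVS//; last first.
  by apply: (measurableT_comp mf); exact: measurable_mulmx.
under eq_integral do under eq_integral do rewrite E.
rewrite (@det_lblock _ 1 m) !det1 mulr1 normr1 mul1e [RHS](ge0_integral_cVS mf f0).
apply: eq_integral => r _.
apply: (ge0_integral_cV_shift (f := fun y => f (consV (r, y)))) => //.
by apply: (measurableT_comp mf); exact: measurable_consV_comp.
Qed.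

(** Induction on the dimension.  When the corner entry of [M] is nonzero, [M] is
    the product of a shear and of a block triangular matrix with a smaller
    diagonal block.  When it vanishes, adding to the first row the combination
    of the others with coefficients [c] makes it [|c| ^ 2], where [c] is the rest
    of the first column. *)
Lemma ge0_integral_cV_linear m (M : 'M[R]_m) : \det M != 0 -> change_of_vars M.
Proof.
elim: m M => [|m IHm] M M0.
  move=> f mf f0; rewrite det_mx00 normr1 mul1e.
  by apply: eq_integral => y _; rewrite [y]flatmx0 mulmx0.
have main (N : 'M[R]_(1 + m)) : \det N != 0 -> N 0 0 != 0 ->
    @change_of_vars m.+1 N.
  move=> N0 a0; set a := N 0 0 in a0.
  pose b := ursubmx N; pose c := dlsubmx N; pose D := drsubmx N.
  have NE : N = block_mx 1%:M 0 (a^-1 *: c) 1%:M *m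
      block_mx a%:M b 0 (D - a^-1 *: c *m b).
    rewrite mulmx_block !mul1mx !mul0mx !addr0 -!scalemxAl.
    rewrite mul_mx_scalar scalerA mulVf// scale1r addrC subrK.
    rewrite -[LHS]submxK; congr block_mx.
    rewrite [LHS]mx11_scalar !mxE; congr (N _ _)%:M; exact/val_inj.
  rewrite NE in N0 *; apply: change_of_vars_mul.
    exact: change_of_vars_block_ll.
  apply: change_of_vars_block_ur => //; apply: IHm.
  move: N0; rewrite det_mulmx det_ublock mulf_eq0 negb_or => /andP[_].
  by rewrite mulf_eq0 negb_or => /andP[].
rewrite -[m.+1]/(1 + m)%N in M M0 *.
have [a0|a0] := eqVneq (M 0 0) 0; last exact: main.
pose c : 'cV[R]_m := dlsubmx M.
have UE (u : 'rV[R]_m) : \det (block_mx 1%:M u 0 1%:M : 'M[R]_(1 + m)) = 1.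
  by rewrite det_ublock !det1 mulr1.
have -> : M = block_mx 1%:M (- c^T) 0 1%:M *m (block_mx 1%:M c^T 0 1%:M *m M).
  rewrite mulmxA mulmx_block !mul1mx !mul0mx !mulmx0 !addr0 !add0r !mulmx1.
  by rewrite subrr -scalar_mx_block mul1mx.
apply: change_of_vars_mul.
  apply: change_of_vars_block_ur; first exact: oner_neq0.
  by move=> f mf f0; rewrite det1 normr1 mul1e; under eq_integral do rewrite mul1mx.
apply: main; first by rewrite det_mulmx UE mul1r.
have ME : M = block_mx (ulsubmx M) (ursubmx M)
    c (drsubmx M) by rewrite submxK.
have -> : block_mx 1%:M c^T 0 1%:M *m M =
    block_mx (ulsubmx M + c^T *m c)
      (ursubmx M + c^T *m drsubmx M) c
      (drsubmx M).
  by rewrite {1}ME mulmx_block !mul1mx !mul0mx !add0r.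
rewrite (_ : (0 : 'I_(1 + m)) = lshift m 0); last exact/val_inj.
rewrite block_mxEul mxE.
rewrite (_ : ulsubmx _ 0 0 = 0) ?add0r; last first.
  by rewrite -[RHS]a0 !mxE; congr (M _ _); exact/val_inj.
rewrite mxE; apply: contra M0 => /eqP c0.
have c00 : c = 0.
  apply/matrixP => i j; rewrite ord1 [RHS]mxE; apply/eqP; rewrite -sqrf_eq0.
  have /(psumr_eq0P _) : \sum_i c i 0 ^+ 2 = 0.
    rewrite -[RHS]c0; apply: eq_bigr => k _; rewrite [c^T _ _]mxE expr2.
    by [].
  by move=> /(_ (fun i _ => sqr_ge0 _) i isT) ->.
rewrite ME c00 det_ublock [ulsubmx _]mx11_scalar.
rewrite det_scalar1 (_ : ulsubmx _ 0 0 = 0) ?mul0r//.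
by rewrite -[RHS]a0 !mxE; congr (M _ _); exact/val_inj.
Qed.

End lebesgue_cV_theory.

(** * Products and iterated integrals *)

Section products.
Context {R : realType}.
Local Notation mu := (@lebesgue_measure R).
Local Notation RT := (measurableTypeR R).
Local Notation leb := (@lebesgue_cV R _).

Lemma emeasurable_prod (d : measure_display) (T : measurableType d) (I : Type)
    (s : seq I) (h : I -> T -> \bar R) :
  (forall i, measurable_fun setT (h i)) ->
  measurable_fun setT (fun x => \prod_(i <- s) h i x)%E.
Proof.
move=> mh; elim: s => [|i s IHs].
  by under eq_fun do rewrite big_nil; exact: measurable_cst.
by under eq_fun do rewrite big_cons; exact: emeasurable_funM.
Qed.

Lemma ge0_integral_cV_prod m (phi : 'I_m -> RT -> \bar R) :
  (forall i, measurable_fun setT (phi i)) -> (forall i r, 0 <= phi i r)%E ->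
  (\int[leb]_y \prod_i phi i (y i 0%R) = \prod_i \int[mu]_r phi i r)%E.
Proof.
elim: m phi => [|m IHm] phi mphi phi0.
  under eq_integral do rewrite big_ord0.
  by rewrite big_ord0 integral_cst// mul1e; exact: diracT.
rewrite ge0_integral_cVS; last 2 first.
- apply: emeasurable_prod => i.
  by apply: (measurableT_comp (mphi i)); exact: measurable_coord.
- by move=> y; exact: prode_ge0.
under eq_integral => r _.
  under eq_integral => y _.
    rewrite big_ord_recl consV0.
    under eq_bigr do rewrite consVS.
    over.
  rewrite /= ge0_integralZl//; last 2 first.
  - apply: emeasurable_prod => i.
    by apply: (measurableT_comp (mphi _)); exact: measurable_coord.
  - by move=> y _; exact: prode_ge0.
  rewrite (IHm (fun i => phi (lift ord0 i)))//.
  over.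
rewrite ge0_integralZr//; last by apply: prode_ge0 => i _; exact: integral_ge0.
by rewrite big_ord_recl.
Qed.

Lemma measurable_col m k (j : 'I_k) :
  measurable_fun setT (fun Z : 'M[R]_(m, k) => col j Z).
Proof.
by apply: measurable_fun_mxP => i i'; under eq_fun do rewrite mxE;
  exact: measurable_coord.
Qed.

Lemma col0_row_mx m k (z : 'cV[R]_m) (Z : 'M[R]_(m, k)) :
  col ord0 (row_mx z Z : 'M[R]_(m, k.+1)) = z.
Proof.
by apply/matrixP => i j; rewrite !mxE; case: splitP => // k' _; rewrite !ord1.
Qed.

Lemma colS_row_mx m k (z : 'cV[R]_m) (Z : 'M[R]_(m, k)) j :
  col (lift ord0 j) (row_mx z Z : 'M[R]_(m, k.+1)) = col j Z.
Proof.
apply/matrixP => i j'; rewrite !mxE; case: splitP => k' /=.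
  by rewrite [k']ord1.
by rewrite /bump /= add1n => -[/val_inj ->].
Qed.

Lemma col'0_row_mx m k (z : 'cV[R]_m) (Z : 'M[R]_(m, k)) :
  col' ord0 (row_mx z Z : 'M[R]_(m, k.+1)) = Z.
Proof.
apply/matrixP => i j; have /matrixP/(_ i 0) := colS_row_mx z Z j.
by rewrite !mxE.
Qed.

End products.

Section iterated_integral.
Context {R : realType} {m : nat}.
Local Notation leb := (@lebesgue_cV R m).

(** Integral of a function of [k] vectors of [R^m], stored as the columns of a
    matrix, taken one column at a time. *)
Fixpoint iint k : ('M[R]_(m, k) -> \bar R) -> \bar R :=
  match k with
  | 0 => fun F => F 0
  | k'.+1 => fun F => (\int[leb]_z @iint k' (fun Z => F (row_mx z Z)))%E
  end.

Lemma iint_ge0 k (F : 'M[R]_(m, k) -> \bar R) :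
  (forall Z, 0 <= F Z)%E -> (0 <= iint F)%E.
Proof.
elim: k F => [|k IHk] F F0 //=.
by apply: integral_ge0 => z _; exact: IHk.
Qed.

Lemma measurable_iint k (d : measure_display) (T : measurableType d)
    (F : T -> 'M[R]_(m, k) -> \bar R) :
  measurable_fun setT (fun p => F p.1 p.2) -> (forall t Z, 0 <= F t Z)%E ->
  measurable_fun setT (fun t => iint (F t)).
Proof.
elim: k d T F => [|k IHk] d T F mF F0 /=.
  exact: (measurable_fun_comp2 mF).
apply: (measurable_integral_snd leb
  (f := fun t z => iint (fun Z => F t (row_mx z Z)))) => [|t z]; last first.
  exact: iint_ge0.
apply: (IHk _ _ (fun (p : T * 'cV[R]_m) Z => F p.1 (row_mx p.2 Z))) => [|p Z]; last exact: F0.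
apply: (measurable_fun_comp2 mF).
  by apply: measurableT_comp; exact: measurable_fst.
apply: (@measurable_row_mx _ _ _ m 1 k); last exact: measurable_snd.
exact: measurable_snd_fst.
Qed.

Lemma measurable_row_mx_snd k (F : 'M[R]_(m, k.+1) -> \bar R) :
  measurable_fun setT F ->
  measurable_fun setT
    (fun p : 'cV[R]_m * 'M[R]_(m, k) => F (row_mx p.1 p.2)).
Proof. by move=> mF; apply: measurableT_comp => //; exact: measurable_row_mx. Qed.

Lemma measurable_iint_row_mx k (F : 'M[R]_(m, k.+1) -> \bar R) :
  measurable_fun setT F -> (forall Z, 0 <= F Z)%E ->
  measurable_fun setT (fun z : 'cV[R]_m =>
    iint (fun Z : 'M[R]_(m, k) => F (row_mx z Z))).
Proof.
move=> mF F0.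
apply: (measurable_iint (F := fun (z : 'cV[R]_m) Z => F (row_mx z Z))) => //.
exact: measurable_row_mx_snd.
Qed.

Lemma measurable_row_mx1 k (F : 'M[R]_(m, k.+1) -> \bar R) (z : 'cV[R]_m) :
  measurable_fun setT F ->
  measurable_fun setT (fun Z : 'M[R]_(m, k) => F (row_mx z Z)).
Proof. by move=> mF; apply: measurableT_comp => //; exact: measurable_row_mx. Qed.

Lemma le_iint k (F G : 'M[R]_(m, k) -> \bar R) :
  measurable_fun setT F -> measurable_fun setT G ->
  (forall Z, 0 <= F Z)%E -> (forall Z, F Z <= G Z)%E -> (iint F <= iint G)%E.
Proof.
elim: k F G => [|k IHk] F G mF mG F0 FG //=.
have G0 Z : (0 <= G Z)%E by exact: le_trans (F0 _) (FG _).
apply: ge0_le_integral => //.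
- by move=> z _; exact: iint_ge0.
- exact: measurable_iint_row_mx.
- exact: measurable_iint_row_mx.
by move=> z _; apply: IHk => //; exact: measurable_row_mx1.
Qed.

Lemma eq_iint k (F G : 'M[R]_(m, k) -> \bar R) : F =1 G -> iint F = iint G.
Proof. by move=> /funext ->. Qed.

Lemma iint_tonelli k (d : measure_display) (T : measurableType d)
    (nu : {sigma_finite_measure set T -> \bar R})
    (F : T -> 'M[R]_(m, k) -> \bar R) :
  measurable_fun setT (fun p => F p.1 p.2) -> (forall t Z, 0 <= F t Z)%E ->
  (\int[nu]_t iint (F t) = iint (fun Z => \int[nu]_t F t Z))%E.
Proof.
elim: k F => [|k IHk] F mF F0 //=.
have mF' : measurable_fun setT (fun q : T * 'cV[R]_m * 'M[R]_(m, k) =>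
    F q.1.1 (row_mx q.1.2 q.2)).
  apply: (measurable_fun_comp2 mF).
    by apply: measurableT_comp; exact: measurable_fst.
  apply: (@measurable_row_mx _ _ _ m 1 k); last exact: measurable_snd.
  exact: measurable_snd_fst.
rewrite (tonelli nu leb (f := fun t z => iint (fun Z => F t (row_mx z Z)))).
- apply: eq_integral => z _; apply: (IHk (fun t Z => F t (row_mx z Z))) => //.
  apply: (measurable_fun_comp2 mF); first exact: measurable_fst.
  by apply: (@measurable_row_mx _ _ _ m 1 k) => //; exact: measurable_snd.
- by apply: (measurable_iint
    (F := fun (p : T * 'cV[R]_m) Z => F p.1 (row_mx p.2 Z))) => // p Z.
- by move=> t z; exact: iint_ge0.
Qed.

Lemma iintZl k (F : 'M[R]_(m, k) -> \bar R) (c : \bar R) :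
  measurable_fun setT F -> (forall Z, 0 <= F Z)%E -> (0 <= c)%E ->
  (iint (fun Z => c * F Z) = c * iint F)%E.
Proof.
elim: k F => [|k IHk] F mF F0 c0 //=.
rewrite -ge0_integralZl//; last 2 first.
- exact: measurable_iint_row_mx.
- by move=> z _; exact: iint_ge0.
apply: eq_integral => z _; apply: (IHk (fun Z => F (row_mx z Z))) => //.
exact: measurable_row_mx1.
Qed.

Lemma iint_prod k (h : 'cV[R]_m -> \bar R) :
  measurable_fun setT h -> (forall z, 0 <= h z)%E ->
  (iint (fun Z : 'M[R]_(m, k) => \prod_j h (col j Z)) =
   (\int[leb]_z h z) ^+ k)%E.
Proof.
move=> mh h0; elim: k => [|k IHk] /=; first by rewrite big_ord0.
have mp : measurable_fun setT (fun Z : 'M[R]_(m, k) => \prod_j h (col j Z))%E.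
  by apply: emeasurable_prod => i; apply: (measurableT_comp mh); exact: measurable_col.
have p0 (Z : 'M[R]_(m, k)) : (0 <= \prod_j h (col j Z))%E by exact: prode_ge0.
under eq_integral => z _.
  under eq_iint => Z.
    rewrite big_ord_recl col0_row_mx.
    under eq_bigr do rewrite colS_row_mx.
    over.
  rewrite iintZl// IHk; over.
rewrite [RHS]expeS ge0_integralZr//.
by apply: expe_ge0; exact: integral_ge0.
Qed.

End iterated_integral.

(** * Averages of determinants *)

Section determinant_average.
Context {R : realType}.
Local Notation leb := (@lebesgue_cV R _).

Lemma measurable_det (d : measure_display) (T : measurableType d) k
    (f : T -> 'M[R]_k) :
  measurable_fun setT f -> measurable_fun setT (fun t => \det (f t)).
Proof.
move=> mf; apply: measurable_sum => s; apply: measurable_funM => //.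
by apply: measurable_prod => i _; exact: measurable_mxE.
Qed.

Lemma measurable_prod_col m k (h : 'cV[R]_m -> R) : measurable_fun setT h ->
  measurable_fun setT (fun Z : 'M[R]_(m, k) => \prod_j h (col j Z)).
Proof.
move=> mh; apply: measurable_prod => j _.
by apply: (measurableT_comp mh); exact: measurable_col.
Qed.

(** The hypothesis says that the norm [c |-> int h |c L z|] dominates half of
    each coordinate.  Expanded along its first column [z], the determinant of
    [L Z] is [c L z] with [c] the vector of cofactors; integrating in [z] leaves
    at least half of the cofactor [c 0 0], which is a determinant of the same
    form in the remaining columns. *)
Lemma iint_det_ge m k (h : 'cV[R]_m -> R) (L : 'M[R]_(k, m)) :
  measurable_fun setT h -> (forall z, 0 <= h z) ->
  (forall (c : 'rV[R]_k) i, (`|c 0 i|%:E <=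
     2%:E * \int[leb]_z (h z * `|(c *m L *m z) 0 0|)%:E)%E) ->
  (1 <= (2 ^+ k)%:E * iint (fun Z : 'M[R]_(m, k) =>
     (\prod_j h (col j Z) * `|\det (L *m Z)|)%:E))%E.
Proof.
move=> mh h0; elim: k L => [|k IHk] L HL /=.
  by rewrite big_ord0 det_mx00 normr1 mul1r mul1e.
pose L' : 'M[R]_(k, m) := row' 0 L.
pose c (Z : 'M[R]_(m, k)) : 'rV[R]_k.+1 :=
  \row_i cofactor (L *m (row_mx (0 : 'cV[R]_m) Z : 'M[R]_(m, k.+1))) i 0.
have cE Z : c Z 0 0 = \det (L' *m Z).
  rewrite mxE /cofactor /= addn0 expr0 mul1r; congr (\det _).
  rewrite [col' _ _](_ : _ = L *m Z); last first.
    by rewrite (@mul_mx_row _ _ _ 1 k) col'0_row_mx.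
  apply/matrixP => i j; rewrite !mxE; apply: eq_bigr => l _.
  by rewrite !mxE.
have detE (z : 'cV[R]_m) (Z : 'M[R]_(m, k)) : \det (L *m (row_mx z Z : 'M[R]_(m, k.+1))) =
    (c Z *m L *m z) 0 0.
  rewrite (expand_det_col _ ord0) -mulmxA [RHS]mxE; apply: eq_bigr => i _.
  rewrite mulrC [c Z 0 i]mxE; congr (_ * _).
    by rewrite /cofactor; congr (_ * \det _);
      rewrite !(@mul_mx_row _ _ _ 1 k) !col'0_row_mx.
  rewrite (@mul_mx_row _ _ _ 1 k).
  by have /matrixP/(_ i 0) := col0_row_mx (L *m z) (L *m Z); rewrite mxE.
pose F (z : 'cV[R]_m) (Z : 'M[R]_(m, k)) : \bar R :=
  ((\prod_j h (col j Z)) * (h z * `|\det (L *m (row_mx z Z : 'M[R]_(m, k.+1)))|))%:E.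
have mF : measurable_fun setT (fun p => F p.1 p.2).
  apply/measurable_EFinP; apply: measurable_funM.
    by apply: (measurableT_comp (measurable_prod_col mh)); exact: measurable_snd.
  apply: measurable_funM.
    by apply: (measurableT_comp mh); exact: measurable_fst.
  apply: measurableT_comp => //; apply: measurable_det.
  apply: measurable_mulmx => //.
  apply: (@measurable_row_mx _ _ _ m 1 k); first exact: measurable_fst.
  exact: measurable_snd.
have F0 z Z : (0 <= F z Z)%E.
  by rewrite lee_fin mulr_ge0// ?mulr_ge0//; apply: prodr_ge0.
have -> : (\int[leb]_z iint (fun Z : 'M[R]_(m, k) =>
   (\prod_j h (col j (row_mx z Z)) * `|\det (L *m row_mx z Z)|)%:E) =
   \int[leb]_z iint (F z))%E.
  apply: eq_integral => z _; apply: eq_iint => Z; rewrite /F.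
  rewrite big_ord_recl col0_row_mx mulrCA mulrA; congr (_ * _ * _)%:E.
  by apply: eq_bigr => j _; rewrite colS_row_mx.
rewrite iint_tonelli//.
have HL' (c' : 'rV[R]_k) i : (`|c' 0 i|%:E <=
    2%:E * \int[leb]_z (h z * `|(c' *m L' *m z) 0 0|)%:E)%E.
  have := HL (row_mx 0 c' : 'rV[R]_(1 + k)) (lift ord0 i).
  have -> : (row_mx 0 c' : 'rV[R]_(1 + k)) *m L = c' *m L'.
    apply/matrixP => a b; rewrite !mxE big_ord_recl [X in X * _]mxE.
    case: splitP => // b' _; rewrite mxE mul0r add0r.
    apply: eq_bigr => l _; have /matrixP/(_ a 0) := colS_row_mx (0 : 'cV[R]_1) c' l.
    by rewrite !mxE => ->.
  have /matrixP/(_ 0 0) := colS_row_mx (0 : 'cV[R]_1) c' i.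
  by rewrite !mxE => ->.
apply: le_trans (IHk L' HL') _.
rewrite exprSr EFinM -muleA; apply: lee_wpmul2l.
  by rewrite lee_fin exprn_ge0.
have mG : measurable_fun setT (fun Z : 'M[R]_(m, k) => \int[leb]_z F z Z)%E.
  exact: measurable_integral_fst mF F0.
rewrite -iintZl//; last by move=> Z; exact: integral_ge0.
apply: le_iint.
- apply/measurable_EFinP; apply: measurable_funM.
    exact: measurable_prod_col.
  apply: measurableT_comp => //; apply: measurable_det.
  exact: measurable_mulmx.
- exact: measurable_funeM.
- by move=> Z; rewrite lee_fin mulr_ge0//; apply: prodr_ge0.
move=> Z; rewrite -cE /F.
under eq_integral => z _ do rewrite EFinM detE.
rewrite ge0_integralZl_EFin//.
- rewrite muleCA EFinM; apply: lee_wpmul2l.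
    by rewrite lee_fin; apply: prodr_ge0.
  exact: HL.
- by move=> z _; rewrite lee_fin mulr_ge0.
- apply/measurable_EFinP; apply: measurable_funM => //.
  apply: measurableT_comp => //; apply: measurable_mxE.
  exact: measurable_mulmx.
by apply: prodr_ge0.
Qed.

End determinant_average.

(** * Integrals of powers on the line *)

Section power_integrals.
Context {R : realType}.
Local Notation mu := (@lebesgue_measure R).
Local Notation RT := (measurableTypeR R).

Lemma nneseries_geometric_lty (C x : R) : 0 <= C -> 0 <= x < 1 ->
  (\sum_(k <oo) (C * x ^+ k)%:E < +oo)%E.
Proof.
move=> C0 /andP[x0 x1].
have b n : (\sum_(0 <= k < n) (C * x ^+ k)%:E <= (C / (1 - x))%:E)%E.
  rewrite sumEFin lee_fin.
  have := congr1 (fun f => f n) (geometric_seriesE C (negbT (lt_eqF x1))).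
  rewrite /series /geometric /= => ->.
  rewrite ler_pM2r ?invr_gt0 ?subr_gt0// ler_piMr// gerBl exprn_ge0//.
apply: (@le_lt_trans _ _ (C / (1 - x))%:E); last exact: ltry.
apply: lime_le; last exact: nearW.
by apply: is_cvg_nneseries => n _ _; rewrite lee_fin mulr_ge0// exprn_ge0.
Qed.

(** A function that is at most [u k] on the shell [|r| <= rho k] is integrable
    as soon as the products [u k * rho k] decay geometrically. *)
Lemma ge0_integral_shells_lty (f : RT -> R) (u rho : nat -> R) (C x : R) :
  measurable_fun setT f -> (forall r, 0 <= f r) ->
  (forall k, 0 <= u k) -> (forall k, 0 <= rho k) -> 0 <= C -> 0 <= x < 1 ->
  (forall k, u k * rho k <= C * x ^+ k) ->
  (forall r : R, f r != 0 -> exists k, f r <= u k /\ `|r| <= rho k) ->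
  (\int[mu]_r (f r)%:E < +oo)%E.
Proof.
move=> mf f0 u0 rho0 C0 x01 urho fH.
pose B k : set RT := `[- rho k, rho k]%classic.
pose g k (r : RT) : \bar R := (u k * \1_(B k) r)%:E.
have mB k : measurable (B k) by exact: measurable_itv.
have mg k : measurable_fun setT (g k).
  by apply/measurable_EFinP; exact: measurable_funM.
have g0 k r : (0 <= g k r)%E by rewrite lee_fin mulr_ge0.
have Ig k : (\int[mu]_r g k r <= (2 * C * x ^+ k)%:E)%E.
  under eq_integral do rewrite /g EFinM.
  rewrite ge0_integralZl_EFin//; last first.
    by apply/measurable_EFinP; exact: measurable_indic.
  rewrite integral_indic// setIT [X in (_ * X)%E]lebesgue_measure_itv /= lte_fin.
  case: ifP => _; last first.
    rewrite mule0 lee_fin; apply: mulr_ge0; first exact: mulr_ge0.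
    by apply: exprn_ge0; case/andP: x01.
  rewrite -EFinB -EFinM lee_fin opprK -mulr2n mulrnAr -mulr_natl -mulrA.
  by rewrite ler_pM2l.
apply: (@le_lt_trans _ _ (\int[mu]_r \sum_(k <oo) g k r)%E).
  apply: ge0_le_integral => //.
  - by move=> r _; rewrite lee_fin.
  - exact/measurable_EFinP.
  - by apply: ge0_emeasurable_sum => // k r _ _; exact: g0.
  move=> r _; have [->|fr0] := eqVneq (f r) 0; first exact: nneseries_ge0.
  have [k [fk rk]] := fH _ fr0.
  apply: le_trans (nneseries_lim_ge k.+1 _) => //.
  rewrite big_nat_recr//= -[leLHS]add0e leeD//; first exact: sume_ge0.
  rewrite /g indicE mem_set ?mulr1 ?lee_fin// /B /= in_itv/=.
  by rewrite -ler_norml.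
rewrite integral_nneseries//.
apply: le_lt_trans (nneseries_geometric_lty (mulr_ge0 (ler0n _ 2) C0) x01).
by apply: lee_nneseries => // k _ _; exact: integral_ge0.
Qed.

Lemma exists_expn_gt (r : R) : exists k, r < 2 ^+ k.
Proof.
exists (Num.bound `|r|); apply: le_lt_trans (ler_norm _) _.
apply: lt_le_trans (archi_boundP (normr_ge0 r)) _.
by rewrite -natrX ler_nat; apply: ltnW; exact: ltn_expl.
Qed.

Lemma powR2_lt1 (a : R) : a < 0 -> 0 <= 2 `^ a < 1.
Proof.
move=> a0; rewrite powR_ge0/=.
rewrite -[a]opprK powRN invf_lt1 ?powR_gt0//.
have E : 1 `^ (- a) = 1 :> R by rewrite powR1.
by rewrite -[ltLHS]E gt0_ltr_powR ?nnegrE ?oppr_gt0// ltr1n.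
Qed.

Lemma tail_power_lty (a : R) : 1 < a ->
  (\int[mu]_r (Num.max 1 `|r| `^ (- a))%:E < +oo)%E.
Proof.
move=> a1.
apply: (@ge0_integral_shells_lty _ (fun k => (2 ^+ k) `^ (- a))
  (fun k => 2 ^+ k.+1) 2 (2 `^ (1 - a))).
- apply: (measurableT_comp (measurable_powR _)).
  by apply: measurable_maxr => //; exact: measurableT_comp.
- by move=> r; exact: powR_ge0.
- by move=> k; exact: powR_ge0.
- by move=> k; exact: exprn_ge0.
- by [].
- by apply: powR2_lt1; rewrite subr_lt0.
- move=> k; rewrite exprS mulrCA ler_pM2l//.
  rewrite -!powR_mulrn// ?powR_ge0// -!powRrM -powRD; last by rewrite pnatr_eq0 implybT.
  by apply: eq_lexx; congr powR; ring.
move=> r _.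
have ex : exists k, `|r| < 2 ^+ k.+1.
  have [k rk] := exists_expn_gt `|r|; exists k.
  by rewrite (lt_le_trans rk)// ler_weXn2l// ler1n.
have [k rk kmin] := ex_minnP ex; exists k; split; last exact: ltW.
have a0 : 0 <= a by rewrite ltW// (lt_trans ltr01 a1).
have m1 : 1 <= Num.max 1 `|r| by rewrite le_max lexx.
have le_inv y : 0 < y -> y <= Num.max 1 `|r| ->
    Num.max 1 `|r| `^ (- a) <= y `^ (- a).
  move=> y0 yr; rewrite !powRN lef_pV2 ?posrE ?powR_gt0// ?(lt_le_trans y0)//.
  by rewrite ge0_ler_powR ?nnegrE// ltW// (lt_le_trans y0).
apply: le_inv; first exact: exprn_gt0.
case: k kmin {rk} => [|k] kmin; first by rewrite expr0.
rewrite le_max; apply/orP; right.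
by rewrite leNgt; apply/negP => /kmin; rewrite ltnn.
Qed.

Lemma local_power_lty (b : R) : 0 < b < 1 ->
  (\int[mu]_r (`|r| `^ (- b) * \1_(`[-2, 2]%classic : set RT) r)%:E < +oo)%E.
Proof.
move=> /andP[b0 b1].
apply: (@ge0_integral_shells_lty _ (fun k => (2 ^+ k) `^ b)
  (fun k => 2 * 2 ^- k) 2 (2 `^ (b - 1))).
- apply: measurable_funM.
    by apply: (measurableT_comp (measurable_powR _)); exact: normr_measurable.
  by apply: measurable_indic; exact: measurable_itv.
- by move=> r; rewrite mulr_ge0// powR_ge0.
- by move=> k; exact: powR_ge0.
- by move=> k; rewrite mulr_ge0// invr_ge0 exprn_ge0.
- by [].
- by apply: powR2_lt1; rewrite subr_lt0.
- move=> k; rewrite mulrCA ler_pM2l//.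
  rewrite -!powR_mulrn// ?powR_ge0// -powRN -!powRrM -powRD; last first.
    by rewrite pnatr_eq0 implybT.
  by apply: eq_lexx; congr powR; ring.
move=> r fr0.
have r0 : 0 < `|r|.
  rewrite normr_gt0; apply: contraNneq fr0 => ->.
  by rewrite normr0 powR0 ?mul0r// oppr_eq0 gt_eqF.
have r2 : `|r| <= 2.
  move: fr0; apply: contraNT => r2; rewrite indicE memNset ?mulr0//=.
  by rewrite in_itv/= -ler_norml; exact/negP.
have ex : exists k, `|r|^-1 < 2 ^+ k by exact: exists_expn_gt.
have [k rk kmin] := ex_minnP ex; exists k; split.
  apply: (@le_trans _ _ (`|r| `^ (- b))).
    by rewrite ler_piMr ?powR_ge0// indicE; case: (_ \in _).
  rewrite -[- b]mulN1r powRrM powR_inv1//.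
  by rewrite ge0_ler_powR ?nnegrE ?exprn_ge0 ?invr_ge0// ltW.
case: k kmin {rk} => [|k] kmin; first by rewrite expr0 invr1 mulr1.
have : 2 ^+ k <= `|r|^-1.
  by rewrite leNgt; apply/negP => /kmin; rewrite ltnn.
rewrite -[leRHS]mul1r ler_pdivlMr// => kr.
by rewrite exprS invfM mulrA divff ?pnatr_eq0// mul1r -[leRHS]mul1r ler_pdivlMr ?exprn_gt0// mulrC.
Qed.

End power_integrals.

(** * The determinant inequality *)

Section determinant_inequality.
Context {R : realType} {m : nat}.
Hypothesis m0 : (0 < m)%N.
Local Notation leb := (@lebesgue_cV R m).
Local Notation mu := (@lebesgue_measure R).
Local Notation RT := (measurableTypeR R).

(** The exponent is above [1], so that [decay] is integrable, yet the product of
    [m] values is as large as the power [- m.+1] of their total size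
    ([prod_decay_ge]). *)
Definition decay (r : R) : R := Num.max 1 `|r| `^ (- (m.+1%:R / m%:R)).

Definition decay_mass : R := fine (\int[mu]_r (decay r)%:E)%E.

Lemma measurable_decay : measurable_fun [set: RT] decay.
Proof.
apply: (measurableT_comp (measurable_powR _)).
by apply: measurable_maxr => //; exact: measurableT_comp.
Qed.

Lemma decay_ge0 r : 0 <= decay r. Proof. exact: powR_ge0. Qed.

Lemma integral_decay : (\int[mu]_r (decay r)%:E = decay_mass%:E)%E.
Proof.
rewrite fineK// ge0_fin_numE; last first.
  by apply: integral_ge0 => r _; rewrite lee_fin decay_ge0.
apply: tail_power_lty.
by rewrite ltr_pdivlMr ?ltr0n// mul1r ltr_nat.
Qed.

Lemma decay_mass_ge0 : 0 <= decay_mass.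
Proof. by apply: fine_ge0; apply: integral_ge0 => r _; rewrite lee_fin decay_ge0. Qed.

Lemma prod_decay_ge (w : 'cV[R]_m) :
  Num.max 1 (\sum_i `|w i 0|) ^- m.+1 <= \prod_i decay (w i 0).
Proof.
set A : R := \sum_i _.
have m1 : 0 < Num.max 1 A by rewrite lt_max ltr01.
have -> : Num.max 1 A ^- m.+1 =
    \prod_(i < m) Num.max 1 A `^ (- (m.+1%:R / m%:R)).
  rewrite prodr_const card_ord -powR_mulrn ?powR_ge0// -powRrM mulNr divfK.
    by rewrite powRN powR_mulrn// ltW.
  by rewrite pnatr_eq0 -lt0n.
apply: ler_prod => i _; rewrite powR_ge0/= /decay !powRN.
have wA : Num.max 1 `|w i 0| <= Num.max 1 A.
  rewrite ge_max !le_max lexx/=; apply/orP; right.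
  by rewrite /A (bigD1 i)//= lerDl sumr_ge0.
have w1 : 0 < Num.max 1 `|w i 0| by rewrite lt_max ltr01.
rewrite lef_pV2 ?posrE ?powR_gt0// ge0_ler_powR ?nnegrE ?(ltW w1) ?(ltW m1)//.
Qed.

(** Either [G] is so large that one more factor [eps * G * sum |w_i|] costs
    nothing, or [G] is bounded by a multiple of [1 / sum |w_i|]. *)
Lemma power_le_weight_decay (G S eps : R) (w : 'cV[R]_m) :
  0 <= G <= S -> 0 < eps ->
  G ^+ m.+1 <= eps * (G ^+ m.+2 * \sum_i `|w i 0|) +
    S ^+ m.+1 * \prod_i decay ((eps * S) * w i 0).
Proof.
move=> /andP[G0 GS] eps0; set A : R := \sum_i _.
have S0 : 0 <= S by exact: le_trans GS.
have A0 : 0 <= A by exact: sumr_ge0.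
have P0 : 0 <= \prod_i decay (eps * S * w i 0).
  by apply: prodr_ge0 => i _; exact: decay_ge0.
have [big|small] := leP 1 (eps * G * A).
  rewrite ler_wpDr//; first by rewrite mulr_ge0// exprn_ge0.
  have -> : eps * (G ^+ m.+2 * A) = G ^+ m.+1 * (eps * G * A).
    by rewrite [G ^+ m.+2]exprSr; ring.
  by rewrite ler_peMr// exprn_ge0.
rewrite ler_wpDl//.
  by rewrite mulr_ge0 ?(ltW eps0)// mulr_ge0// exprn_ge0.
have -> : \prod_i decay (eps * S * w i 0) =
    \prod_i decay ((eps * S *: w) i 0) by apply: eq_bigr => i _; rewrite mxE.
apply: le_trans (ler_wpM2l (exprn_ge0 _ S0) (prod_decay_ge _)).
have -> : \sum_i `|(eps * S *: w) i 0| = eps * S * A.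
  rewrite mulr_sumr; apply: eq_bigr => i _.
  by rewrite mxE normrM ger0_norm// mulr_ge0// ltW.
set M := Num.max _ _; have M0 : 0 < M by rewrite lt_max ltr01.
rewrite ler_pdivlMr ?exprn_gt0// -exprMn lerXn2r ?nnegrE ?mulr_ge0 ?(ltW M0)//.
rewrite /M maxr_pMr// ge_max mulr1 GS/=.
have -> : G * (eps * S * A) = S * (eps * G * A) by ring.
by rewrite ler_piMr// ltW.
Qed.

Section fixed_function.
Variables (G : 'cV[R]_m -> R) (S I : R).
Hypotheses (mG : measurable_fun setT G) (G0 : forall z, 0 <= G z)
  (GS : forall z, G z <= S) (S0 : 0 < S) (I0 : 0 < I)
  (GI : (\int[leb]_z (G z ^+ m.+1)%:E = I%:E)%E)
  (Gfin : forall i, (\int[leb]_z (G z ^+ m.+2 * `|z i 0|)%:E < +oo)%E).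

Definition moment (l : 'rV[R]_m) : \bar R :=
  (\int[leb]_z (G z ^+ m.+2 * `|(l *m z) 0 0|)%:E)%E.

Lemma measurable_moment_fun (l : 'rV[R]_m) :
  measurable_fun setT (fun z => G z ^+ m.+2 * `|(l *m z) 0 0|).
Proof.
apply: measurable_funM; first exact: measurable_funX.
apply: measurableT_comp => //; apply: measurable_mxE; exact: measurable_mulmx.
Qed.

Lemma moment_fun_ge0 (l : 'rV[R]_m) z : 0 <= G z ^+ m.+2 * `|(l *m z) 0 0|.
Proof. by rewrite mulr_ge0// exprn_ge0. Qed.

Lemma moment_ge0 l : (0 <= moment l)%E.
Proof. by apply: integral_ge0 => z _; rewrite lee_fin moment_fun_ge0. Qed.

Lemma momentZ (k : R) l : 0 <= k -> moment (k *: l) = (k%:E * moment l)%E.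
Proof.
move=> k0; rewrite /moment -ge0_integralZl_EFin//; last 2 first.
- by move=> z _; rewrite lee_fin moment_fun_ge0.
- by apply/measurable_EFinP; exact: measurable_moment_fun.
apply: eq_integral => z _; rewrite -EFinM -scalemxAl [X in `|X|]mxE normrM.
by rewrite (ger0_norm k0); congr EFin; ring.
Qed.

Definition det_const : R := 2 * (2 * m%:R) ^+ m * decay_mass ^+ m.

(** Integrate [power_le_weight_decay] at [w = L z].  The moments bound the first
    term by [eps * m], and the substitution [w = L z] evaluates the second, with
    the factor [1 / |det L|].  The choice of [eps] makes the first term half of
    [I]. *)
Lemma det_le_of_moments (L : 'M[R]_m) : \det L != 0 ->
  (forall i, moment (row i L) <= 1)%E ->
  `|\det L| * I ^+ m.+1 <= det_const * S.
Proof.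
move=> L0 HL.
have mR0 : (0 : R) < m%:R by rewrite ltr0n.
pose eps : R := I / (2 * m%:R).
have eps0 : 0 < eps by rewrite divr_gt0// mulr_gt0.
have lam0 : 0 < eps * S by rewrite mulr_gt0.
pose psi (w : 'cV[R]_m) : \bar R := (\prod_i (decay (w i 0%R))%:E)%E.
have psi0 w : (0 <= psi w)%E by apply: prode_ge0 => i _; rewrite lee_fin decay_ge0.
have mpsi : measurable_fun setT psi.
  apply: emeasurable_prod => i; apply/measurable_EFinP.
  by apply: (measurableT_comp measurable_decay); exact: measurable_coord.
have Ipsi : (\int[leb]_w psi w = (decay_mass ^+ m)%:E)%E.
  rewrite (ge0_integral_cV_prod (phi := fun _ r => (decay r)%:E)).
  - under eq_bigr do rewrite integral_decay.
    by rewrite prodEFin prodr_const card_ord.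
  - by move=> i; apply/measurable_EFinP; exact: measurable_decay.
  - by move=> i r; rewrite lee_fin decay_ge0.
have dL : \det ((eps * S) *: L) != 0.
  by rewrite detZ mulf_neq0// expf_neq0// gt_eqF.
have := ge0_integral_cV_linear dL mpsi psi0.
rewrite Ipsi detZ normrM normrX (gtr0_norm lam0) => cov.
set J : \bar R := (\int[leb]_z psi (_ *m z))%E in cov.
have K0 : 0 < (eps * S) ^+ m * `|\det L|.
  by rewrite mulr_gt0 ?exprn_gt0// normr_gt0.
have JE : J = (decay_mass ^+ m / ((eps * S) ^+ m * `|\det L|))%:E.
  rewrite -[J]mul1e -(mulVf (negbT (gt_eqF K0))) EFinM -muleA cov -EFinM.
  by rewrite mulrC.
have step : (I%:E <= (eps * m%:R)%:E + (S ^+ m.+1)%:E * J)%E.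
  have mm i : measurable_fun setT
      (fun z => (G z ^+ m.+2 * `|(row i L *m z) 0 0|)%:E).
    by apply/measurable_EFinP; exact: measurable_moment_fun.
  have mS : measurable_fun setT
      (fun z => eps%:E * \sum_i (G z ^+ m.+2 * `|(row i L *m z) 0%R 0%R|)%:E)%E.
    by apply: measurable_funeM; exact: emeasurable_sum.
  have mP : measurable_fun setT
      (fun z => (S ^+ m.+1)%:E * psi (eps * S *: L *m z)%R)%E.
    apply: measurable_funeM; apply: (measurableT_comp mpsi).
    exact: measurable_mulmx.
  have s0 z : (0 <= \sum_i (G z ^+ m.+2 * `|(row i L *m z) 0%R 0%R|)%:E)%E.
    by apply: sume_ge0 => i _; rewrite lee_fin moment_fun_ge0.
  have S0' : 0 <= S ^+ m.+1 by rewrite exprn_ge0// ltW.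
  rewrite -GI.
  apply: (@le_trans _ _ (\int[leb]_z
     (eps%:E * \sum_i (G z ^+ m.+2 * `|(row i L *m z) 0%R 0%R|)%:E +
      (S ^+ m.+1)%:E * psi (eps * S *: L *m z)%R))%E).
    apply: ge0_le_integral => //.
    - by move=> z _; rewrite lee_fin exprn_ge0.
    - by apply/measurable_EFinP; exact: measurable_funX.
    - exact: emeasurable_funD.
    move=> z _; rewrite sumEFin -mulr_sumr /psi prodEFin -!EFinM -EFinD lee_fin.
    have GzS : 0 <= G z <= S by rewrite G0 GS.
    apply: le_trans (power_le_weight_decay (L *m z) GzS eps0) _.
    apply: eq_lexx; congr (_ * (_ * _) + _ * _).
      by apply: eq_bigr => i _; rewrite -row_mul [in RHS]mxE.
    by apply: eq_bigr => i _; rewrite -scalemxAl [in RHS]mxE.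
  rewrite ge0_integralD//; last 2 first.
  - by move=> z _; rewrite mule_ge0// lee_fin ltW.
  - by move=> z _; rewrite mule_ge0.
  rewrite ge0_integralZl_EFin ?(ltW eps0)//; last exact: emeasurable_sum.
  rewrite ge0_integralZl_EFin//; last first.
    by apply: (measurableT_comp mpsi); exact: measurable_mulmx.
  apply: leeD => //.
  rewrite ge0_integral_sum//; last first.
    by move=> i z _; rewrite lee_fin moment_fun_ge0.
  rewrite [leRHS]EFinM; apply: lee_wpmul2l; first by rewrite lee_fin ltW.
  apply: le_trans (lee_sum _ (fun i _ => HL i)) _.
  by rewrite sumEFin sumr_const card_ord.
move: step; rewrite JE -EFinM -EFinD lee_fin.
have -> : eps * m%:R = I / 2.
  by rewrite /eps; field; rewrite gt_eqF.
rewrite -lerBlDl (_ : I - I / 2 = I / 2); last by field.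
set d : R := `|\det L|; have d0 : 0 < d by rewrite normr_gt0.
pose q : R := 2 * m%:R; have q0 : 0 < q by rewrite mulr_gt0.
have -> : S ^+ m.+1 * (decay_mass ^+ m / ((eps * S) ^+ m * d)) =
    S * decay_mass ^+ m * q ^+ m / (I ^+ m * d).
  rewrite /eps -/q [(I / q * S) ^+ m]exprMn [(I / q) ^+ m]exprMn exprVn exprSr.
  by field; rewrite !expf_neq0 ?gt_eqF.
rewrite ler_pdivlMr ?mulr_gt0 ?exprn_gt0// => H.
rewrite /det_const -/q exprSr.
have -> : d * (I ^+ m * I) = 2 * (I / 2 * (I ^+ m * d)) by field.
have -> : 2 * q ^+ m * decay_mass ^+ m * S = 2 * (S * decay_mass ^+ m * q ^+ m).
  by ring.
by rewrite ler_pM2l.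
Qed.

Lemma det_replace_row (L : 'M[R]_m) (c : 'rV[R]_m) (i : 'I_m) :
  \det (\matrix_(a, b) if a == i then (c *m L) 0 b else L a b) =
  c 0 i * \det L.
Proof.
set L' := \matrix_(a, b) _.
rewrite (expand_det_row L' i).
transitivity (\sum_j (c *m L) 0 j * cofactor L i j).
  apply: eq_bigr => j _; rewrite mxE eqxx; congr (_ * (_ * \det _)).
  apply/matrixP => a b; rewrite !mxE eq_sym.
  by rewrite (negbTE (neq_lift _ _)).
transitivity ((c *m L *m \adj L) 0 i).
  by rewrite [RHS]mxE; apply: eq_bigr => j _; rewrite [\adj L _ _]mxE.
by rewrite -mulmxA mul_mx_adj mul_mx_scalar mxE mulrC.
Qed.

(** Vectors [l] with [moment l <= 1] form the unit ball of a norm; rows that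
    nearly maximise the determinant within it are a basis in which coordinates
    are controlled by that norm. *)
Lemma exists_auerbach_basis : exists2 L : 'M[R]_m, \det L != 0 &
  (forall i, moment (row i L) <= 1)%E /\
  forall (c : 'rV[R]_m) i, (`|c 0 i|%:E <= 2%:E * moment (c *m L))%E.
Proof.
pose D : set R := [set `|\det L| | L in [set L : 'M[R]_m |
  forall i, (moment (row i L) <= 1)%E]].
have Dub x : D x -> x <= det_const * S / I ^+ m.+1.
  move=> [L HL <-]; rewrite ler_pdivlMr ?exprn_gt0//.
  have [->|L0] := eqVneq (\det L) 0; last exact: det_le_of_moments.
  rewrite normr0 mul0r mulr_ge0// ?(ltW S0)// /det_const.
  by rewrite !mulr_ge0 ?exprn_ge0 ?mulr_ge0// decay_mass_ge0.
pose W i : R := fine (moment (delta_mx 0 i)).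
have WE i : moment (delta_mx 0 i) = (W i)%:E.
  rewrite fineK// ge0_fin_numE ?moment_ge0//.
  rewrite /moment; under eq_integral do rewrite -rowE mxE.
  exact: Gfin.
have W0 i : 0 <= W i by rewrite -lee_fin -WE moment_ge0.
(* A small multiple of the identity is admissible, so the supremum is positive. *)
pose k : R := (1 + \sum_i W i)^-1.
have k0 : 0 < k by rewrite invr_gt0 ltr_pwDl// sumr_ge0.
have Dk : D (k ^+ m).
  exists k%:M; last by rewrite det_scalar ger0_norm// exprn_ge0// ltW.
  move=> i; rewrite (_ : row i k%:M = k *: delta_mx 0 i); last first.
    by apply/rowP => j; rewrite !mxE eqxx/= eq_sym mulr_natr.
  rewrite (momentZ _ (ltW k0)) WE -EFinM lee_fin /k mulrC ler_pdivrMr.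
    by rewrite mul1r (bigD1 i)//= ler_wpDl// lerDl sumr_ge0.
  by rewrite ltr_pwDl// sumr_ge0.
have hs : has_sup D.
  by split; [exists (k ^+ m)|exists (det_const * S / I ^+ m.+1) => x; exact: Dub].
pose sg := sup D.
have sg0 : 0 < sg.
  by apply: (lt_le_trans (exprn_gt0 m k0)); apply: ub_le_sup => //; case: hs.
have sg2 : 0 < sg / 2 by rewrite divr_gt0.
have [_ [L HL <-] dL] := sup_adherent sg2 hs.
rewrite -/sg in dL.
have {}dL : sg < 2 * `|\det L| by lra.
have L0 : \det L != 0.
  rewrite -normr_gt0; lra.
exists L => //; split => // c i.
have key (t : R) : 0 <= t -> (t%:E * moment (c *m L) <= 1)%E ->
    t * `|c 0 i| <= 2.
  move=> t0 tc.
  pose L' : 'M[R]_m := \matrix_(a, b) if a == i then (t *: c *m L) 0 b else L a b.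
  have DL' : D `|\det L'|.
    exists L' => // a; have [->|ai] := eqVneq a i.
      rewrite (_ : row i L' = t *: (c *m L)) ?momentZ//.
      by apply/matrixP => x y; rewrite ord1 [LHS]mxE [LHS]mxE eqxx scalemxAl.
    rewrite (_ : row a L' = row a L)//.
    by apply/matrixP => x y; rewrite !mxE (negbTE ai).
  have : `|\det L'| <= sg by apply: ub_le_sup => //; case: hs.
  rewrite det_replace_row mxE !normrM (ger0_norm t0) => H.
  have d0 : 0 < `|\det L| by rewrite normr_gt0.
  by rewrite -(ler_pM2r d0); apply: le_trans H (ltW dL).
have [foo|] := eqVneq (moment (c *m L)) +oo%E.
  by rewrite foo gt0_muley ?leey// lte_fin.
rewrite -ltey => Mlt.
have Mfin : moment (c *m L) = (fine (moment (c *m L)))%:E.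
  by rewrite fineK// ge0_fin_numE ?moment_ge0.
have := moment_ge0 (c *m L); rewrite Mfin lee_fin; rewrite Mfin in key.
set M := fine _ in key *; rewrite le_eqVlt => /predU1P[M0|M0]; last first.
  rewrite -EFinM lee_fin.
  have := key M^-1; rewrite invr_ge0 ltW// => /(_ isT).
  rewrite -EFinM mulVf ?gt_eqF// lexx => /(_ isT).
  by rewrite mulrC ler_pdivrMr.
rewrite -M0 mule0 lee_fin leNgt; apply/negP => c0.
have := key (3 / `|c 0 i|); rewrite -M0 mule0 lee_fin ler01 divr_ge0// => /(_ isT isT).
by rewrite divfK ?gt_eqF//; lra.
Qed.

(** For the forms of [exists_auerbach_basis], [iint_det_ge] bounds below the
    average of [|det (L Z)| = |det L| |det Z|], and [det_le_of_moments] bounds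
    [|det L|] above. *)
Lemma power_integral_le_det :
  ((I ^+ m.+1)%:E <= (det_const * 2 ^+ m * S)%:E *
    iint (fun Z : 'M[R]_(m, m) =>
      (\prod_j (G (col j Z) ^+ m.+2) * `|\det Z|)%:E))%E.
Proof.
have [L L0 [HL HL2]] := exists_auerbach_basis.
have mh : measurable_fun setT (fun z => G z ^+ m.+2) by exact: measurable_funX.
have h0 z : 0 <= G z ^+ m.+2 by rewrite exprn_ge0.
have := iint_det_ge mh h0 HL2.
under eq_iint do rewrite det_mulmx normrM mulrCA EFinM.
rewrite iintZl//; last 2 first.
- apply/measurable_EFinP; apply: measurable_funM; first exact: (measurable_prod_col mh).
  by apply: measurableT_comp => //; exact: measurable_det.
- by move=> Z; rewrite lee_fin mulr_ge0// prodr_ge0.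
set J := iint _ => H.
have J0 : (0 <= J)%E.
  by apply: iint_ge0 => Z; rewrite lee_fin mulr_ge0// prodr_ge0.
rewrite -[leLHS]mule1.
apply: le_trans (lee_wpmul2l _ H) _; first by rewrite lee_fin exprn_ge0// ltW.
rewrite !muleA -!EFinM; apply: lee_wpmul2r => //; rewrite lee_fin.
have -> : det_const * 2 ^+ m * S = det_const * S * 2 ^+ m by ring.
have -> : I ^+ m.+1 * 2 ^+ m * `|\det L| = `|\det L| * I ^+ m.+1 * 2 ^+ m.
  by ring.
by rewrite ler_pM2r ?exprn_gt0//; exact: det_le_of_moments.
Qed.

End fixed_function.
End determinant_inequality.

(** * Truncation *)

Section truncation.
Context {R : realType}.

Lemma expe_poweR (x : \bar R) k : (0 <= x)%E -> (x ^+ k.+1 = x `^ k.+1%:R)%E.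
Proof.
case: x => [x|_|]//.
  by rewrite lee_fin => x0; rewrite -EFin_expe poweR_EFin powR_mulrn.
rewrite poweRyr//.
by elim: k => // k IHk; rewrite expeS IHk mulyy.
Qed.

Lemma le_expe (x y : \bar R) k : (0 <= x)%E -> (x <= y)%E ->
  (x ^+ k <= y ^+ k)%E.
Proof.
move=> x0 xy; elim: k => // k IHk; rewrite !expeS; apply: lee_pmul => //.
exact: expe_ge0.
Qed.

Lemma le_poweR (x y : \bar R) (r : R) : 0 <= r -> (0 <= x)%E -> (x <= y)%E ->
  (x `^ r <= y `^ r)%E.
Proof.
move=> r0 x0 xy; apply: gt0_ler_poweR => //; rewrite in_itv/= leey andbT//.
exact: le_trans xy.
Qed.

Lemma expe_cvg_le (a : nat -> \bar R) (l B : \bar R) k :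
  (forall j, 0 <= a j)%E -> a @ \oo --> l -> (forall j, a j ^+ k.+1 <= B)%E ->
  (l ^+ k.+1 <= B)%E.
Proof.
move=> a0 al aB.
have kV : k.+1%:R * k.+1%:R^-1 = 1 :> R by rewrite mulfV// pnatr_eq0.
have B0 : (0 <= B)%E by apply: le_trans (aB 0%N); exact: expe_ge0.
have l0 : (0 <= l)%E by apply: (cvge_to_ge al); exact: nearW.
have : (l <= B `^ k.+1%:R^-1)%E.
  apply: (cvge_to_le al); apply: nearW => j.
  rewrite -[a j]poweRe1// -[X in (_ `^ X <= _)%E]kV poweRrM -expe_poweR//.
  by apply: le_poweR => //; exact: expe_ge0.
move=> /(le_expe k.+1 l0) /le_trans; apply.
by rewrite expe_poweR ?poweR_ge0// -poweRrM mulrC kV poweRe1.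
Qed.

Context {m : nat}.
Local Notation leb := (@lebesgue_cV R m).

Lemma bounded_support_lty (u : 'cV[R]_m -> R) (K rho : R) :
  measurable_fun setT u -> (forall z, 0 <= u z <= K) ->
  (forall z, u z != 0 -> forall i, `|z i 0| <= rho) ->
  (\int[leb]_z (u z)%:E < +oo)%E.
Proof.
move=> mu uK urho.
pose B : set 'cV[R]_m := [set z | forall i, `[- rho, rho]%classic (z i 0)].
have mB : measurable B.
  rewrite [X in measurable X](_ : _ = \bigcap_(i in [set: 'I_m])
    ((fun y : 'cV[R]_m => y i 0) @^-1` `[- rho, rho]%classic)); last first.
    by apply/seteqP; split => y /= By i; [move=> _; exact: By|exact: (By i)].
  apply: fin_bigcap_measurable => // i _; rewrite -[X in measurable X]setTI.
  by apply: measurable_coord => //; exact: measurable_itv.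
have K0 : 0 <= K by have /andP[u0 /(le_trans u0)] := uK 0.
apply: (@le_lt_trans _ _ (\int[leb]_z (K * \1_B z)%:E)%E).
  apply: ge0_le_integral => //.
  - by move=> z _; rewrite lee_fin; have /andP[] := uK z.
  - exact/measurable_EFinP.
  - apply/measurable_EFinP; apply: measurable_funM => //.
  move=> z _; rewrite lee_fin; have [->|uz] := eqVneq (u z) 0.
    by rewrite mulr_ge0.
  rewrite indicE mem_set ?mulr1; first by have /andP[] := uK z.
  by move=> i /=; rewrite in_itv/= -ler_norml; exact: urho.
under eq_integral do rewrite EFinM.
rewrite ge0_integralZl_EFin//; last exact/measurable_EFinP.
rewrite integral_indic// setIT /B.
rewrite [X in (_ * X)%E](lebesgue_cV_box (B := fun=> `[- rho, rho]%classic)).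
  2: by move=> i; exact: measurable_itv.
apply: lte_mul_pinfty => //.
rewrite -ge0_fin_numE; last by apply: prode_ge0.
apply: prode_fin_num => i _; rewrite ge0_fin_numE//.
by rewrite [X in (X < _)%E]lebesgue_measure_itv/=; case: ifP => _; rewrite ?ltry.
Qed.

(** Both the values and the support of [clip j G] are bounded by [j], so that its
    powers and their moments are integrable, and it equals [G] wherever it does
    not vanish. *)
Definition clip (j : nat) (G : 'cV[R]_m -> R) (z : 'cV[R]_m) : R :=
  if G z + \sum_i `|z i 0| <= j%:R then G z else 0.

Variable G : 'cV[R]_m -> R.
Hypotheses (mG : measurable_fun setT G) (G0 : forall z, 0 <= G z).

Lemma measurable_clip j : measurable_fun setT (clip j G).
Proof.
apply: measurable_fun_ifT => //; apply: measurable_fun_ler => //.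
apply: measurable_funD => //; apply: measurable_sum => i.
by apply: measurableT_comp => //; exact: measurable_coord.
Qed.

Lemma clip_ge0 j z : 0 <= clip j G z.
Proof. by rewrite /clip; case: ifP. Qed.

Lemma clip_le j z : clip j G z <= G z.
Proof. by rewrite /clip; case: ifP. Qed.

Lemma clip_le_nat j z : clip j G z <= j%:R.
Proof.
rewrite /clip; case: ifP => // /(le_trans _); apply.
by rewrite lerDl sumr_ge0.
Qed.

Lemma clip_support j z i : clip j G z != 0 -> `|z i 0| <= j%:R.
Proof.
rewrite /clip; case: ifP => [H _|]; last by rewrite eqxx.
apply: le_trans H; rewrite (bigD1 i)//= addrCA lerDl addr_ge0//.
exact: sumr_ge0.
Qed.

Lemma clip_pow_lty j k : (\int[leb]_z (clip j G z ^+ k.+1)%:E < +oo)%E.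
Proof.
apply: (@bounded_support_lty _ (j%:R ^+ k.+1) j%:R).
- by apply: measurable_funX; exact: measurable_clip.
- move=> z; rewrite exprn_ge0 ?clip_ge0//= lerXn2r ?nnegrE ?clip_ge0//.
  exact: clip_le_nat.
- by move=> z; rewrite expf_eq0 => /= ? i; exact: clip_support.
Qed.

Lemma clip_moment_lty j k i :
  (\int[leb]_z (clip j G z ^+ k.+1 * `|z i 0|)%:E < +oo)%E.
Proof.
have b z : clip j G z ^+ k.+1 * `|z i 0| != 0 -> clip j G z != 0.
  by apply: contraNneq => ->; rewrite exprS !mul0r.
apply: (@bounded_support_lty _ (j%:R ^+ k.+1 * j%:R) j%:R).
- apply: measurable_funM; first by apply: measurable_funX; exact: measurable_clip.
  by apply: measurableT_comp => //; exact: measurable_coord.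
- move=> z; rewrite mulr_ge0 ?exprn_ge0 ?clip_ge0//=.
  have [->|/b cz] := eqVneq (clip j G z ^+ k.+1 * `|z i 0|) 0.
    by rewrite mulr_ge0// exprn_ge0.
  apply: ler_pM => //; first by rewrite exprn_ge0 ?clip_ge0.
    by rewrite lerXn2r ?nnegrE ?clip_ge0//; exact: clip_le_nat.
  exact: clip_support cz.
- by move=> z /b ? i'; exact: clip_support.
Qed.

Lemma clip_cvg k :
  (\int[leb]_z (clip j G z ^+ k.+1)%:E)%E @[j --> \oo] -->
  (\int[leb]_z (G z ^+ k.+1)%:E)%E.
Proof.
have H z : (clip j G z ^+ k.+1)%:E @[j --> \oo] --> (G z ^+ k.+1)%:E.
  apply: cvg_near_cst.
  exists (Num.bound (G z + \sum_i `|z i 0|)) => // j /= bj.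
  rewrite /clip ifT// (le_trans (ltW (archi_boundP _)))// ?ler_nat//.
  by rewrite addr_ge0// sumr_ge0.
rewrite [X in _ --> X](_ : _ =
    \int[leb]_z limn (fun j => (clip j G z ^+ k.+1)%:E))%E; last first.
  by apply: eq_integral => z _; apply/esym/cvg_lim.
apply: cvg_monotone_convergence => //.
- move=> j; apply/measurable_EFinP/measurable_funX; exact: measurable_clip.
- by move=> j z _; rewrite lee_fin exprn_ge0// clip_ge0.
move=> z _ i j ij; rewrite lee_fin lerXn2r ?nnegrE ?clip_ge0//.
rewrite /clip; case: ifP => [zi|_]; last by case: ifP.
by rewrite ifT// (le_trans zi)// ler_nat.
Qed.

End truncation.

(** * General functions, and the mass below a level *)

Section radon.
Context {R : realType} {m : nat}.
Hypothesis m0 : (0 < m)%N.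
Local Notation V := 'cV[R]_m.
Local Notation leb := (@lebesgue_cV R m).
Local Notation mu := (@lebesgue_measure R).
Local Notation RT := (measurableTypeR R).

Definition radon_const : R := @det_const R m * 2 ^+ m.

Lemma radon_const_ge0 : 0 <= radon_const.
Proof.
by rewrite !mulr_ge0 ?exprn_ge0 ?mulr_ge0// decay_mass_ge0.
Qed.

Lemma measurable_det_weight (G : V -> R) k : measurable_fun setT G ->
  measurable_fun setT (fun Z : 'M[R]_(m, m) =>
    ((\prod_j (G (col j Z) ^+ k)) * `|\det Z|)%:E).
Proof.
move=> mG; apply/measurable_EFinP; apply: measurable_funM.
  by apply: (measurable_prod_col (h := fun z => G z ^+ k)); exact: measurable_funX.
by apply: measurableT_comp => //; exact: measurable_det.
Qed.

(** Truncation supplies the finite moments that [power_integral_le_det] needs,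
    and the right-hand side decreases under truncation. *)
Lemma det_inequality (G : V -> R) (S : R) :
  measurable_fun setT G -> (forall z, 0 <= G z <= S) ->
  ((\int[leb]_z (G z ^+ m.+1)%:E) ^+ m.+1 <= (radon_const * S)%:E *
    iint (fun Z : 'M[R]_(m, m) =>
      ((\prod_j (G (col j Z) ^+ m.+2)) * `|\det Z|)%:E))%E.
Proof.
move=> mG GS.
have G0 z : 0 <= G z by have /andP[] := GS z.
have S0 : 0 <= S by have /andP[/le_trans H /H] := GS 0.
pose a j : \bar R := (\int[leb]_z (clip j G z ^+ m.+1)%:E)%E.
have a0 j : (0 <= a j)%E.
  by apply: integral_ge0 => z _; rewrite lee_fin exprn_ge0// clip_ge0.
apply: (expe_cvg_le a0 (clip_cvg mG G0 (k := m))) => j; rewrite /a.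
have w0 (F : V -> R) (Z : 'M[R]_(m, m)) : (forall z, 0 <= F z) ->
    (0 <= ((\prod_j (F (col j Z) ^+ m.+2)) * `|\det Z|)%:E)%E.
  by move=> F0; rewrite lee_fin mulr_ge0// prodr_ge0// => i _; exact: exprn_ge0.
apply: (@le_trans _ _ ((radon_const * S)%:E *
    iint (fun Z : 'M[R]_(m, m) =>
      ((\prod_i (clip j G (col i Z) ^+ m.+2)) * `|\det Z|)%:E))%E).
  have J0 : (0 <= iint (fun Z : 'M[R]_(m, m) =>
      ((\prod_i (clip j G (col i Z) ^+ m.+2)) * `|\det Z|)%:E))%E.
    by apply: iint_ge0 => Z; apply: w0 => z; exact: clip_ge0.
  have I0 : (0 <= \int[leb]_z (clip j G z ^+ m.+1)%:E)%E.
    by apply: integral_ge0 => z _; rewrite lee_fin exprn_ge0// clip_ge0.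
  have IE : (\int[leb]_z (clip j G z ^+ m.+1)%:E =
      (fine (\int[leb]_z (clip j G z ^+ m.+1)%:E))%:E)%E.
    by rewrite fineK// ge0_fin_numE// clip_pow_lty.
  move: I0; rewrite IE lee_fin; set I := fine _ in IE *.
  rewrite le_eqVlt => /predU1P[<-|I0].
    rewrite -EFin_expe expr0n/= mule_ge0// lee_fin mulr_ge0//.
    exact: radon_const_ge0.
  have Sp : 0 < S.
    rewrite lt_neqAle S0 andbT; apply: contraTneq I0 => S00.
    rewrite -leNgt -lee_fin -IE; apply: eq_lexx.
    apply: integral0_eq => z _; have /andP[Gz0] := GS z; rewrite -S00 => Gz1.
    rewrite (_ : clip j G z = 0) ?expr0n//.
    apply/eqP; rewrite eq_le clip_ge0// andbT.
    exact: le_trans (clip_le _ _ _) Gz1.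
  rewrite -EFin_expe /radon_const.
  apply: (power_integral_le_det m0 _ _ _ Sp I0) => //.
  - exact: measurable_clip.
  - by move=> z; exact: clip_ge0.
  - move=> z; apply: le_trans (clip_le _ _ _) _ => //.
    by have /andP[] := GS z.
  - by move=> i; exact: clip_moment_lty.
apply: lee_wpmul2l; first by rewrite lee_fin mulr_ge0// radon_const_ge0.
apply: le_iint.
- by apply: measurable_det_weight; exact: measurable_clip.
- exact: measurable_det_weight.
- by move=> Z; apply: w0 => z; exact: clip_ge0.
move=> Z; rewrite lee_fin ler_wpM2r//; apply: ler_prod => i _.
rewrite exprn_ge0 ?clip_ge0//= lerXn2r ?nnegrE ?clip_ge0//.
exact: clip_le.
Qed.

Definition below (s v : R) : R := if v <= s then v else 0.

Lemma below_ge0 s v : 0 <= v -> 0 <= below s v.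
Proof. by rewrite /below; case: ifP. Qed.

Lemma below_le s v : 0 <= v -> below s v <= v.
Proof. by rewrite /below; case: ifP. Qed.

Lemma below_ub s v : 0 <= s -> below s v <= s.
Proof. by rewrite /below; case: ifP. Qed.

Lemma measurable_below (d : measure_display) (T : measurableType d)
    (a b : T -> R) :
  measurable_fun setT a -> measurable_fun setT b ->
  measurable_fun setT (fun t => below (a t) (b t)).
Proof.
by move=> ma mb; apply: measurable_fun_ifT => //; exact: measurable_fun_ler.
Qed.

Lemma below_sym k (s v : R) : 0 <= s -> 0 <= v ->
  s ^+ k.+1 * v ^+ k.+1 <=
  s ^+ k.+1 * below s v ^+ k.+1 + v ^+ k.+1 * below v s ^+ k.+1.
Proof.
move=> s0 v0; rewrite /below; case: (leP v s) => vs.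
  by rewrite lerDl mulr_ge0 ?exprn_ge0//; case: ifP.
by rewrite (ltW vs) [X in X <= _]mulrC lerDr mulr_ge0 ?exprn_ge0.
Qed.

Section rearrangement.
Variables (k : nat) (G : V -> R).
Hypotheses (mG : measurable_fun setT G) (G0 : forall z, 0 <= G z).

Definition lower_mass z0 : \bar R :=
  (\int[leb]_z (below (G z0) (G z) ^+ k.+1)%:E)%E.

Lemma measurable_below_pow : measurable_fun setT
  (fun p : V * V => (below (G p.1) (G p.2) ^+ k.+1)%:E).
Proof.
apply/measurable_EFinP; apply: measurable_funX; apply: measurable_below.
  by apply: (measurableT_comp mG); exact: measurable_fst.
by apply: (measurableT_comp mG); exact: measurable_snd.
Qed.

Lemma measurable_lower_mass : measurable_fun setT lower_mass.
Proof.
apply: (measurable_integral_snd leb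
  (f := fun z0 z => (below (G z0) (G z) ^+ k.+1)%:E)).
  exact: measurable_below_pow.
by move=> z0 z; rewrite lee_fin exprn_ge0// below_ge0.
Qed.

Lemma lower_mass_ge0 z0 : (0 <= lower_mass z0)%E.
Proof. by apply: integral_ge0 => z _; rewrite lee_fin exprn_ge0// below_ge0. Qed.

(** Of two points, one lies below the level of the other: the product measure is
    covered by two symmetric halves. *)
Lemma square_le_lower_mass :
  ((\int[leb]_z (G z ^+ k.+1)%:E) ^+ 2 <=
   2%:E * \int[leb]_z ((G z ^+ k.+1)%:E * lower_mass z))%E.
Proof.
set F := fun z => G z ^+ k.+1.
have F0 z : (0 <= (F z)%:E)%E by rewrite lee_fin exprn_ge0.
have mF : measurable_fun setT (fun z => (F z)%:E).
  by apply/measurable_EFinP; exact: measurable_funX.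
pose b z0 z := (F z0 * below (G z0) (G z) ^+ k.+1)%:E.
have b0 z0 z : (0 <= b z0 z)%E.
  by rewrite lee_fin mulr_ge0 ?exprn_ge0// below_ge0.
have mb : measurable_fun setT (fun p => b p.1 p.2).
  apply/measurable_EFinP; apply: measurable_funM; last first.
    by apply/measurable_EFinP; exact: measurable_below_pow.
  by apply: measurable_funX; apply: (measurableT_comp mG); exact: measurable_fst.
have bE : (\int[leb]_z ((F z)%:E * lower_mass z) =
    \int[leb]_z0 \int[leb]_z b z0 z)%E.
  apply: eq_integral => z0 _; rewrite -ge0_integralZl_EFin ?exprn_ge0//.
    by move=> z _; rewrite lee_fin exprn_ge0// below_ge0.
  exact: (measurable_slice_snd (F := fun z0 z => (below (G z0) (G z) ^+ k.+1)%:E)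
    measurable_below_pow).
rewrite expe2 bE.
have -> : ((\int[leb]_z (F z)%:E) * (\int[leb]_z (F z)%:E) =
    \int[leb]_z0 \int[leb]_z (F z0 * F z)%:E)%E.
  have I0 : (0 <= \int[leb]_z (F z)%:E)%E by exact: integral_ge0.
  rewrite -(ge0_integralZr leb measurableT mF (fun z _ => F0 z) I0).
  apply: eq_integral => z0 _.
  by rewrite -(ge0_integralZl_EFin leb measurableT (fun z _ => F0 z) mF)
    ?exprn_ge0.
have mb1 z0 : measurable_fun setT (b z0).
  exact: measurable_slice_snd.
have mb2 z0 : measurable_fun setT (b ^~ z0).
  exact: measurable_slice_fst.
have mi1 := measurable_integral_snd leb mb b0.
have mi2 := measurable_integral_fst leb mb b0.
have -> : (2%:E * \int[leb]_z0 \int[leb]_z b z0 z =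
    \int[leb]_z0 \int[leb]_z (b z0 z + b z z0))%E.
  have -> : (\int[leb]_z0 \int[leb]_z (b z0 z + b z z0) =
      \int[leb]_z0 (\int[leb]_z b z0 z + \int[leb]_z b z z0))%E.
    by apply: eq_integral => z0 _; rewrite ge0_integralD.
  rewrite [RHS]ge0_integralD//; last 2 first.
  - by move=> z0 _; exact: integral_ge0.
  - by move=> z0 _; exact: integral_ge0.
  have -> : (\int[leb]_z0 \int[leb]_z b z z0 = \int[leb]_z \int[leb]_z0 b z z0)%E.
    by rewrite -(tonelli leb leb mb b0).
  by rewrite -mule2n -mule_natl.
have mFF : measurable_fun setT (fun p : V * V =>
    (F p.1 * F p.2)%:E).
  apply/measurable_EFinP; apply: measurable_funM; apply: measurable_funX.
    by apply: (measurableT_comp mG); exact: measurable_fst.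
  by apply: (measurableT_comp mG); exact: measurable_snd.
have mbs : measurable_fun setT (fun p : V * V =>
    (b p.1 p.2 + b p.2 p.1)%E).
  apply: emeasurable_funD => //.
  apply: (measurable_fun_comp2 mb); first exact: measurable_snd.
  exact: measurable_fst.
have FF0 z0 z : (0 <= (F z0 * F z)%:E)%E by rewrite EFinM mule_ge0.
have bs0 z0 z : (0 <= b z0 z + b z z0)%E by rewrite adde_ge0.
apply: ge0_le_integral => //.
- by move=> z0 _; exact: integral_ge0.
- exact: (measurable_integral_snd leb (f := fun z0 z => (F z0 * F z)%:E)).
- exact: (measurable_integral_snd leb (f := fun z0 z => (b z0 z + b z z0)%E)).
move=> z0 _; apply: ge0_le_integral => //.
- exact: (measurable_slice_snd (F := fun z0 z => (F z0 * F z)%:E)).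
- exact: emeasurable_funD.
by move=> z _; rewrite -EFinD lee_fin; exact: below_sym.
Qed.

(** For the density [G ^ k.+1], of total mass [I], the mean of [lower_mass] is at
    least [I / 2] by [square_le_lower_mass].  As it never exceeds [I], the points
    where it is at least [I / 4] carry a mass [Q >= I / 4]. *)
Lemma power_le_lower_mass_fin (k' : nat) :
  (\int[leb]_z (G z ^+ k.+1)%:E < +oo)%E ->
  ((\int[leb]_z (G z ^+ k.+1)%:E) ^+ k'.+1 <= (4 ^+ k'.+1)%:E *
    \int[leb]_z ((G z ^+ k.+1)%:E * lower_mass z ^+ k'))%E.
Proof.
move=> Ifin; pose F z := G z ^+ k.+1.
have F0 z : 0 <= F z by exact: exprn_ge0.
have mF : measurable_fun setT F by exact: measurable_funX.
have mF' : measurable_fun setT (fun z => (F z)%:E) by exact/measurable_EFinP.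
have F0' z : (0 <= (F z)%:E)%E by rewrite lee_fin.
have I0 : (0 <= \int[leb]_z (F z)%:E)%E by exact: integral_ge0.
have IE : (\int[leb]_z (F z)%:E = (fine (\int[leb]_z (F z)%:E))%:E)%E.
  by rewrite fineK// ge0_fin_numE.
have := square_le_lower_mass.
rewrite -/(F _) IE; set I := fine _ in IE *.
have {}I0 : 0 <= I by rewrite -lee_fin -IE.
have lmI z : (lower_mass z <= I%:E)%E.
  rewrite -IE; apply: ge0_le_integral => //.
  - by move=> y _; rewrite lee_fin exprn_ge0// below_ge0.
  - exact: (measurable_slice_snd
      (F := fun z0 z => (below (G z0) (G z) ^+ k.+1)%:E) measurable_below_pow).
  - move=> y _; rewrite lee_fin lerXn2r ?nnegrE ?below_ge0//.
    exact: below_le.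
pose a z := fine (lower_mass z).
have aE z : lower_mass z = (a z)%:E.
  by rewrite fineK// ge0_fin_numE ?lower_mass_ge0// (le_lt_trans (lmI z))// ltry.
have a0 z : 0 <= a z by rewrite -lee_fin -aE lower_mass_ge0.
have aI z : a z <= I by rewrite -lee_fin -aE.
have ma : measurable_fun setT a by apply: measurableT_comp => //; exact: measurable_lower_mass.
under eq_integral do rewrite aE -EFinM.
under [in X in _ -> X]eq_integral do rewrite aE -EFin_expe -EFinM.
pose P z : R := if I / 4 <= a z then F z else 0.
have P0 z : 0 <= P z by rewrite /P; case: ifP.
have mP : measurable_fun setT P.
  by apply: measurable_fun_ifT => //; exact: measurable_fun_ler.
have mP' : measurable_fun setT (fun z => (P z)%:E) by exact/measurable_EFinP.
have PI : (\int[leb]_z (P z)%:E <= I%:E)%E.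
  rewrite -IE; apply: ge0_le_integral => // [z _|z _]; first by rewrite lee_fin.
  by rewrite lee_fin /P; case: ifP.
have PE : (\int[leb]_z (P z)%:E = (fine (\int[leb]_z (P z)%:E))%:E)%E.
  rewrite fineK// ge0_fin_numE; first by rewrite (le_lt_trans PI)// ltry.
  by apply: integral_ge0 => z _; rewrite lee_fin.
set Q := fine _ in PE.
have Q0 : 0 <= Q by rewrite -lee_fin -PE; apply: integral_ge0 => z _; rewrite lee_fin.
have split1 : (\int[leb]_z (F z * a z)%:E <= (I / 4 * I + I * Q)%:E)%E.
  rewrite (_ : (I / 4 * I + I * Q)%:E = (I / 4)%:E * \int[leb]_z (F z)%:E +
    I%:E * \int[leb]_z (P z)%:E)%E; last by rewrite IE PE -!EFinM -EFinD.
  rewrite -!ge0_integralZl_EFin ?divr_ge0//; last first.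
    by move=> z _; rewrite lee_fin.
  rewrite -ge0_integralD//; last 4 first.
  - by move=> z _; rewrite mule_ge0 ?lee_fin ?divr_ge0.
  - by apply: measurable_funeM.
  - by move=> z _; rewrite mule_ge0 ?lee_fin.
  - by apply: measurable_funeM.
  apply: ge0_le_integral => //.
  - by move=> z _; rewrite lee_fin mulr_ge0.
  - by apply/measurable_EFinP; exact: measurable_funM.
  - by apply: emeasurable_funD; apply: measurable_funeM.
  move=> z _; rewrite -!EFinM -EFinD lee_fin /P; case: (leP (I / 4) (a z)) => az.
    by rewrite ler_wpDl ?mulr_ge0 ?divr_ge0// mulrC ler_wpM2r.
  by rewrite mulr0 addr0 mulrC ler_wpM2r// ltW.
have split2 : (((I / 4) ^+ k' * Q)%:E <= \int[leb]_z (F z * a z ^+ k')%:E)%E.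
  rewrite EFinM -PE -ge0_integralZl_EFin ?exprn_ge0 ?divr_ge0//; last first.
    by move=> z _; rewrite lee_fin.
  apply: ge0_le_integral => //.
  - by move=> z _; rewrite mule_ge0 ?lee_fin ?exprn_ge0 ?divr_ge0.
  - exact: measurable_funeM.
  - by apply/measurable_EFinP; apply: measurable_funM => //; exact: measurable_funX.
  move=> z _; rewrite -EFinM lee_fin /P; case: ifP => az; last first.
    by rewrite mulr0 mulr_ge0 ?exprn_ge0.
  by rewrite mulrC ler_wpM2l// lerXn2r ?nnegrE ?divr_ge0.
move=> sq.
have {}sq : I ^+ 2 <= 2 * (I / 4 * I + I * Q).
  rewrite -lee_fin EFin_expe (le_trans sq)// EFinM.
  by apply: lee_wpmul2l; rewrite ?lee_fin.
have IQ : I / 4 <= Q.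
  move: I0; rewrite le_eqVlt => /predU1P[<-|I0]; first by rewrite mul0r.
  by rewrite -(ler_pM2l I0); nra.
apply: (@le_trans _ _ ((4 ^+ k'.+1)%:E * ((I / 4) ^+ k' * Q)%:E)%E); last first.
  by apply: lee_wpmul2l => //; rewrite lee_fin exprn_ge0.
rewrite -EFin_expe -EFinM lee_fin.
have -> : I ^+ k'.+1 = 4 ^+ k'.+1 * ((I / 4) ^+ k' * (I / 4)).
  by rewrite -exprSr -exprMn mulrC divfK// pnatr_eq0.
by rewrite ler_pM2l ?exprn_gt0// ler_wpM2l// exprn_ge0// divr_ge0.
Qed.

End rearrangement.

Lemma power_le_lower_mass k k' (G : V -> R) :
  measurable_fun setT G -> (forall z, 0 <= G z) ->
  ((\int[leb]_z (G z ^+ k.+1)%:E) ^+ k'.+1 <= (4 ^+ k'.+1)%:E *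
    \int[leb]_z ((G z ^+ k.+1)%:E * lower_mass k G z ^+ k'))%E.
Proof.
move=> mG G0.
have e0 (F : V -> R) z : (forall z, 0 <= F z) ->
    (0 <= (F z ^+ k.+1)%:E * lower_mass k F z ^+ k')%E.
  move=> F0; rewrite mule_ge0 ?lee_fin ?exprn_ge0//.
  by apply: expe_ge0; exact: lower_mass_ge0.
have me (F : V -> R) : measurable_fun setT F -> (forall z, 0 <= F z) ->
    measurable_fun setT (fun z => (F z ^+ k.+1)%:E * lower_mass k F z ^+ k')%E.
  move=> mF F0; apply: emeasurable_funM.
    by apply/measurable_EFinP; exact: measurable_funX.
  by apply: emeasurable_funX; exact: measurable_lower_mass.
pose a j : \bar R := (\int[leb]_z (clip j G z ^+ k.+1)%:E)%E.
have a0 j : (0 <= a j)%E.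
  by apply: integral_ge0 => z _; rewrite lee_fin exprn_ge0// clip_ge0.
apply: (expe_cvg_le a0 (clip_cvg mG G0 (k := k))) => j.
have mc : measurable_fun setT (clip j G) by exact: measurable_clip.
have c0 z : 0 <= clip j G z by exact: clip_ge0.
apply: le_trans (power_le_lower_mass_fin mc c0 _ _) _.
  exact: clip_pow_lty.
apply: lee_wpmul2l; first by rewrite lee_fin exprn_ge0.
apply: ge0_le_integral => //.
- by move=> z _; exact: e0.
- exact: me.
- exact: me.
move=> z _; have [->|cz] := eqVneq (clip j G z) 0.
  by rewrite expr0n/= mul0e e0.
have cGz : clip j G z = G z.
  by move: cz; rewrite /clip; case: ifP => //; rewrite eqxx.
rewrite cGz; apply: lee_wpmul2l; first by rewrite lee_fin exprn_ge0.
apply: le_expe; first exact: lower_mass_ge0.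
have mb (F F' : V -> R) z0 : measurable_fun setT F' ->
    measurable_fun setT (fun z => (below (F z0) (F' z) ^+ k.+1)%:E).
  by move=> mF'; apply/measurable_EFinP; apply: measurable_funX; exact: measurable_below.
rewrite /lower_mass cGz; apply: ge0_le_integral => //.
- by move=> y _; rewrite lee_fin exprn_ge0// below_ge0.
- exact: (mb G (clip j G)).
- exact: (mb G G).
move=> y _; rewrite lee_fin lerXn2r ?nnegrE ?below_ge0// /below.
rewrite /clip; case: (_ <= j%:R) => //.
by rewrite G0; case: ifP.
Qed.

End radon.

(** * The Radon transform *)

Section radon_transform.
Context {R : realType} {m : nat}.
Hypothesis m0 : (0 < m)%N.
Local Notation V := 'cV[R]_m.
Local Notation leb := (@lebesgue_cV R m).
Local Notation mu := (@lebesgue_measure R).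
Local Notation RT := (measurableTypeR R).

Definition dot (x z : V) : R := (x^T *m z) 0 0.

Lemma measurable_dot (d : measure_display) (T : measurableType d)
    (a b : T -> V) :
  measurable_fun setT a -> measurable_fun setT b ->
  measurable_fun setT (fun t => dot (a t) (b t)).
Proof.
move=> ma mb; apply: measurable_mxE; apply: measurable_mulmx => //.
exact: measurable_trmx.
Qed.

Lemma dotBr x y z : dot x (y - z) = dot x y - dot x z.
Proof. by rewrite /dot mulmxBr !mxE. Qed.

(** Apply [det_inequality] on each hyperplane and integrate in [x].  For fixed
    [Z] the substitution [w = Z^T x] has Jacobian [|det Z|] and turns the
    integrand into a product of functions of one coordinate each. *)
Lemma radon_through_origin (H : V -> RT -> R) (S : R) :
  measurable_fun setT (fun p => H p.1 p.2) -> (forall z u, 0 <= H z u <= S) ->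
  (\int[leb]_x (\int[leb]_z (H z (dot x z) ^+ m.+1)%:E) ^+ m.+1 <=
   (@radon_const R m * S)%:E *
   (\int[leb]_z \int[mu]_u (H z u ^+ m.+2)%:E) ^+ m)%E.
Proof.
move=> mH HS.
have H0 z u : 0 <= H z u by have /andP[] := HS z u.
have S0 : 0 <= S by have /andP[/le_trans h /h] := HS 0 0.
have C0 : 0 <= @radon_const R m * S by rewrite mulr_ge0// radon_const_ge0.
pose W x (Z : 'M[R]_(m, m)) : \bar R :=
  ((\prod_i (H (col i Z) (dot x (col i Z)) ^+ m.+2)) * `|\det Z|)%:E.
have W0 x Z : (0 <= W x Z)%E.
  by rewrite lee_fin mulr_ge0// prodr_ge0// => i _; exact: exprn_ge0.
have mW : measurable_fun setT (fun p => W p.1 p.2).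
  apply/measurable_EFinP; apply: measurable_funM; last first.
    apply: measurableT_comp => //; apply: measurable_det; exact: measurable_snd.
  apply: measurable_prod => i _; apply: measurable_funX.
  have mc : measurable_fun setT (fun p : V * 'M[R]_(m, m) => col i p.2).
    by apply: (measurableT_comp (measurable_col i)); exact: measurable_snd.
  apply: (measurable_fun_comp2 mH) => //.
  by apply: measurable_dot => //; exact: measurable_fst.
have mHx : measurable_fun setT (fun p : V * V =>
    (H p.2 (dot p.1 p.2) ^+ m.+1)%:E).
  apply/measurable_EFinP; apply: measurable_funX.
  apply: (measurable_fun_comp2 mH); first exact: measurable_snd.
  by apply: measurable_dot; [exact: measurable_fst|exact: measurable_snd].
have Hx0 x z : (0 <= (H z (dot x z) ^+ m.+1)%:E)%E by rewrite lee_fin exprn_ge0.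
have mHxz x : measurable_fun setT (fun z => H z (dot x z)).
  by apply: (measurable_fun_comp2 mH) => //; exact: measurable_dot.
have miW : measurable_fun setT (fun x => iint (W x)) by exact: measurable_iint.
apply: (@le_trans _ _ (\int[leb]_x ((@radon_const R m * S)%:E * iint (W x)))%E).
  apply: ge0_le_integral => //.
  - by move=> x _; apply: expe_ge0; exact: integral_ge0.
  - apply: emeasurable_funX.
    exact: (measurable_integral_snd leb
      (f := fun x z => (H z (dot x z) ^+ m.+1)%:E)).
  - exact: measurable_funeM.
  by move=> x _; apply: (det_inequality m0 (G := fun z => H z (dot x z))).
rewrite ge0_integralZl_EFin//; last first.
  by move=> x _; exact: iint_ge0.
apply: lee_wpmul2l; first by rewrite lee_fin.
rewrite iint_tonelli//.
have mHu : measurable_fun setT (fun p : V * RT => (H p.1 p.2 ^+ m.+2)%:E).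
  by apply/measurable_EFinP; exact: measurable_funX.
have Hu0 z u : (0 <= (H z u ^+ m.+2)%:E)%E by rewrite lee_fin exprn_ge0.
pose h z : \bar R := (\int[mu]_u (H z u ^+ m.+2)%:E)%E.
have h0 z : (0 <= h z)%E by exact: integral_ge0.
have mh : measurable_fun setT h.
  exact: (measurable_integral_snd mu (f := fun z u => (H z u ^+ m.+2)%:E)).
rewrite -(iint_prod m mh h0); apply: le_iint.
- exact: measurable_integral_fst mW W0.
- apply: emeasurable_prod => i; apply: (measurableT_comp mh).
  exact: measurable_col.
- by move=> Z; exact: integral_ge0.
move=> Z.
have mHz z : measurable_fun setT (fun u => (H z u ^+ m.+2)%:E).
  exact: (measurable_slice_snd (F := fun z u => (H z u ^+ m.+2)%:E)).
rewrite -(ge0_integral_cV_prod (phi := fun i u => (H (col i Z) u ^+ m.+2)%:E))//.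
pose psi (w : V) : \bar R := (\prod_i (H (col i Z) (w i 0%R) ^+ m.+2)%:E)%E.
have psi0 w : (0 <= psi w)%E by apply: prode_ge0.
have mpsi : measurable_fun setT psi.
  apply: emeasurable_prod => i.
  by apply: (measurableT_comp (mHz (col i Z))); exact: measurable_coord.
have [Z0|Z0] := eqVneq (\det Z) 0.
  under eq_integral do rewrite /W Z0 normr0 mulr0.
  by rewrite integral0; apply: integral_ge0 => y _; exact: psi0.
rewrite -/(psi _) -(ge0_integral_cV_linear (M := Z^T) _ mpsi psi0) ?det_tr//.
rewrite -ge0_integralZl_EFin//; last first.
  by apply: (measurableT_comp mpsi); exact: measurable_mulmx.
apply: eq_lexx; apply: eq_integral => x _.
rewrite /W /psi prodEFin mulrC EFinM; congr (_ * (_)%:E)%E.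
apply: eq_bigr => i _; congr (H _ _ ^+ _).
by rewrite /dot !mxE; apply: eq_bigr => j _; rewrite !mxE mulrC.
Qed.

(** By [power_le_lower_mass] only the part of [G] below its value at a point
    [(z0, s)] of the hyperplane matters; the variable [s] replaces [t].  For fixed
    [(z0, s)] all hyperplanes pass through that point, and after a translation
    [radon_through_origin] applies with [S = G z0 s]. *)
Lemma radon_bound (G : V -> RT -> R) :
  measurable_fun setT (fun p => G p.1 p.2) -> (forall z u, 0 <= G z u) ->
  (\int[leb]_x \int[mu]_t
     (\int[leb]_z (G z (t + dot x z)%R ^+ m.+1)%:E) ^+ m.+2 <=
   (4 ^+ m.+2 * @radon_const R m)%:E *
   (\int[leb]_z \int[mu]_u (G z u ^+ m.+2)%:E) ^+ m.+1)%E.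
Proof.
move=> mG G0.
set K := (\int[leb]_z \int[mu]_u (G z u ^+ m.+2)%:E)%E.
have C0 := @radon_const_ge0 R m.
have mGp k : measurable_fun setT (fun p : V * RT => (G p.1 p.2 ^+ k)%:E).
  by apply/measurable_EFinP; exact: measurable_funX.
have Gp0 z u k : (0 <= (G z u ^+ k)%:E)%E by rewrite lee_fin exprn_ge0.
have K0 : (0 <= K)%E by apply: integral_ge0 => z _; exact: integral_ge0.
pose B x z0 (s : RT) z : R :=
  below (G z0 s) (G z ((s : R) + dot x (z - z0))).
have B0 x z0 s z : 0 <= B x z0 s z by exact: below_ge0.
pose A (x z0 : V) (s : RT) : \bar R := (\int[leb]_z (B x z0 s z ^+ m.+1)%:E)%E.
have A0 x z0 s : (0 <= A x z0 s)%E.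
  by apply: integral_ge0 => z _; rewrite lee_fin exprn_ge0.
pose Psi (x z0 : V) (s : RT) : \bar R := ((G z0 s ^+ m.+1)%:E * A x z0 s ^+ m.+1)%E.
have Psi0 x z0 s : (0 <= Psi x z0 s)%E.
  by rewrite mule_ge0// expe_ge0.
have mB : measurable_fun setT
    (fun q : (V * (V * RT)) * V =>
      (B q.1.1 q.1.2.1 q.1.2.2 q.2 ^+ m.+1)%:E).
  have m1 : measurable_fun setT (fun q : (V * (V * RT)) * V => q.1.2).
    exact: measurable_snd_fst.
  have m11 : measurable_fun setT (fun q : (V * (V * RT)) * V => q.1.2.1).
    exact: (measurableT_comp measurable_fst m1).
  have m12 : measurable_fun setT (fun q : (V * (V * RT)) * V => q.1.2.2).
    exact: (measurableT_comp measurable_snd m1).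
  apply/measurable_EFinP; apply: measurable_funX; apply: measurable_below.
    exact: (measurable_fun_comp2 mG).
  apply: (measurable_fun_comp2 mG); first exact: measurable_snd.
  apply: measurable_funD => //; apply: measurable_dot.
    exact: measurable_fst_fst.
  apply: measurable_addmx; first exact: measurable_snd.
  exact: measurable_oppmx.
have mA : measurable_fun setT (fun p : V * (V * RT) =>
    A p.1 p.2.1 p.2.2).
  apply: (measurable_integral_snd leb (f := fun (p : V * (V * RT)) z =>
    (B p.1 p.2.1 p.2.2 z ^+ m.+1)%:E)) => // p z.
  by rewrite lee_fin exprn_ge0.
have mPsi : measurable_fun setT (fun p : V * (V * RT) =>
    Psi p.1 p.2.1 p.2.2).
  apply: emeasurable_funM; last exact: emeasurable_funX.
  apply: (measurableT_comp (mGp m.+1)); exact: measurable_snd.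
have mPsix x : measurable_fun setT (fun p => Psi x p.1 p.2).
  exact: (measurable_slice_snd (F := fun x (p : V * RT) => Psi x p.1 p.2)).
have mPsiz z0 : measurable_fun setT (fun p => Psi p.1 z0 p.2).
  apply: (measurable_fun_comp2 (F := fun x (p : V * RT) => Psi x p.1 p.2)
    mPsi (a := fst) (b := fun p => (z0, p.2))); first exact: measurable_fst.
  by apply: measurable_fun_pair => //; exact: measurable_snd.
pose Phi (x : V) (t : RT) (z0 : V) : \bar R := Psi x z0 ((t : R) + dot x z0).
have mPhix x : measurable_fun setT (fun p => Phi x p.1 p.2).
  apply: (measurable_fun_comp2 (mPsix x)); first exact: measurable_snd.
  apply: measurable_funD; first exact: measurable_fst.
  by apply: measurable_dot => //; exact: measurable_snd.
have Phi0 x t z0 : (0 <= Phi x t z0)%E by exact: Psi0.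
have shift x : (\int[mu]_t \int[leb]_z0 Phi x t z0 =
    \int[leb]_z0 \int[mu]_s Psi x z0 s)%E.
  transitivity (\int[leb]_z0 \int[mu]_t Phi x t z0)%E.
    exact: (tonelli mu leb (f := Phi x)).
  apply: eq_integral => z0 _.
  have mPs : measurable_fun setT (Psi x z0).
    exact: (measurable_slice_snd (F := Psi x) (mPsix x)).
  exact: (ge0_integral_shift (dot x z0) mPs (Psi0 x z0)).
have mIPsi : measurable_fun setT (fun p : V * V =>
    \int[mu]_s Psi p.1 p.2 s)%E.
  apply: (measurable_integral_snd mu
      (f := fun (p : V * V) s => Psi p.1 p.2 s)) => //.
  apply: (measurable_fun_comp2 (F := fun x (p : V * RT) => Psi x p.1 p.2)
      mPsi (a := fun q => q.1.1) (b := fun q => (q.1.2, q.2))).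
    exact: measurable_fst_fst.
  apply: measurable_fun_pair; last exact: measurable_snd.
  exact: measurable_snd_fst.
have IPsi0 x z0 : (0 <= \int[mu]_s Psi x z0 s)%E by exact: integral_ge0.
have swap : (\int[leb]_x \int[leb]_z0 \int[mu]_s Psi x z0 s =
    \int[leb]_z0 \int[mu]_s \int[leb]_x Psi x z0 s)%E.
  transitivity (\int[leb]_z0 \int[leb]_x \int[mu]_s Psi x z0 s)%E; last first.
    apply: eq_integral => z0 _.
    exact: (tonelli leb mu (f := fun x s => Psi x z0 s)).
  exact: (tonelli leb leb (f := fun x z0 => \int[mu]_s Psi x z0 s)%E).
have inner z0 s : (\int[leb]_x Psi x z0 s <=
    (@radon_const R m)%:E * K ^+ m * (G z0 s ^+ m.+2)%:E)%E.
  have mAx : measurable_fun setT (fun x => A x z0 s).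
    exact: (measurable_slice_fst (F := fun x (p : V * RT) => A x p.1 p.2)
      mA (z0, s)).
  rewrite ge0_integralZl_EFin ?exprn_ge0//; last 2 first.
  - by move=> x _; exact: expe_ge0.
  - exact: emeasurable_funX.
  pose H (z : V) (u : RT) : R := below (G z0 s) (G (z + z0) ((s : R) + (u : R))).
  have mH : measurable_fun setT (fun p => H p.1 p.2).
    apply: measurable_below => //; apply: (measurable_fun_comp2 mG).
      by apply: measurable_addmx => //; exact: measurable_fst.
    by apply: measurable_funD => //; exact: measurable_snd.
  have HS z u : 0 <= H z u <= G z0 s by rewrite below_ge0// below_ub.
  have AH x : A x z0 s = (\int[leb]_z (H z (dot x z) ^+ m.+1)%:E)%E.
    rewrite /A -(ge0_integral_cV_shift z0).
    - by apply: eq_integral => z _; rewrite /B /H addrK.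
    - exact: (measurable_slice_snd
        (F := fun (p : V * (V * RT)) z =>
          (B p.1 p.2.1 p.2.2 z ^+ m.+1)%:E) mB (x, (z0, s))).
    - by move=> z; rewrite lee_fin exprn_ge0.
  under eq_integral do rewrite AH.
  apply: le_trans (lee_wpmul2l _ (radon_through_origin mH HS)) _ => //.
  pose Gs (z : V) (u : RT) : \bar R :=
    (G (z + z0) ((s : R) + (u : R))%R ^+ m.+2)%:E.
  have mGz : measurable_fun setT (fun p => Gs p.1 p.2).
    apply/measurable_EFinP; apply: measurable_funX.
    apply: (measurable_fun_comp2 mG).
      by apply: measurable_addmx => //; exact: measurable_fst.
    by apply: measurable_funD => //; exact: measurable_snd.
  have HK : (\int[leb]_z \int[mu]_u (H z u ^+ m.+2)%:E <= K)%E.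
    have -> : K = (\int[leb]_z \int[mu]_u Gs z u)%E.
      rewrite /K -(ge0_integral_cV_shift z0); last 2 first.
      - exact: (measurable_integral_snd mu (f := fun z u => (G z u ^+ m.+2)%:E)).
      - by move=> z; exact: integral_ge0.
      apply: eq_integral => z _; rewrite -(ge0_integral_shift s).
      - by apply: eq_integral => u _; rewrite /Gs [X in G _ X]addrC.
      - exact: (measurable_slice_snd (F := fun z u => (G z u ^+ m.+2)%:E)).
      - by [].
    have mHp : measurable_fun setT (fun p => (H p.1 p.2 ^+ m.+2)%:E).
      by apply/measurable_EFinP; exact: measurable_funX.
    have H0 z u : (0 <= (H z u ^+ m.+2)%:E)%E.
      by rewrite lee_fin exprn_ge0//; have /andP[] := HS z u.
    have Gs0 z u : (0 <= Gs z u)%E by exact: Gp0.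
    apply: ge0_le_integral => //.
    - by move=> z _; exact: integral_ge0.
    - exact: (measurable_integral_snd mu (f := fun z u => (H z u ^+ m.+2)%:E)).
    - exact: (measurable_integral_snd mu
        (f := Gs)).
    move=> z _; apply: ge0_le_integral => //.
    - exact: (measurable_slice_snd (F := fun z u => (H z u ^+ m.+2)%:E)).
    - exact: (measurable_slice_snd
        (F := Gs)).
    move=> u _; rewrite lee_fin lerXn2r ?nnegrE ?below_ge0//.
    exact: below_le.
  rewrite muleA -EFinM.
  have -> : ((@radon_const R m)%:E * K ^+ m * (G z0 s ^+ m.+2)%:E =
      (G z0 s ^+ m.+1 * (@radon_const R m * G z0 s))%:E * K ^+ m)%E.
    by rewrite muleAC -EFinM; congr (_%:E * _)%E; rewrite [G z0 s ^+ m.+2]exprSr; ring.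
  apply: lee_wpmul2l; first by rewrite lee_fin mulr_ge0 ?exprn_ge0// mulr_ge0//.
  apply: le_expe HK; apply: integral_ge0 => z _; apply: integral_ge0 => u _.
  by rewrite lee_fin exprn_ge0//; have /andP[] := HS z u.
have mg x t : measurable_fun setT (fun z => G z (t + dot x z)).
  by apply: (measurable_fun_comp2 mG) => //; apply: measurable_funD => //; exact: measurable_dot.
have lmE x t z0 : lower_mass m (fun z => G z (t + dot x z)) z0 =
    A x z0 (t + dot x z0).
  apply: eq_integral => z _; rewrite /B dotBr; congr ((below _ (G _ _) ^+ _)%:E).
  by ring.
have mgxt : measurable_fun setT (fun q : (V * RT) * V =>
    (G q.2 ((q.1.2 : R) + dot q.1.1 q.2) ^+ m.+1)%:E).
  apply: (measurable_fun_comp2 (F := fun z u => (G z u ^+ m.+1)%:E) (mGp m.+1)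
    (a := snd) (b := fun q : (V * RT) * V =>
      ((q.1.2 : R) + dot q.1.1 q.2 : RT))); first exact: measurable_snd.
  apply: measurable_funD.
    exact: measurable_snd_fst.
  apply: measurable_dot; last exact: measurable_snd.
  exact: measurable_fst_fst.
pose Rg (x : V) (t : RT) : \bar R :=
  (\int[leb]_z (G z ((t : R) + dot x z)%R ^+ m.+1)%:E)%E.
have mRg : measurable_fun setT (fun p => Rg p.1 p.2 ^+ m.+2)%E.
  apply: emeasurable_funX; exact: (measurable_integral_snd leb
   (f := fun (p : V * RT) z => (G z ((p.2 : R) + dot p.1 z) ^+ m.+1)%:E)).
have Rg0 x t : (0 <= Rg x t ^+ m.+2)%E.
  by apply: expe_ge0; exact: integral_ge0.
have mPhi : measurable_fun setT (fun q : (V * RT) * V =>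
    Phi q.1.1 q.1.2 q.2).
  have q11 : measurable_fun setT (fun q : (V * RT) * V => q.1.1).
    exact: measurable_fst_fst.
  apply: (measurable_fun_comp2 (F := fun x (p : V * RT) => Psi x p.1 p.2)
    mPsi (a := fun q => q.1.1)
    (b := fun q : (V * RT) * V =>
       (q.2, ((q.1.2 : R) + dot q.1.1 q.2 : RT)))) => //.
  apply: measurable_fun_pair; first exact: measurable_snd.
  apply: measurable_funD; last by apply: measurable_dot => //; exact: measurable_snd.
  exact: measurable_snd_fst.
have mIPhi : measurable_fun setT
    (fun p : V * RT => \int[leb]_z0 Phi p.1 p.2 z0)%E.
  exact: (measurable_integral_snd leb
    (f := fun (p : V * RT) z0 => Phi p.1 p.2 z0)).
have IPhi0 x t : (0 <= \int[leb]_z0 Phi x t z0)%E by exact: integral_ge0.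
have four0 : 0 <= 4 ^+ m.+2 :> R by exact: exprn_ge0.
have mRgx x : measurable_fun setT (fun t => Rg x t ^+ m.+2)%E.
  exact: (measurable_slice_snd (F := fun x t => Rg x t ^+ m.+2)%E mRg x).
have pt x (t : RT) : (Rg x t ^+ m.+2 <= (4 ^+ m.+2)%:E * \int[leb]_z0 Phi x t z0)%E.
  have E : (\int[leb]_z0 ((G z0 ((t : R) + dot x z0)%R ^+ m.+1)%:E *
      lower_mass m (fun z => G z ((t : R) + dot x z)%R) z0 ^+ m.+1) =
      \int[leb]_z0 Phi x t z0)%E.
    by apply: eq_integral => z0 _; rewrite lmE.
  rewrite -E.
  exact: (power_le_lower_mass m m.+1 (mg x t) (fun z => G0 z ((t : R) + dot x z))).
apply: (@le_trans _ _ (\int[leb]_x \int[mu]_t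
    ((4 ^+ m.+2)%:E * \int[leb]_z0 Phi x t z0))%E).
  have m4 : measurable_fun setT (fun p : V * RT =>
      (4 ^+ m.+2)%:E * \int[leb]_z0 Phi p.1 p.2 z0)%E by exact: measurable_funeM.
  have p4 x t : (0 <= (4 ^+ m.+2)%:E * \int[leb]_z0 Phi x t z0)%E.
    by rewrite mule_ge0.
  apply: ge0_le_integral => //.
  - by move=> x _; apply: integral_ge0 => t _; exact: Rg0.
  - exact: (measurable_integral_snd mu (f := fun x t => Rg x t ^+ m.+2)%E).
  - exact: (measurable_integral_snd mu
      (f := fun x t => (4 ^+ m.+2)%:E * \int[leb]_z0 Phi x t z0)%E).
  move=> x _; apply: ge0_le_integral.
  - exact: measurableT.
  - by move=> t _; exact: Rg0.
  - exact: mRgx.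
  - exact: (measurable_slice_snd
      (F := fun x t => (4 ^+ m.+2)%:E * \int[leb]_z0 Phi x t z0)%E m4 x).
  by move=> t _; exact: pt.
under eq_integral => x _.
  rewrite ge0_integralZl_EFin//; last first.
    exact: (measurable_slice_snd (F := fun x t => \int[leb]_z0 Phi x t z0)%E).
  rewrite shift; over.
rewrite ge0_integralZl_EFin//; last 2 first.
- by move=> x _; exact: integral_ge0.
- exact: (measurable_integral_snd leb (f := fun x z0 => \int[mu]_s Psi x z0 s)%E).
rewrite swap.
have -> : ((4 ^+ m.+2 * @radon_const R m)%:E * K ^+ m.+1 =
    (4 ^+ m.+2)%:E * ((@radon_const R m)%:E * K ^+ m.+1))%E.
  by rewrite EFinM muleA.
apply: lee_wpmul2l => //.
have CK0 : (0 <= (@radon_const R m)%:E * K ^+ m)%E by rewrite mule_ge0// expe_ge0.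
have mIx : measurable_fun setT (fun p : V * RT => \int[leb]_x Psi x p.1 p.2)%E.
  exact: (measurable_integral_fst leb
    (f := fun x (p : V * RT) => Psi x p.1 p.2)).
have mCK : measurable_fun setT (fun p : V * RT =>
    (@radon_const R m)%:E * K ^+ m * (G p.1 p.2 ^+ m.+2)%:E)%E.
  exact: measurable_funeM.
have Ix0 z0 s : (0 <= \int[leb]_x Psi x z0 s)%E by exact: integral_ge0.
have pCK z0 s : (0 <= (@radon_const R m)%:E * K ^+ m * (G z0 s ^+ m.+2)%:E)%E.
  by rewrite mule_ge0.
apply: (@le_trans _ _ (\int[leb]_z0 \int[mu]_s
    ((@radon_const R m)%:E * K ^+ m * (G z0 s ^+ m.+2)%:E))%E).
  apply: ge0_le_integral => //.
  - by move=> z0 _; exact: integral_ge0.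
  - exact: (measurable_integral_snd mu (f := fun z0 s => \int[leb]_x Psi x z0 s)%E).
  - exact: (measurable_integral_snd mu (f := fun z0 s =>
      (@radon_const R m)%:E * K ^+ m * (G z0 s ^+ m.+2)%:E)%E).
  move=> z0 _; apply: ge0_le_integral => //.
  - exact: (measurable_slice_snd (F := fun z0 s => \int[leb]_x Psi x z0 s)%E).
  - exact: (measurable_slice_snd (F := fun z0 s =>
      (@radon_const R m)%:E * K ^+ m * (G z0 s ^+ m.+2)%:E)%E).
under eq_integral => z0 _.
  rewrite ge0_integralZl//; last first.
    exact: (measurable_slice_snd (F := fun z u => (G z u ^+ m.+2)%:E)).
  over.
rewrite ge0_integralZl//; last 2 first.
- exact: (measurable_integral_snd mu (f := fun z u => (G z u ^+ m.+2)%:E)).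
- by move=> z _; exact: integral_ge0.
by rewrite expeS -muleA [(K ^+ m * _)%E]muleC.
Qed.

End radon_transform.

(** * Hoelder's inequality *)

Lemma measurable_powR_comp (d : measure_display) (T : measurableType d)
    (R : realType) (f : T -> R) (a : R) :
  measurable_fun setT f -> measurable_fun setT (fun x => f x `^ a).
Proof.
by move=> mf; apply: (measurableT_comp (f := @powR R ^~ a)) mf; exact: measurable_powR.
Qed.

Section hoelder_inequality.
Context {d : measure_display} {T : measurableType d} {R : realType}.
Variable mu : {measure set T -> \bar R}.
Implicit Types f g : T -> \bar R.

Lemma weighted_am_gm (a b x y : R) : 0 < a -> 0 < b -> a + b = 1 ->
  0 <= x -> 0 <= y -> x `^ a * y `^ b <= a * x + b * y.
Proof.
move=> a0 b0 ab x0 y0.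
have := @conjugate_powR R (x `^ a) (y `^ b) a^-1 b^-1.
rewrite !powR_ge0 !invr_gt0 a0 b0 !invrK ab -!powRrM !mulfV ?gt_eqF// !powRr1//.
by move=> /(_ isT isT isT isT erefl); rewrite [x * a]mulrC [y * b]mulrC.
Qed.

(** The inequality [weighted_am_gm] at [x / i] and [y / j], in a form that also
    holds for infinite arguments. *)
Lemma scaled_am_gm (a b i j : R) (x y : \bar R) :
  0 < a -> 0 < b -> a + b = 1 -> 0 < i -> 0 < j -> (0 <= x)%E -> (0 <= y)%E ->
  (x `^ a * y `^ b <=
   (i `^ a * j `^ b * (a / i))%:E * x + (i `^ a * j `^ b * (b / j))%:E * y)%E.
Proof.
move=> a0 b0 ab i0 j0.
have c0 : 0 < i `^ a * j `^ b by rewrite mulr_gt0// powR_gt0.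
have ci : 0 < i `^ a * j `^ b * (a / i) by rewrite mulr_gt0// divr_gt0.
have cj : 0 < i `^ a * j `^ b * (b / j) by rewrite mulr_gt0// divr_gt0.
case: x => [x| |]//; case: y => [y| |]//; rewrite ?lee_fin => x0 y0.
- have := weighted_am_gm a0 b0 ab (divr_ge0 x0 (ltW i0)) (divr_ge0 y0 (ltW j0)).
  move=> /(ler_wpM2l (ltW c0)) H.
  have E (u v r : R) : 0 <= u -> 0 < v -> u `^ r = v `^ r * (u / v) `^ r.
    move=> u0 v0; rewrite -(powRM _ (ltW v0) (divr_ge0 u0 (ltW v0))).
    by rewrite [v * _]mulrC divfK// gt_eqF.
  rewrite (E x i)// (E y j)// mulrACA; apply: le_trans H _.
  by apply: eq_lexx; ring.
- by rewrite [(_%:E * +oo)%E]gt0_muley ?lte_fin// addey ?leey// -EFinM.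
- by rewrite [(_%:E * +oo)%E]gt0_muley ?lte_fin// addye ?leey// -EFinM.
- by rewrite ![(_%:E * +oo)%E]gt0_muley ?lte_fin// leey.
Qed.

Lemma measurable_poweR_comp f (a : R) : measurable_fun setT f ->
  measurable_fun setT (fun x => f x `^ a)%E.
Proof. by move=> mf; exact: (measurableT_comp (measurable_poweR a) mf). Qed.

Lemma integral_null_mul f g (a : R) :
  0 < a -> measurable_fun setT f -> (forall x, 0 <= f x)%E ->
  measurable_fun setT g -> (\int[mu]_x f x = 0)%E ->
  (\int[mu]_x (f x `^ a * g x) = 0)%E.
Proof.
move=> a0 mf f0 mg If0.
have : ae_eq mu setT f (cst 0%E).
  apply/(ae_eq_integral_abs mu measurableT mf).
  by rewrite -[RHS]If0; apply: eq_integral => x _; rewrite gee0_abs.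
move=> f0ae; rewrite -[RHS](integral0 mu setT); apply: ae_eq_integral => //.
  by apply: emeasurable_funM => //; exact: measurable_poweR_comp.
apply: filterS f0ae => x /= /(_ Logic.I) fx0 _.
by rewrite fx0 poweR0r ?gt_eqF// mul0e.
Qed.

(** Both exponents may vanish, because [x `^ 0 = 1] even at infinity; this
    spares every application the separate treatment of the end points. *)
Lemma ge0_hoelder f g (a b : R) : 0 <= a -> 0 <= b -> a + b = 1 ->
  measurable_fun setT f -> measurable_fun setT g ->
  (forall x, 0 <= f x)%E -> (forall x, 0 <= g x)%E ->
  (\int[mu]_x (f x `^ a * g x `^ b) <=
   (\int[mu]_x f x) `^ a * (\int[mu]_x g x) `^ b)%E.
Proof.
move=> a0 b0 ab mf mg f0 g0.
have I0 : (0 <= \int[mu]_x f x)%E by exact: integral_ge0.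
have J0 : (0 <= \int[mu]_x g x)%E by exact: integral_ge0.
move: a0; rewrite le_eqVlt => /predU1P[a0|a0].
  have -> : b = 1 by rewrite -ab -a0 add0r.
  rewrite -a0 poweRe0 mul1e poweRe1//; apply: eq_lexx.
  by apply: eq_integral => x _; rewrite poweRe0 mul1e poweRe1.
move: b0; rewrite le_eqVlt => /predU1P[b0|b0].
  have -> : a = 1 by rewrite -ab -b0 addr0.
  rewrite -b0 poweRe0 mule1 poweRe1//; apply: eq_lexx.
  by apply: eq_integral => x _; rewrite poweRe0 mule1 poweRe1.
have mfa := measurable_poweR_comp a mf; have mgb := measurable_poweR_comp b mg.
have [If0|In0] := eqVneq (\int[mu]_x f x)%E 0%E.
  by rewrite integral_null_mul// mule_ge0// poweR_ge0.
have [Jg0|Jn0] := eqVneq (\int[mu]_x g x)%E 0%E.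
  rewrite (_ : (\int[mu]_x _ = 0)%E) ?mule_ge0 ?poweR_ge0//.
  rewrite -(integral_null_mul b0 mg g0 mfa Jg0); apply: eq_integral => x _.
  by rewrite muleC.
have Ip : (0 < \int[mu]_x f x)%E by rewrite lt_neqAle eq_sym In0.
have Jp : (0 < \int[mu]_x g x)%E by rewrite lt_neqAle eq_sym Jn0.
have [Iy|Ify] := eqVneq (\int[mu]_x f x)%E +oo%E.
  by rewrite Iy poweRyr ?gt_eqF// gt0_mulye ?leey// poweR_gt0.
have [Jy|Jfy] := eqVneq (\int[mu]_x g x)%E +oo%E.
  by rewrite Jy poweRyr ?gt_eqF// gt0_muley ?leey// poweR_gt0.
have IE : (\int[mu]_x f x)%E = (fine (\int[mu]_x f x)%E)%:E.
  by rewrite fineK// ge0_fin_numE// ltey.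
have JE : (\int[mu]_x g x)%E = (fine (\int[mu]_x g x)%E)%:E.
  by rewrite fineK// ge0_fin_numE// ltey.
move: Ip Jp; rewrite IE JE !lte_fin; set i := fine _ in IE *; set j := fine _ in JE *.
move=> i0 j0.
set c1 : R := i `^ a * j `^ b * (a / i); set c2 : R := i `^ a * j `^ b * (b / j).
have c10 : 0 <= c1 by rewrite !mulr_ge0 ?powR_ge0 ?invr_ge0 ?ltW.
have c20 : 0 <= c2 by rewrite !mulr_ge0 ?powR_ge0 ?invr_ge0 ?ltW.
have p1 x : (0 <= c1%:E * f x)%E by rewrite mule_ge0.
have p2 x : (0 <= c2%:E * g x)%E by rewrite mule_ge0.
have m1 : measurable_fun setT (fun x => c1%:E * f x)%E by exact: measurable_funeM.
have m2 : measurable_fun setT (fun x => c2%:E * g x)%E by exact: measurable_funeM.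
apply: (@le_trans _ _ (\int[mu]_x (c1%:E * f x + c2%:E * g x))%E).
  apply: ge0_le_integral => //.
  - by move=> x _; rewrite mule_ge0 ?poweR_ge0.
  - exact: emeasurable_funM.
  - exact: emeasurable_funD.
  by move=> x _; exact: scaled_am_gm.
rewrite (ge0_integralD mu measurableT (fun x _ => p1 x) m1 (fun x _ => p2 x) m2).
rewrite (ge0_integralZl_EFin mu measurableT (fun x _ => f0 x) mf c10).
rewrite (ge0_integralZl_EFin mu measurableT (fun x _ => g0 x) mg c20).
rewrite IE JE -!EFinM -EFinD lee_fin /c1 /c2.
apply: eq_lexx.
rewrite -[RHS]mulr1 -ab; field; by rewrite !gt_eqF.
Qed.

End hoelder_inequality.

(** * Change of density *)

Section integral_nu_gamma.
Import HBSimple HBNNSimple.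
Context {R : realType} {n : nat}.
Variables (A : 'M[R]_(n + n)) (gamma : R) (eta : cutoff R (n + n)).
Local Notation H := (heisenberg R n).
Local Notation nu := (nu_gamma A gamma eta).
Local Notation leb := (@lebesgue_cV R (n + n)).
Local Notation dens := (density gamma eta).

Lemma nnsfun_integral_nu_gamma (f : {nnsfun H >-> R}) :
  (\int[nu]_h (f h)%:E =
   \int[leb]_y ((f (quad_graph A y))%:E * (dens y)%:E))%E.
Proof.
have mq : measurable_fun setT (quad_graph A) by exact: measurable_quad_graph.
have md : measurable_fun setT (fun y => (dens y)%:E).
  by apply/measurable_EFinP; exact: measurable_density.
have mi k : measurable_fun setT (fun y =>
    (\1_(f @^-1` [set k]) (quad_graph A y))%:E : \bar R).
  apply/measurable_EFinP.
  by apply: (measurableT_comp _ mq); exact: measurable_indic.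
transitivity (\int[nu]_h (\sum_(k \in range f) (k * \1_(f @^-1` [set k]) h)%:E))%E.
  by apply: eq_integral => h _; rewrite fimfunE -fsumEFin.
transitivity (\int[leb]_y (\sum_(k \in range f)
    ((k * \1_(f @^-1` [set k]) (quad_graph A y))%:E * (dens y)%:E)))%E; last first.
  apply: eq_integral => y _; rewrite fimfunE -fsumEFin//.
  by rewrite ge0_mule_fsuml// => k; rewrite EFinM nnfun_muleindic_ge0.
rewrite ge0_integral_fsum//; last 2 first.
- by move=> k; apply/measurable_EFinP; exact: measurable_funM.
- by move=> k h _; rewrite EFinM nnfun_muleindic_ge0.
rewrite ge0_integral_fsum//; last 2 first.
- by move=> k; under eq_fun do rewrite EFinM; apply: emeasurable_funM => //;
    exact: measurable_funeM.
- move=> k y _; apply: mule_ge0; last by rewrite lee_fin density_ge0.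
  by rewrite EFinM; exact: nnfun_muleindic_ge0.
apply: eq_fsbigr => k _; under eq_integral do rewrite EFinM.
rewrite integralZl_indic_nnsfun// integral_indic// setIT.
transitivity (k%:E * \int[leb]_y
    ((\1_(f @^-1` [set k]) (quad_graph A y))%:E * (dens y)%:E))%E.
  by congr (_ * _)%E; apply: eq_integral => y _; rewrite EFinM.
have [k0|k0] := leP 0 k.
  rewrite -(ge0_integralZl_EFin leb measurableT _ _ k0); last 2 first.
  - by move=> y _; rewrite -EFinM lee_fin mulr_ge0// density_ge0.
  - exact: emeasurable_funM.
  by apply: eq_integral => y _; rewrite EFinM muleA.
rewrite (preimage_nnfun0 f k0) indic0.
by rewrite !integral0_eq ?mule0// => y _; rewrite /= ?mulr0 ?mul0e.
Qed.

Lemma ge0_integral_nu_gamma (f : H -> \bar R) :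
  measurable_fun setT f -> (forall h, 0 <= f h)%E ->
  (\int[nu]_h f h = \int[leb]_y (f (quad_graph A y) * (dens y)%:E))%E.
Proof.
move=> mf f0.
pose f_ := nnsfun_approx measurableT mf.
have mq : measurable_fun setT (quad_graph A) by exact: measurable_quad_graph.
have md : measurable_fun setT (fun y => (dens y)%:E).
  by apply/measurable_EFinP; exact: measurable_density.
have d0 y : (0 <= (dens y)%:E)%E by rewrite lee_fin density_ge0.
have nd h : {homo (fun k => (f_ k h)%:E) : a b / (a <= b)%N >-> (a <= b)%E}.
  move=> a b ab; rewrite lee_fin; have := nd_nnsfun_approx measurableT mf ab.
  by move=> /lefP; exact.
have cf h : (fun k => (f_ k h)%:E) @ \oo --> f h.
  exact: (cvg_nnsfun_approx measurableT mf (fun x _ => f0 x)).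
transitivity (limn (fun k => \int[nu]_h (f_ k h)%:E)%E).
  rewrite -(monotone_convergence nu measurableT).
  - by apply: eq_integral => h _; apply/esym/cvg_lim => //; exact: cf.
  - by move=> k; apply/measurable_EFinP.
  - by move=> k x _; rewrite lee_fin.
  - by move=> x _; exact: nd.
under eq_fun do rewrite nnsfun_integral_nu_gamma.
rewrite -(monotone_convergence leb measurableT).
- apply: eq_integral => y _; apply/cvg_lim => //.
  by apply: cvgeZr => //; exact: cf.
- move=> k; apply: emeasurable_funM => //; apply/measurable_EFinP.
  exact: measurableT_comp.
- by move=> k x _; rewrite mule_ge0// lee_fin.
- by move=> x _ a b ab; apply: lee_wpmul2r => //; exact: nd.
Qed.

End integral_nu_gamma.

(** * Averages over translated graphs *)

Section averages.
Context {R : realType} {n : nat}.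
Variable A : 'M[R]_(n + n).
Hypothesis symA : A^T = A.
Local Notation m := (n + n)%N.
Local Notation H := (heisenberg R n).
Local Notation V := 'cV[R]_m.
Local Notation leb := (@lebesgue_cV R m).
Local Notation mu := (@lebesgue_measure R).
Local Notation RT := (measurableTypeR R).
Local Notation haar := (@haar R n).
Local Notation J := (symp_mx R n).

(** The point at which the convolution with a measure on the graph evaluates its
    argument. *)
Definition graph_shift (g : H) (y : V) : H :=
  heis_mul g (heis_inv (quad_graph A y)).

Lemma measurable_quad_comp (d : measure_display) (T : measurableType d)
    (a : T -> V) : measurable_fun setT a ->
  measurable_fun setT (fun t => quad A (a t)).
Proof. by move=> ma; apply: measurableT_comp ma; exact: measurable_quad. Qed.

Lemma measurable_symp (d : measure_display) (T : measurableType d)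
    (a b : T -> V) : measurable_fun setT a -> measurable_fun setT b ->
  measurable_fun setT (fun t => symp (a t) (b t)).
Proof.
move=> ma mb; apply: measurable_mxE; apply: measurable_mulmx => //.
apply: measurable_mulmx => //; exact: measurable_trmx.
Qed.

Lemma graph_shiftE g y :
  graph_shift g y = (g.1 - y, (g.2 : R) - quad A y - symp g.1 y).
Proof.
by rewrite /graph_shift /heis_mul /heis_inv /= /symp mulmxN mxE.
Qed.

Lemma measurable_graph_shift (d : measure_display) (T : measurableType d)
    (a : T -> H) (b : T -> V) :
  measurable_fun setT a -> measurable_fun setT b ->
  measurable_fun setT (fun t => graph_shift (a t) (b t)).
Proof.
move=> ma mb; under eq_fun do rewrite graph_shiftE.
have m1 : measurable_fun setT (fun t => (a t).1).
  exact: (measurableT_comp measurable_fst ma).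
have m2 : measurable_fun setT (fun t => (a t).2 : RT).
  exact: (measurableT_comp measurable_snd ma).
apply: measurable_fun_pair.
  by apply: measurable_addmx => //; exact: measurable_oppmx.
apply: measurable_funB; last exact: measurable_symp.
by apply: measurable_funB => //; exact: measurable_quad_comp.
Qed.

Lemma measurable_graph_shift2 :
  measurable_fun setT (fun p : H * V => graph_shift p.1 p.2).
Proof.
by apply: measurable_graph_shift; [exact: measurable_fst|exact: measurable_snd].
Qed.

Lemma haar_integral (F : H -> \bar R) :
  measurable_fun setT F -> (forall g, 0 <= F g)%E ->
  (\int[haar]_g F g = \int[leb]_x \int[mu]_t F (x, t))%E.
Proof.
move=> mF F0.
rewrite -(tonelli_prod leb mu (f := fun x t => F (x, t))).
- by apply: eq_integral => -[x t].
- by apply: eq_measurable_fun mF => -[x t].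
- by [].
Qed.

Lemma measurable_pair_slice (F : H -> \bar R) (x : V) :
  measurable_fun setT F -> measurable_fun setT (fun t : RT => F (x, t)).
Proof.
move=> mF; apply: (measurableT_comp mF).
exact: measurable_fun_pair.
Qed.

Lemma measurable_pair_int (F : H -> \bar R) :
  measurable_fun setT F -> (forall g, 0 <= F g)%E ->
  measurable_fun setT (fun x : V => \int[mu]_t F (x, t))%E.
Proof.
move=> mF F0; apply: (measurable_integral_snd mu (f := fun x t => F (x, t))) => //.
by apply: eq_measurable_fun mF => -[x t].
Qed.

Lemma haar_tonelli (F : H -> V -> \bar R) :
  measurable_fun setT (fun p => F p.1 p.2) -> (forall g y, 0 <= F g y)%E ->
  (\int[haar]_g \int[leb]_y F g y = \int[leb]_y \int[haar]_g F g y)%E.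
Proof.
move=> mF F0.
have mI : measurable_fun setT (fun g => \int[leb]_y F g y)%E.
  exact: (measurable_integral_snd leb (f := F)).
have I0 g : (0 <= \int[leb]_y F g y)%E by exact: integral_ge0.
rewrite (haar_integral mI I0).
have mQ : measurable_fun setT (fun q : (V * V) * RT =>
    F (q.1.1, q.2) q.1.2).
  have q11 : measurable_fun setT (fun q : (V * V) * RT => q.1.1).
    exact: measurable_fst_fst.
  have q12 : measurable_fun setT (fun q : (V * V) * RT => q.1.2).
    exact: measurable_snd_fst.
  apply: (measurable_fun_comp2 mF
    (a := fun q : (V * V) * RT => ((q.1.1, q.2) : H))) => //.
  exact: measurable_fun_pair.
transitivity (\int[leb]_x \int[leb]_y \int[mu]_t F (x, t) y)%E.
  apply: eq_integral => x _.
  apply: (tonelli mu leb (f := fun t y => F (x, t) y)) => //.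
  apply: (measurable_fun_comp2 mF (a := fun p : RT * V => ((x, p.1) : H))).
    by apply: measurable_fun_pair => //; exact: measurable_fst.
  exact: measurable_snd.
transitivity (\int[leb]_y \int[leb]_x \int[mu]_t F (x, t) y)%E.
  apply: (tonelli leb leb (f := fun x y => \int[mu]_t F (x, t) y)%E).
    exact: (measurable_integral_snd mu
      (f := fun (p : V * V) t => F (p.1, t) p.2)).
  by move=> x y; exact: integral_ge0.
apply: eq_integral => y _; rewrite haar_integral//.
exact: (measurable_slice_fst (F := F)).
Qed.

(** Haar measure is also right invariant: a right translation is a translation
    in [x] composed with a shear in [t]. *)
Lemma haar_integral_shift (F : H -> \bar R) (y : V) :
  measurable_fun setT F -> (forall g, 0 <= F g)%E ->
  (\int[haar]_g F (graph_shift g y) = \int[haar]_g F g)%E.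
Proof.
move=> mF F0.
have mS : measurable_fun setT (fun g => F (graph_shift g y)).
  by apply: (measurableT_comp mF); exact: measurable_graph_shift.
rewrite (haar_integral mS (fun g => F0 _)) (haar_integral mF F0).
pose phi (x : V) : \bar R := (\int[mu]_t F (x, t))%E.
have mphi : measurable_fun setT phi by exact: measurable_pair_int.
have phi0 x : (0 <= phi x)%E by exact: integral_ge0.
rewrite -(ge0_integral_cV_shift (- y) mphi phi0).
apply: eq_integral => x _; rewrite /phi.
rewrite -(ge0_integral_shift (- quad A y - symp x y)
  (measurable_pair_slice (x - y) mF) (fun t => F0 _)).
by apply: eq_integral => t _; rewrite graph_shiftE/= addrA.
Qed.

Section weight.
Variable w : V -> R.
Hypotheses (mw : measurable_fun setT w) (w0 : forall y, 0 <= w y).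

Definition average (F : H -> \bar R) (g : H) : \bar R :=
  (\int[leb]_y (F (graph_shift g y) * (w y)%:E))%E.

Lemma measurable_average_integrand (F : H -> \bar R) :
  measurable_fun setT F ->
  measurable_fun setT (fun p : H * V =>
    (F (graph_shift p.1 p.2) * (w p.2)%:E)%E).
Proof.
move=> mF; apply: emeasurable_funM.
  exact: (measurableT_comp mF measurable_graph_shift2).
by apply/measurable_EFinP; apply: (measurableT_comp mw); exact: measurable_snd.
Qed.

Lemma average_ge0 (F : H -> \bar R) g :
  (forall h, 0 <= F h)%E -> (0 <= average F g)%E.
Proof. by move=> F0; apply: integral_ge0 => y _; rewrite mule_ge0 ?lee_fin. Qed.

Lemma measurable_average (F : H -> \bar R) :
  measurable_fun setT F -> (forall h, 0 <= F h)%E ->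
  measurable_fun setT (average F).
Proof.
move=> mF F0; apply: (measurable_integral_snd leb
  (f := fun g y => (F (graph_shift g y) * (w y)%:E)%E)).
  exact: measurable_average_integrand.
by move=> g y; rewrite mule_ge0 ?lee_fin.
Qed.

Lemma integral_average (F : H -> \bar R) :
  measurable_fun setT F -> (forall h, 0 <= F h)%E ->
  (\int[haar]_g average F g =
   (\int[leb]_y (w y)%:E) * \int[haar]_g F g)%E.
Proof.
move=> mF F0.
have I0 : (0 <= \int[haar]_g F g)%E by exact: integral_ge0.
transitivity (\int[leb]_y \int[haar]_g (F (graph_shift g y) * (w y)%:E))%E.
  have p0 g y : (0 <= F (graph_shift g y) * (w y)%:E)%E.
    by rewrite mule_ge0 ?lee_fin.
  exact: (haar_tonelli
    (F := fun g y => (F (graph_shift g y) * (w y)%:E)%E)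
    (measurable_average_integrand mF) p0).
have mwE : measurable_fun setT (fun y => (w y)%:E) by exact/measurable_EFinP.
have w0E y : (0 <= (w y)%:E)%E by rewrite lee_fin.
rewrite -(ge0_integralZr leb measurableT mwE (fun y _ => w0E y) I0).
apply: eq_integral => y _.
have mS : measurable_fun setT (fun g => F (graph_shift g y)).
  by apply: (measurableT_comp mF); exact: measurable_graph_shift.
rewrite (ge0_integralZr haar measurableT mS (fun g _ => F0 _) (w0E y)).
by rewrite muleC haar_integral_shift.
Qed.

End weight.

Section full_average.
Hypothesis m0 : (0 < m)%N.
Hypothesis detB : \det (2 *: A + J) != 0.

Lemma trmx_symp : J^T = - J.
Proof.
by rewrite /symp_mx tr_block_mx !trmx0 linearN /= trmx1 opp_block_mx !oppr0 opprK.
Qed.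

Lemma symp_diag (x : V) : symp x x = 0.
Proof.
have E : (x^T *m J *m x)^T = - (x^T *m J *m x).
  by rewrite !trmx_mul trmxK trmx_symp mulNmx mulmxN mulmxA.
have : symp x x = - symp x x.
  have : ((x^T *m J *m x)^T) 0 0 = - symp x x by rewrite E mxE.
  by rewrite mxE.
lra.
Qed.

Lemma bilin_sym (x z : V) : (z^T *m A *m x) 0 0 = (x^T *m A *m z) 0 0.
Proof.
transitivity (((x^T *m A *m z)^T) 0 0); last by rewrite mxE.
by rewrite !trmx_mul trmxK symA mulmxA.
Qed.

(** Completing the square turns the average over the graph into a Radon
    transform: the bilinear terms combine to [x^T (2A + J) z]. *)
Lemma graph_shift_reflect (x z : V) (t : RT) :
  graph_shift (x, t) (x - z) =
  (z, ((t : R) - quad A x) + dot ((2 *: A + J)^T *m x) z - quad A z).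
Proof.
rewrite graph_shiftE /=; congr pair; first by rewrite opprB addrC subrK.
have -> : dot ((2 *: A + J)^T *m x) z =
    2 * (x^T *m A *m z) 0 0 + (x^T *m J *m z) 0 0.
  rewrite /dot trmx_mul trmxK mulmxDr mulmxDl -scalemxAr -scalemxAl.
  by rewrite mxE [X in X + _]mxE.
have -> : symp x (x - z) = - (x^T *m J *m z) 0 0.
  by rewrite -[RHS]add0r -(symp_diag x) /symp mulmxBr !mxE.
have -> : quad A (x - z) =
    quad A x - 2 * (x^T *m A *m z) 0 0 + quad A z.
  have -> : quad A (x - z) = quad A x - (x^T *m A *m z) 0 0 -
      ((z^T *m A *m x) 0 0 - quad A z).
    rewrite /quad [(x - z)^T]linearB /= !(mulmxBl, mulmxBr).
    by rewrite !mxE; ring.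
  by rewrite bilin_sym; ring.
ring.
Qed.

Lemma average_all_eq (F : H -> \bar R) (x : V) (t : RT) :
  measurable_fun setT F -> (forall h, 0 <= F h)%E ->
  (\int[leb]_y F (graph_shift (x, t) y) =
   \int[leb]_z F (z, (((t : R) - quad A x) + dot ((2 *: A + J)^T *m x) z
     - quad A z)%R))%E.
Proof.
move=> mF F0.
pose f (y : V) := F (graph_shift (x, t) y).
have mf : measurable_fun setT f.
  by apply: (measurableT_comp mF); exact: measurable_graph_shift.
have f0 y : (0 <= f y)%E by exact: F0.
pose h (y : V) := f (y + x).
have mh : measurable_fun setT h.
  by apply: (measurableT_comp mf); exact: measurable_addmx.
have h0 y : (0 <= h y)%E by exact: F0.
rewrite -(ge0_integral_cV_shift x mf f0) -/(h _).
have dN : \det (- 1%:M : 'M[R]_m) != 0.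
  by rewrite -scaleN1r detZ det1 mulr1 expf_neq0// oppr_eq0 oner_eq0.
have := ge0_integral_cV_linear dN mh h0.
have -> : `|\det (- 1%:M : 'M[R]_m)| = 1.
  by rewrite -scaleN1r detZ det1 mulr1 normrX normrN1 expr1n.
rewrite mul1e => <-; apply: eq_integral => z _.
by rewrite /h /f mulNmx mul1mx addrC graph_shift_reflect.
Qed.

Definition full_average_const : R :=
  `|\det (2 *: A + J)|^-1 * (4 ^+ m.+2 * @radon_const R m).

Lemma full_average_const_ge0 : 0 <= full_average_const.
Proof.
by rewrite mulr_ge0 ?invr_ge0// mulr_ge0 ?exprn_ge0// radon_const_ge0.
Qed.

(** [radon_bound] for [G z u = F (z, u - Q z)]: the shear by [Q] and the
    translation of [t] by [Q x] preserve the measure, and [(2A + J)^T] contributes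
    its Jacobian. *)
Lemma full_average_bound (F : H -> R) :
  measurable_fun setT F -> (forall h, 0 <= F h) ->
  (\int[haar]_g (\int[leb]_y (F (graph_shift g y) ^+ m.+1)%:E) ^+ m.+2 <=
   full_average_const%:E * (\int[haar]_g (F g ^+ m.+2)%:E) ^+ m.+1)%E.
Proof.
move=> mF F0.
pose G (z : V) (u : RT) : R := F (z, (u : R) - quad A z).
have G0 z u : 0 <= G z u by exact: F0.
have mG : measurable_fun setT (fun p => G p.1 p.2).
  apply: (measurableT_comp mF); apply: measurable_fun_pair.
    exact: measurable_fst.
  apply: measurable_funB; first exact: measurable_snd.
  by apply: measurable_quad_comp; exact: measurable_fst.
have mFk k : measurable_fun setT (fun g => (F g ^+ k)%:E).
  by apply/measurable_EFinP; exact: measurable_funX.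
have F0k k g : (0 <= (F g ^+ k)%:E)%E by rewrite lee_fin exprn_ge0.
pose Rg (x : V) (t : RT) : \bar R :=
  ((\int[leb]_z (G z ((t : R) + dot x z)%R ^+ m.+1)%:E) ^+ m.+2)%E.
have Rg0 x t : (0 <= Rg x t)%E.
  by apply: expe_ge0; apply: integral_ge0 => z _; rewrite lee_fin exprn_ge0.
have mRg : measurable_fun setT (fun p => Rg p.1 p.2).
  apply: emeasurable_funX; apply: (measurable_integral_snd leb
    (f := fun (p : V * RT) z => (G z ((p.2 : R) + dot p.1 z) ^+ m.+1)%:E)).
    apply/measurable_EFinP; apply: measurable_funX.
    apply: (measurable_fun_comp2 mG (a := snd)
      (b := fun q : (V * RT) * V =>
        ((q.1.2 : R) + dot q.1.1 q.2 : RT))); first exact: measurable_snd.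
    apply: measurable_funD.
      exact: measurable_snd_fst.
    apply: measurable_dot; last exact: measurable_snd.
    exact: measurable_fst_fst.
  by move=> p z; rewrite lee_fin exprn_ge0.
pose phi (x : V) : \bar R := (\int[mu]_t Rg x t)%E.
have mphi : measurable_fun setT phi.
  exact: (measurable_integral_snd mu (f := Rg)).
have phi0 x : (0 <= phi x)%E by exact: integral_ge0.
pose S (g : H) : \bar R :=
  ((\int[leb]_y (F (graph_shift g y) ^+ m.+1)%:E) ^+ m.+2)%E.
have S0 g : (0 <= S g)%E.
  by apply: expe_ge0; apply: integral_ge0 => z _; rewrite lee_fin exprn_ge0.
have SE x (t : RT) : S (x, t) =
    Rg ((2 *: A + J)^T *m x) ((t : R) + (- quad A x)).
  have E := average_all_eq x t (mFk m.+1) (F0k m.+1).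
  exact: (congr1 (fun I => I ^+ m.+2)%E E).
have mS : measurable_fun setT S.
  apply: emeasurable_funX; apply: (measurable_integral_snd leb
    (f := fun g y => (F (graph_shift g y) ^+ m.+1)%:E)); last first.
    by move=> g y; exact: F0k.
  exact: (measurableT_comp (mFk m.+1) measurable_graph_shift2).
rewrite -/(S _) (haar_integral mS S0).
have -> : (\int[leb]_x \int[mu]_t S (x, t) =
    \int[leb]_x phi ((2 *: A + J)^T *m x))%E.
  apply: eq_integral => x _; rewrite /phi.
  have mRx : measurable_fun setT (Rg ((2 *: A + J)^T *m x)).
    exact: (measurable_slice_snd mRg).
  apply: etrans (ge0_integral_shift (- quad A x) mRx (Rg0 _)).
  by apply: eq_integral => t _; rewrite SE.
have dT : \det ((2 *: A + J)^T) != 0 by rewrite det_tr.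
have dn : 0 < `|\det (2 *: A + J)| by rewrite normr_gt0.
have := ge0_integral_cV_linear dT mphi phi0.
rewrite det_tr => /(congr1 (fun v => `|\det (2 *: A + J)|^-1%:E * v)%E).
rewrite muleA -EFinM mulVf ?gt_eqF// mul1e => ->.
rewrite /full_average_const EFinM -muleA.
apply: lee_wpmul2l; first by rewrite lee_fin invr_ge0.
apply: le_trans (radon_bound m0 mG G0) _.
apply: lee_wpmul2l.
  by rewrite lee_fin mulr_ge0 ?exprn_ge0// radon_const_ge0.
apply: eq_lexx; congr (_ ^+ _)%E.
rewrite (haar_integral (mFk m.+2) (F0k m.+2)).
apply: eq_integral => z _.
have mz : measurable_fun setT (fun u : RT => (F (z, u) ^+ m.+2)%:E).
  exact: (measurable_pair_slice z (mFk m.+2)).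
by rewrite -(ge0_integral_shift (- quad A z) mz (fun u => F0k _ _)).
Qed.

End full_average.
End averages.

(** * Interpolation *)

Section local_weight.
Context {R : realType} {m : nat}.
Hypothesis m0 : (0 < m)%N.
Local Notation V := 'cV[R]_m.
Local Notation leb := (@lebesgue_cV R m).
Local Notation mu := (@lebesgue_measure R).
Local Notation RT := (measurableTypeR R).

Definition local_weight (b : R) (y : V) : R :=
  if euclid_norm y < 2 then euclid_norm y `^ (- b) else 0.

Lemma local_weight_ge0 b y : 0 <= local_weight b y.
Proof. by rewrite /local_weight; case: ifP => // _; exact: powR_ge0. Qed.

Lemma measurable_local_weight b : measurable_fun setT (local_weight b).
Proof.
apply: measurable_fun_ifT => //.
  by apply: measurable_fun_ltr => //; exact: measurable_euclid_norm.
by apply: measurable_powR_comp; exact: measurable_euclid_norm.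
Qed.

Lemma norm_coord_le_euclid (y : V) i : `|y i 0| <= euclid_norm y.
Proof.
rewrite -sqrtr_sqr /euclid_norm ler_wsqrtr// (bigD1 i)//= lerDl.
by apply: sumr_ge0 => j _; exact: sqr_ge0.
Qed.

Lemma local_weight_powR (b s : R) y : s != 0 ->
  local_weight (b * s) y = local_weight b y `^ s.
Proof.
move=> s0; rewrite /local_weight; case: ifP => _; last by rewrite powR0.
by rewrite -mulNr powRrM.
Qed.

(** The value at [0] is infinite, so that the product of these factors bounds
    the weight at every point, the coordinate hyperplanes included. *)
Definition coordinate_weight (c : R) (r : RT) : \bar R :=
  ((`|r| `^ (- c) * \1_(`[-2, 2]%classic : set RT) r)%:E
   + +oo * (\1_([set 0] : set RT) r)%:E)%E.

Lemma coordinate_weight_ge0 c r : (0 <= coordinate_weight c r)%E.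
Proof.
by rewrite adde_ge0 ?lee_fin ?mulr_ge0 ?powR_ge0// mule_ge0 ?leey// lee_fin.
Qed.

Lemma measurable_local_power c : measurable_fun setT (fun r : RT =>
  (`|r| `^ (- c) * \1_(`[-2, 2]%classic : set RT) r)%:E).
Proof.
apply/measurable_EFinP; apply: measurable_funM.
  by apply: measurable_powR_comp; exact: normr_measurable.
exact: measurable_indic.
Qed.

Lemma measurable_coordinate_weight c : measurable_fun setT (coordinate_weight c).
Proof.
apply: emeasurable_funD; first exact: measurable_local_power.
by apply: measurable_funeM; apply/measurable_EFinP; exact: measurable_indic.
Qed.

Lemma coordinate_weight_lty c : 0 < c < 1 ->
  (\int[mu]_r coordinate_weight c r < +oo)%E.
Proof.
move=> /local_power_lty c01.
have m1 := measurable_local_power c.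
have m2 : measurable_fun setT (fun r : RT => (\1_([set 0] : set RT) r)%:E : \bar R).
  by apply/measurable_EFinP; exact: measurable_indic.
have p1 (r : RT) : (0 <= (`|r| `^ (- c) * \1_(`[-2, 2]%classic : set RT) r)%:E)%E.
  by rewrite lee_fin mulr_ge0 ?powR_ge0.
have p2 (r : RT) : (0 <= +oo * (\1_([set 0] : set RT) r)%:E :> \bar R)%E.
  by rewrite mule_ge0 ?leey// lee_fin.
have m3 : measurable_fun setT
    (fun r : RT => +oo * (\1_([set 0] : set RT) r)%:E : \bar R)%E.
  exact: measurable_funeM.
rewrite /coordinate_weight.
rewrite (ge0_integralD mu measurableT (fun r _ => p1 r) m1 (fun r _ => p2 r) m3).
rewrite (_ : \int[mu]_r (+oo * (\1_([set 0] : set RT) r)%:E) = 0)%E ?adde0//.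
have -> : (\int[mu]_r (+oo * (\1_([set 0] : set RT) r)%:E) =
    +oo * \int[mu]_r (\1_([set 0] : set RT) r)%:E)%E.
  by rewrite ge0_integralZl// => r _; rewrite lee_fin.
rewrite integral_indic// setIT.
transitivity (+oo * 0 : \bar R)%E; last by rewrite mule0.
by congr (_ * _)%E; exact: lebesgue_measure_set1.
Qed.

Lemma le_prode (I : Type) (r : seq I) (f g : I -> \bar R) :
  (forall i, 0 <= f i)%E -> (forall i, f i <= g i)%E ->
  (\prod_(i <- r) f i <= \prod_(i <- r) g i)%E.
Proof.
move=> f0 fg; suff /andP[] : (0 <= \prod_(i <- r) f i)%E &&
    (\prod_(i <- r) f i <= \prod_(i <- r) g i)%E by [].
apply: (big_ind2 (fun a b => (0 <= a)%E && (a <= b)%E)) => //.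
- by rewrite lee01 lexx.
- by move=> a b a' b' /andP[a0 ab] /andP[a0' ab']; rewrite mule_ge0// lee_pmul.
- by move=> i _; rewrite f0 fg.
Qed.

Lemma local_weight_le_prod (b : R) y : 0 < b ->
  ((local_weight b y)%:E <= \prod_i coordinate_weight (b / m%:R) (y i 0%R))%E.
Proof.
move=> b0; have mR : 0 < m%:R :> R by rewrite ltr0n.
have c0 : 0 < b / m%:R by rewrite divr_gt0.
rewrite /local_weight; case: ifPn => [y2|_]; last first.
  by apply: prode_ge0 => i _; exact: coordinate_weight_ge0.
have -> : (euclid_norm y `^ (- b))%:E =
    (\prod_(i < m) (euclid_norm y `^ (- (b / m%:R)))%:E)%E.
  rewrite prodEFin prodr_const card_ord -powR_mulrn ?powR_ge0// -powRrM.
  by rewrite mulNr divfK ?gt_eqF.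
apply: le_prode => i; first by rewrite lee_fin powR_ge0.
have yi := norm_coord_le_euclid y i.
rewrite /coordinate_weight !indicE.
have [->|yi0] := eqVneq (y i 0) 0.
  rewrite [0 \in [set 0]]mem_set// mule1 addey ?leey//.
rewrite [_ \in [set 0]]memNset ?mule0 ?adde0; last by move/eqP; rewrite (negbTE yi0).
rewrite mem_set ?mulr1; last first.
  by rewrite /= in_itv/= -ler_norml (le_trans yi)// ltW.
have ai : 0 < `|y i 0| by rewrite normr_gt0.
rewrite lee_fin !powRN lef_pV2 ?posrE ?powR_gt0// ?(lt_le_trans ai)//.
by rewrite ge0_ler_powR ?nnegrE ?(ltW c0)// (le_trans _ yi).
Qed.

Lemma local_weight_lty (b : R) : 0 < b < m%:R ->
  (\int[leb]_y (local_weight b y)%:E < +oo)%E.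
Proof.
move=> /andP[b0 bm]; have mR : 0 < m%:R :> R by rewrite ltr0n.
have c01 : 0 < b / m%:R < 1 by rewrite divr_gt0//= ltr_pdivrMr// mul1r.
pose phi (i : 'I_m) := coordinate_weight (b / m%:R).
have phi0 i r : (0 <= phi i r)%E by exact: coordinate_weight_ge0.
have mphi i : measurable_fun setT (phi i) by exact: measurable_coordinate_weight.
apply: (@le_lt_trans _ _ (\int[leb]_y \prod_i phi i (y i 0%R))%E).
  apply: ge0_le_integral => //.
  - by move=> y _; rewrite lee_fin local_weight_ge0.
  - by apply/measurable_EFinP; exact: measurable_local_weight.
  - apply: emeasurable_prod => i; apply: (measurableT_comp (mphi i)).
    exact: measurable_coord.
  by move=> y _; exact: local_weight_le_prod.
rewrite (ge0_integral_cV_prod mphi phi0).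
suff /andP[] : (0 <= \prod_(i < m) \int[mu]_r phi i r)%E &&
    (\prod_(i < m) \int[mu]_r phi i r < +oo)%E by [].
apply: (big_ind (fun a => (0 <= a)%E && (a < +oo)%E)) => //.
- by rewrite lee01 ltry.
- by move=> a a' /andP[a0 ay] /andP[a0' ay']; rewrite mule_ge0// lte_mul_pinfty//
    ge0_fin_numE.
- move=> i _; rewrite integral_ge0; last by move=> r _; exact: phi0.
  exact: coordinate_weight_lty.
Qed.

End local_weight.

Lemma density_le_local_weight (R : realType) (n : nat) (gamma : R)
    (eta : cutoff R (n + n)) y :
  density gamma eta y <= local_weight gamma y.
Proof.
rewrite /density /local_weight; have /andP[e0 e1] := cutoff_itv eta y.
case: ltP => y2; last by rewrite cutoff0// mul0r.
by rewrite -[leRHS]mul1r ler_wpM2r// powR_ge0.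
Qed.

Section interpolation.
Context {R : realType} {n : nat}.
Variables (A : 'M[R]_(n + n)) (gamma theta c : R).
Hypotheses (symA : A^T = A) (n0 : (0 < n)%N).
Hypothesis detB : \det (2 *: A + symp_mx R n) != 0.
Local Notation m := (n + n)%N.
Local Notation H := (heisenberg R n).
Local Notation V := 'cV[R]_m.
Local Notation leb := (@lebesgue_cV R m).
Local Notation haar := (@haar R n).
Local Notation v := (m.+1%:R / m.+2%:R : R).
Hypotheses (theta01 : 0 <= theta < 1) (c01 : 0 <= c <= 1).
Hypothesis gamma_lt : 0 < gamma < (1 - theta) * m%:R.

Local Notation u := ((1 - theta) * c + theta * v).
Local Notation u' := ((1 - theta) * c + theta * (1 - v)).
Hypothesis u0 : 0 < u.

Lemma interpolation_target_gt0 : 0 < u'.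
Proof.
have /andP[t0 t1] := theta01; have /andP[c0 _] := c01.
have v1 : 0 < 1 - v by rewrite subr_gt0 ltr_pdivrMr ?ltr0n// mul1r ltr_nat.
have t1' : 0 < 1 - theta by rewrite subr_gt0.
move: t0; rewrite le_eqVlt => /predU1P[t0|t0].
  by move: u0; rewrite -t0 !mul0r !addr0.
by rewrite ltr_wpDl ?(mulr_gt0 t0 v1)// mulr_ge0// ltW.
Qed.

Local Notation W := (local_weight (gamma / (1 - theta))).

Lemma interpolation_weight (y : V) :
  local_weight gamma y = W y `^ (1 - theta).
Proof.
have /andP[_ t1] := theta01.
have t0 : 1 - theta != 0 by rewrite gt_eqF// subr_gt0.
by rewrite -local_weight_powR// divfK.
Qed.

Lemma interpolation_mass : (\int[leb]_y (W y)%:E < +oo)%E.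
Proof.
have /andP[_ t1] := theta01; have /andP[g0 g1] := gamma_lt.
apply: local_weight_lty; first by rewrite addn_gt0 n0.
by rewrite divr_gt0 ?subr_gt0//= ltr_pdivrMr ?subr_gt0// mulrC.
Qed.

Local Notation M := (\int[leb]_y (W y)%:E)%E.

(** Two applications of Hoelder in [y]: the weight is split between the
    averaging operator of finite mass and the one over the whole graph. *)
Lemma average_le_geometric_mean (P : H -> R) (g : H) :
  measurable_fun setT P -> (forall h, 0 <= P h) ->
  (average A (local_weight gamma) (fun h => (P h `^ u)%:E) g <=
   (average A W (fun h => (P h)%:E) g `^ c * M `^ (1 - c)) `^ (1 - theta) *
   (\int[leb]_y (P (graph_shift A g y) `^ v)%:E) `^ theta)%E.
Proof.
move=> mP P0.
have /andP[t0 t1] := theta01; have /andP[c0 c1] := c01.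
have t1' : 0 < 1 - theta by rewrite subr_gt0.
have mS : measurable_fun setT (fun y => P (graph_shift A g y)).
  by apply: (measurableT_comp mP); exact: measurable_graph_shift.
have mW : measurable_fun setT (W : V -> R) by exact: measurable_local_weight.
have W0 (y : V) : 0 <= W y by exact: local_weight_ge0.
pose f1 (y : V) : \bar R := (P (graph_shift A g y) `^ c * W y)%:E.
pose f2 (y : V) : \bar R := (P (graph_shift A g y) `^ v)%:E.
have mf1 : measurable_fun setT f1.
  by apply/measurable_EFinP; apply: measurable_funM => //; exact: measurable_powR_comp.
have mf2 : measurable_fun setT f2 by apply/measurable_EFinP; exact: measurable_powR_comp.
have f10 y : (0 <= f1 y)%E by rewrite lee_fin mulr_ge0 ?powR_ge0.
have f20 y : (0 <= f2 y)%E by rewrite lee_fin powR_ge0.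
have -> : average A (local_weight gamma) (fun h => (P h `^ u)%:E) g =
    (\int[leb]_y (f1 y `^ (1 - theta) * f2 y `^ theta))%E.
  apply: eq_integral => y _; rewrite interpolation_weight /f1 /f2.
  rewrite !poweR_EFin -!EFinM; congr EFin.
  rewrite powRM ?powR_ge0// powRD; last by rewrite gt_eqF.
  by rewrite -!powRrM [c * _]mulrC [v * _]mulrC mulrAC.
have tt : (1 - theta) + theta = 1 by ring.
apply: le_trans (ge0_hoelder leb (ltW t1') t0 tt mf1 mf2 f10 f20) _.
apply: lee_wpmul2r; first exact: poweR_ge0.
apply: le_poweR; [exact: ltW|exact: integral_ge0|].
pose f3 (y : V) : \bar R := (P (graph_shift A g y) * W y)%:E.
pose f4 (y : V) : \bar R := (W y)%:E.
have mf3 : measurable_fun setT f3.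
  by apply/measurable_EFinP; exact: measurable_funM.
have mf4 : measurable_fun setT f4 by exact/measurable_EFinP.
have f30 y : (0 <= f3 y)%E by rewrite lee_fin mulr_ge0.
have f40 y : (0 <= f4 y)%E by rewrite lee_fin.
have -> : (\int[leb]_y f1 y = \int[leb]_y (f3 y `^ c * f4 y `^ (1 - c)))%E.
  apply: eq_integral => y _; rewrite /f1 /f3 /f4 !poweR_EFin -EFinM; congr EFin.
  rewrite powRM// -mulrA -powRD; last by rewrite addrC subrK oner_eq0.
  by rewrite [c + _]addrC subrK powRr1.
have c1' : 0 <= 1 - c by rewrite subr_ge0.
have cc : c + (1 - c) = 1 by ring.
exact: (ge0_hoelder leb c0 c1' cc mf3 mf4 f30 f40).
Qed.

(** Raise [average_le_geometric_mean] to the power [1 / u'] and apply Hoelder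
    with the weights [a] for the average of finite mass and [b] for the
    [m.+2]-th power of the full one; they add up to [1] because
    [1 - v = 1 / m.+2]. *)
Lemma average_bound : exists K : R, 0 <= K /\
  forall P : H -> R, measurable_fun setT P -> (forall h, 0 <= P h) ->
  (\int[haar]_g (average A (local_weight gamma) (fun h => (P h `^ u)%:E) g `^ u'^-1) <=
   K%:E * (\int[haar]_g (P g)%:E) `^ (u / u'))%E.
Proof.
have /andP[t0 t1] := theta01; have /andP[c0 c1] := c01.
have t1' : 0 < 1 - theta by rewrite subr_gt0.
have u'0 := interpolation_target_gt0.
have M0 : (0 <= M)%E by apply: integral_ge0 => y _; rewrite lee_fin local_weight_ge0.
have ME : M = (fine M)%:E.
  by rewrite fineK// ge0_fin_numE//; exact: interpolation_mass.
set Mr := fine M in ME.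
have Mr0 : 0 <= Mr by rewrite -lee_fin -ME.
have m0 : (0 < m)%N by rewrite addn_gt0 n0.
pose C := full_average_const A.
have C0 : 0 <= C by exact: full_average_const_ge0.
pose a := c * (1 - theta) / u'; pose b := theta / u' / m.+2%:R.
have m2 : m.+2%:R != 0 :> R by rewrite pnatr_eq0.
have b0 : 0 <= b by rewrite !divr_ge0// ltW.
have a0 : 0 <= a by rewrite divr_ge0 ?mulr_ge0 ?(ltW t1')// ltW.
have v1E : 1 - v = m.+2%:R^-1.
  by rewrite -[X in X - _](divff m2) -mulrBl -natrB// subSnn mul1r.
have ab : a + b = 1.
  have -> : a + b = ((1 - theta) * c + theta * m.+2%:R^-1) / u' by rewrite /a /b; ring.
  have -> : (1 - theta) * c + theta * m.+2%:R^-1 = u' by rewrite -[in LHS]v1E.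
  by rewrite divff// gt_eqF.
have abE : a + m.+1%:R * b = u / u' by rewrite /a /b; ring.
pose Q := Mr `^ ((1 - c) * (1 - theta) / u').
have Q0 : 0 <= Q by exact: powR_ge0.
exists (Q * (Mr `^ a * C `^ b)); split; first by rewrite !mulr_ge0 ?powR_ge0.
move=> P mP P0.
pose h (g : H) : \bar R := average A W (fun h => (P h)%:E) g.
pose k1 (g : H) : \bar R := (\int[leb]_y (P (graph_shift A g y) `^ v)%:E)%E.
pose F0 (g : H) := P g `^ m.+2%:R^-1.
have mpow (d : R) : measurable_fun setT (fun h : H => P h `^ d).
  exact: measurable_powR_comp.
have F0v g : F0 g ^+ m.+1 = P g `^ v.
  by rewrite -powR_mulrn ?powR_ge0// -powRrM mulrC.
have F02 g : F0 g ^+ m.+2 = P g.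
  by rewrite -powR_mulrn ?powR_ge0// -powRrM mulVf// powRr1.
have mPE : measurable_fun setT (fun g : H => (P g)%:E) by exact/measurable_EFinP.
have P0E g : (0 <= (P g)%:E)%E by rewrite lee_fin.
have W0 (y : V) : 0 <= W y by exact: local_weight_ge0.
have mW : measurable_fun setT (W : V -> R) by exact: measurable_local_weight.
have mh : measurable_fun setT h by exact: measurable_average.
have h0 g : (0 <= h g)%E by exact: average_ge0.
have mk1 : measurable_fun setT k1.
  apply: (measurable_integral_snd leb
    (f := fun g y => (P (graph_shift A g y) `^ v)%:E)); last first.
    by move=> g y; rewrite lee_fin powR_ge0.
  apply/measurable_EFinP.
  exact: (measurableT_comp (mpow v) (measurable_graph_shift2 A)).
have k10 g : (0 <= k1 g)%E.
  by apply: integral_ge0 => y _; rewrite lee_fin powR_ge0.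
pose k (g : H) : \bar R := (k1 g ^+ m.+2)%E.
have mk : measurable_fun setT k by exact: emeasurable_funX.
have k0 g : (0 <= k g)%E by exact: expe_ge0.
have Ih : (\int[haar]_g h g = M * \int[haar]_g (P g)%:E)%E by exact: integral_average.
have Ik : (\int[haar]_g k g <= C%:E * (\int[haar]_g (P g)%:E) ^+ m.+1)%E.
  have mF0 : measurable_fun setT F0 by exact: mpow.
  have F00 g : 0 <= F0 g by exact: powR_ge0.
  have := full_average_bound symA m0 detB mF0 F00.
  have -> : (\int[haar]_g (F0 g ^+ m.+2)%:E = \int[haar]_g (P g)%:E)%E.
    by apply: eq_integral => g _; rewrite F02.
  apply: le_trans; apply: eq_lexx.
  apply: eq_integral => g _; congr (_ ^+ _)%E; apply: eq_integral => y _.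
  by rewrite F0v.
have I0 : (0 <= \int[haar]_g (P g)%:E)%E by exact: integral_ge0.
set I := (\int[haar]_g (P g)%:E)%E in Ih Ik I0 *.
have pt g : (average A (local_weight gamma) (fun h => (P h `^ u)%:E) g `^ u'^-1 <=
    Q%:E * (h g `^ a * k g `^ b))%E.
  apply: le_trans.
    apply: le_poweR; last exact: average_le_geometric_mean.
      by rewrite invr_ge0 ltW.
    apply: average_ge0 => [y|h']; first exact: local_weight_ge0.
    by rewrite lee_fin powR_ge0.
  have -> : (k g `^ b = k1 g `^ (theta / u'))%E.
    rewrite /k expe_poweR// -poweRrM /b; congr (_ `^ _)%E.
    by rewrite mulrCA mulfV// mulr1.
  have hc : (0 <= h g `^ c)%E by exact: poweR_ge0.
  have Mc : (0 <= Mr%:E `^ (1 - c))%E by exact: poweR_ge0.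
  rewrite -/(h g) -/(k1 g) ME (poweRM (1 - theta) hc Mc).
  rewrite poweRM ?mule_ge0 ?poweR_ge0// poweRM ?poweR_ge0//.
  rewrite -!poweRrM [X in (X * _ <= _)%E]muleC -muleA.
  by rewrite /Q /a -!mulrA.
have mpa := measurable_poweR_comp a mh; have mpb := measurable_poweR_comp b mk.
have pab g : (0 <= h g `^ a * k g `^ b)%E by rewrite mule_ge0 ?poweR_ge0.
have mab : measurable_fun setT (fun g => h g `^ a * k g `^ b)%E.
  exact: emeasurable_funM.
have mavg : measurable_fun setT (fun g =>
    average A (local_weight gamma) (fun h => (P h `^ u)%:E) g `^ u'^-1)%E.
  apply: measurable_poweR_comp; apply: measurable_average.
  - exact: measurable_local_weight.
  - exact: local_weight_ge0.
  - by apply/measurable_EFinP; exact: mpow.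
  - by move=> g; rewrite lee_fin powR_ge0.
apply: (@le_trans _ _ (\int[haar]_g (Q%:E * (h g `^ a * k g `^ b)))%E).
  apply: ge0_le_integral => //.
  - by move=> g _; exact: poweR_ge0.
  - exact: measurable_funeM.
rewrite (ge0_integralZl_EFin haar measurableT (fun g _ => pab g) mab Q0).
rewrite EFinM -muleA; apply: lee_wpmul2l; first by rewrite lee_fin.
apply: le_trans (ge0_hoelder haar a0 b0 ab mh mk h0 k0) _.
rewrite Ih ME poweRM ?lee_fin// EFinM -!muleA poweR_EFin.
apply: lee_wpmul2l; first by rewrite lee_fin powR_ge0.
apply: (@le_trans _ _ (I `^ a * (C%:E * I ^+ m.+1) `^ b)%E).
  apply: lee_wpmul2l; first exact: poweR_ge0.
  by apply: le_poweR => //; exact: integral_ge0.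
rewrite poweRM ?lee_fin ?expe_ge0// expe_poweR// -poweRrM muleCA poweR_EFin.
rewrite -poweRD; first by rewrite abE.
by apply: add_neq0_poweRD_def; rewrite abE gt_eqF// divr_gt0.
Qed.

End interpolation.

(** * Points of the type set *)

Section norms.
Context {d : measure_display} {T : measurableType d} {R : realType}.
Variable mu : {measure set T -> \bar R}.
Local Notation normc := ComplexField.Normc.normc.

(** Each side is the supremum of the integrals of the simple functions below the
    integrand. *)
Lemma le_ge0_integral (f g : T -> \bar R) :
  (forall x, 0 <= f x)%E -> (forall x, f x <= g x)%E ->
  (\int[mu]_x f x <= \int[mu]_x g x)%E.
Proof.
move=> f0 fg; have g0 x : (0 <= g x)%E by exact: le_trans (fg x).
rewrite !ge0_integralTE//; apply: le_ereal_sup => _ [h hf <-].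
by exists h => // x; exact: le_trans (hf x) (fg x).
Qed.

Lemma measurable_normc (f : T -> R[i]) : cmeasurable f ->
  measurable_fun setT (fun x => normc (f x)).
Proof.
move=> [mr mi]; have -> : (fun x => normc (f x)) = (fun x =>
    Num.sqrt (complex.Re (f x) ^+ 2 + complex.Im (f x) ^+ 2)).
  by apply/funext => x; case: (f x).
apply: (measurableT_comp (f := @Num.sqrt R)).
  by apply: continuous_measurable_fun; exact: sqrt_continuous.
by apply: measurable_funD; exact: measurable_funX.
Qed.

Lemma normc_ge0 (z : R[i]) : 0 <= normc z.
Proof. by case: z => a b; exact: sqrtr_ge0. Qed.

Lemma norm_Re_le_normc (z : R[i]) : `|complex.Re z| <= normc z.
Proof.
by case: z => a b /=; rewrite -sqrtr_sqr ler_wsqrtr// lerDl sqr_ge0.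
Qed.

Lemma norm_Im_le_normc (z : R[i]) : `|complex.Im z| <= normc z.
Proof.
by case: z => a b /=; rewrite -sqrtr_sqr ler_wsqrtr// lerDr sqr_ge0.
Qed.

Lemma normc_le_add (a b : R) : normc (Complex a b) <= `|a| + `|b|.
Proof.
rewrite /= -[leRHS]ger0_norm ?addr_ge0// -sqrtr_sqr ler_wsqrtr// sqrrD.
rewrite !real_normK ?num_real// addrAC lerDl.
by rewrite mulrn_wge0// mulr_ge0.
Qed.

Lemma Lnorm_EFin (p : R) (f : T -> \bar R) :
  Lnorm mu p%:E f = ((\int[mu]_x (`|f x| `^ p)) `^ p^-1)%E.
Proof. by rewrite unlock. Qed.

Lemma ae_le_Lnorm_oo (f : T -> \bar R) :
  \forall x \ae mu, (`|f x| <= Lnorm mu +oo f)%E.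
Proof.
rewrite unlock /=; case: ifPn => [_|]; first exact: ess_sup_ge.
rewrite -leNgt => mu0; exists setT; split => //.
by apply/eqP; rewrite eq_le mu0 measure_ge0.
Qed.

Lemma Lnorm_oo_le (f : T -> \bar R) (y : \bar R) : (0 <= y)%E ->
  (\forall x \ae mu, (`|f x| <= y)%E) -> (Lnorm mu +oo f <= y)%E.
Proof.
by move=> y0 fy; rewrite unlock /=; case: ifPn => // _; apply/ess_supP.
Qed.

End norms.

Section convolution_bounds.
Context {R : realType} {n : nat}.
Variables (A : 'M[R]_(n + n)) (gamma : R) (eta : cutoff R (n + n)).
Local Notation m := (n + n)%N.
Local Notation H := (heisenberg R n).
Local Notation leb := (@lebesgue_cV R m).
Local Notation haar := (@haar R n).
Local Notation nu := (nu_gamma A gamma eta).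
Local Notation RT := (measurableTypeR R).
Local Notation normc := ComplexField.Normc.normc.

Lemma measurable_heis_shift (g : H) :
  measurable_fun setT (fun h : H => heis_mul g (heis_inv h) : H).
Proof.
have m1 : measurable_fun setT (fun h : H => - h.1).
  by apply: measurable_oppmx; exact: measurable_fst.
apply: measurable_fun_pair; first exact: measurable_addmx.
apply: measurable_funD; last exact: measurable_symp.
have m2 : measurable_fun setT (fun h : H => - (h.2 : R) : RT).
  by apply: (measurableT_comp (f := @GRing.opp R)) => //; exact: measurable_snd.
exact: measurable_funD.
Qed.

Definition norm_average (f : H -> R[i]) (g : H) : \bar R :=
  average A (local_weight gamma) (fun h => (normc (f h))%:E) g.

Lemma integral_norm_le_average (f : H -> R[i]) (r : R[i] -> R) (g : H) :
  cmeasurable f -> measurable_fun setT (fun h => r (f h)) ->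
  (forall z, `|r z| <= normc z) ->
  (\int[nu]_h `|(r (f (heis_mul g (heis_inv h))))%:E| <=
   norm_average f g)%E.
Proof.
move=> mf mr rn.
have ms := measurable_heis_shift g.
rewrite (ge0_integral_nu_gamma A gamma eta
  (f := fun h => `|(r (f (heis_mul g (heis_inv h))))%:E|%E)) //; last first.
  apply: measurableT_comp => //; apply/measurable_EFinP.
  exact: (measurableT_comp mr ms).
apply: le_ge0_integral => y.
  by rewrite mule_ge0 ?abse_ge0// lee_fin density_ge0.
apply: lee_pmul => //; rewrite ?abse_ge0 ?lee_fin ?density_ge0//.
exact: density_le_local_weight.
Qed.

Lemma conv_defined_of_average (f : H -> R[i]) (g : H) :
  cmeasurable f -> (norm_average f g < +oo)%E -> conv_defined nu f g.
Proof.
move=> mf Tg; have [mr mi] := mf; have ms := measurable_heis_shift g.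
split; apply/integrableP; split.
- by apply/measurable_EFinP; exact: (measurableT_comp mr ms).
- apply: le_lt_trans Tg; apply: integral_norm_le_average => //.
  exact: norm_Re_le_normc.
- by apply/measurable_EFinP; exact: (measurableT_comp mi ms).
- apply: le_lt_trans Tg; apply: integral_norm_le_average => //.
  exact: norm_Im_le_normc.
Qed.

Lemma abs_fine_le (x : \bar R) : (`|fine x|%:E <= `|x|)%E.
Proof. by case: x => [r| |] //=; rewrite ?normr0 leey. Qed.

(** The constant [2] accounts for the real and the imaginary part.  Where the
    right-hand side is infinite there is nothing to prove, so the bound holds
    even where the convolution is meaningless. *)
Lemma normc_conv_le (f : H -> R[i]) (g : H) : cmeasurable f ->
  ((normc (heis_conv nu f g))%:E <= 2%:E * norm_average f g)%E.
Proof.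
move=> mf; have [mr mi] := mf; have ms := measurable_heis_shift g.
rewrite /heis_conv /cintegral.
apply: (@le_trans _ _ (`|\int[nu]_h complex.Re (f (heis_mul g (heis_inv h)))|%:E +
    `|\int[nu]_h complex.Im (f (heis_mul g (heis_inv h)))|%:E)%E).
  by rewrite -EFinD lee_fin; exact: normc_le_add.
have step (r : R[i] -> R) : measurable_fun setT (fun h => r (f h)) ->
    (forall z, `|r z| <= normc z) ->
    (`|\int[nu]_h r (f (heis_mul g (heis_inv h)))|%:E <= norm_average f g)%E.
  move=> mrf rn; apply: le_trans (integral_norm_le_average g mf mrf rn).
  apply: le_trans (abs_fine_le _) _; apply: le_abse_integral => //.
  by apply/measurable_EFinP; exact: (measurableT_comp mrf ms).
rewrite -[2%:E]/((1 + 1)%:E) EFinD; last first.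
rewrite ge0_muleDl ?lee_fin// mul1e; apply: leeD.
  by apply: step => //; exact: norm_Re_le_normc.
by apply: step => //; exact: norm_Im_le_normc.
Qed.

Lemma measurable_norm_average (f : H -> R[i]) :
  cmeasurable f -> measurable_fun setT (norm_average f).
Proof.
move=> mf; apply: measurable_average => //.
- exact: measurable_local_weight.
- exact: local_weight_ge0.
- by apply/measurable_EFinP; exact: measurable_normc.
- by move=> h; rewrite lee_fin normc_ge0.
Qed.

Lemma norm_average_ge0 (f : H -> R[i]) g : (0 <= norm_average f g)%E.
Proof.
apply: average_ge0 => [y|h]; first exact: local_weight_ge0.
by rewrite lee_fin normc_ge0.
Qed.

End convolution_bounds.

Section sufficiency.
Context {R : realType} {n : nat}.
Variables (A : 'M[R]_(n + n)) (gamma : R) (eta : cutoff R (n + n)).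
Hypotheses (symA : A^T = A) (n0 : (0 < n)%N).
Hypothesis detB : \det (2 *: A + symp_mx R n) != 0.
Local Notation m := (n + n)%N.
Local Notation H := (heisenberg R n).
Local Notation leb := (@lebesgue_cV R m).
Local Notation haar := (@haar R n).
Local Notation nu := (nu_gamma A gamma eta).
Local Notation v := (m.+1%:R / m.+2%:R : R).
Local Notation normc := ComplexField.Normc.normc.

(** The set [N] where [|f|] exceeds its essential supremum is null, and so the
    average of its indicator, whose integral is the mass times the measure of
    [N], vanishes almost everywhere. *)
Lemma type_set_origin : 0 < gamma < m%:R -> type_set nu (0, 0).
Proof.
move=> gm; split; rewrite /= ?lexx ?ler01// inve0.
have Moo : (\int[leb]_y (local_weight gamma y)%:E < +oo)%E.
  by apply: local_weight_lty => //; rewrite addn_gt0 n0.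
have w0 (y : 'cV[R]_m) : 0 <= local_weight gamma y by exact: local_weight_ge0.
have mw : measurable_fun setT (local_weight gamma : 'cV[R]_m -> R).
  exact: measurable_local_weight.
have M0 : (0 <= \int[leb]_y (local_weight gamma y)%:E)%E.
  by apply: integral_ge0 => y _; rewrite lee_fin.
set M := (\int[leb]_y (local_weight gamma y)%:E)%E in Moo M0 *.
have ME : M = (fine M)%:E by rewrite fineK// ge0_fin_numE.
exists (2 * fine M) => f mf.
pose F (h : H) := normc (f h).
have mF : measurable_fun setT F by exact: measurable_normc.
have F0 h : 0 <= F h by exact: normc_ge0.
rewrite /cLnorm -/F => Loo.
have L0 : (0 <= Lnorm haar +oo (fun h => (F h)%:E))%E by exact: Lnorm_ge0.
have LE : Lnorm haar +oo (fun h => (F h)%:E) =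
    (fine (Lnorm haar +oo (fun h => (F h)%:E)))%:E by rewrite fineK// ge0_fin_numE.
have := ae_le_Lnorm_oo haar (fun h => (F h)%:E).
rewrite LE; set S := fine _ => FS.
have S0 : 0 <= S by rewrite -lee_fin -LE.
pose N : set H := [set h | S < F h].
have mN : measurable N.
  rewrite [X in measurable X](_ : N = F @^-1` `]S, +oo[%classic); last first.
    by apply/seteqP; split => h /=; rewrite in_itv/= andbT.
  by rewrite -[X in measurable X]setTI; apply: mF => //; exact: measurable_itv.
have N0 : haar N = 0%E.
  suff : haar.-negligible N by move/negligibleP; exact.
  case: FS => B [mB B0 FB]; exists B; split => // h /= Sh; apply: FB => /=.
  by rewrite lee_fin ger0_norm// leNgt => /negP; exact.
have mN1 : measurable_fun setT (fun h : H => (\1_N h)%:E : \bar R).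
  by apply/measurable_EFinP; exact: measurable_indic.
have N10 h : (0 <= (\1_N h)%:E :> \bar R)%E by rewrite lee_fin.
have TN : (\int[haar]_g average A (local_weight gamma) (fun h => (\1_N h)%:E) g = 0)%E.
  by rewrite integral_average// integral_indic// setIT N0 mule0.
have mTN : measurable_fun setT (average A (local_weight gamma) (fun h => (\1_N h)%:E)).
  exact: measurable_average.
have TN0 : \forall g \ae haar,
    average A (local_weight gamma) (fun h => (\1_N h)%:E) g = 0%E.
  have : ae_eq haar setT (average A (local_weight gamma) (fun h => (\1_N h)%:E)) (cst 0%E).
    apply/(ae_eq_integral_abs haar measurableT mTN).
    rewrite -[RHS]TN; apply: eq_integral => g _.
    by rewrite gee0_abs//; exact: average_ge0.
  by apply: filterS => g /= /(_ Logic.I).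
have Tae : \forall g \ae haar, (norm_average A gamma f g <= (S * fine M)%:E)%E.
  apply: filterS TN0 => g TNg.
  have mi : measurable_fun setT (fun y =>
      (\1_N (graph_shift A g y))%:E * (local_weight gamma y)%:E : \bar R)%E.
    exact: (measurable_slice_snd (F := fun g y =>
      ((\1_N (graph_shift A g y))%:E * (local_weight gamma y)%:E)%E)
      (measurable_average_integrand A mw mN1) g).
  have aey : ae_eq leb setT (fun y =>
      (\1_N (graph_shift A g y))%:E * (local_weight gamma y)%:E)%E (cst 0%E).
    apply/(ae_eq_integral_abs leb measurableT mi).
    rewrite -[RHS]TNg; apply: eq_integral => y _.
    by rewrite gee0_abs// mule_ge0// lee_fin.
  rewrite EFinM -ME /M -(ge0_integralZl_EFin leb measurableT _ _ S0); last 2 first.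
  - by move=> y _; rewrite lee_fin.
  - exact/measurable_EFinP.
  have mFE : measurable_fun setT (fun h : H => (F h)%:E) by exact/measurable_EFinP.
  apply: ae_ge0_le_integral => //.
  - by move=> y _; rewrite -EFinM lee_fin mulr_ge0// normc_ge0.
  - exact: (measurable_slice_snd (F := fun g y =>
      ((F (graph_shift A g y))%:E * (local_weight gamma y)%:E)%E)
      (measurable_average_integrand A mw mFE) g).
  - by move=> y _; rewrite -EFinM lee_fin mulr_ge0.
  - by apply: measurable_funeM; exact/measurable_EFinP.
  apply: filterS aey => y /= /(_ Logic.I) + _.
  rewrite -!EFinM => -[]; rewrite indicE lee_fin.
  case: (boolP (_ \in N)) => [_|]; first by rewrite mul1r => ->; rewrite !mulr0.
  by move=> /negP; rewrite inE /N /= => /negP; rewrite -leNgt => FS' _; exact: ler_wpM2r.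
split.
  apply: filterS Tae => g Tg; apply: conv_defined_of_average => //.
  by rewrite (le_lt_trans Tg)// ltry.
apply: Lnorm_oo_le; first by rewrite mule_ge0// lee_fin mulr_ge0// -lee_fin -ME.
apply: filterS Tae => g Tg; rewrite gee0_abs; last by rewrite lee_fin normc_ge0.
apply: le_trans (normc_conv_le A gamma eta g mf) _.
rewrite -EFinM -mulrA [fine M * S]mulrC (EFinM 2); apply: lee_wpmul2l => //.
Qed.

Section positive_exponents.
Variables theta c : R.
Hypotheses (theta01 : 0 <= theta < 1) (c01 : 0 <= c <= 1).
Hypothesis gamma_lt : 0 < gamma < (1 - theta) * m%:R.
Local Notation u := ((1 - theta) * c + theta * v).
Local Notation u' := ((1 - theta) * c + theta * (1 - v)).
Hypothesis u0 : 0 < u.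

Lemma type_set_interpolation : type_set nu (u, u').
Proof.
have /andP[t0 t1] := theta01; have /andP[c0 c1] := c01.
have v0 : 0 <= v by rewrite divr_ge0.
have v1 : v <= 1 by rewrite ler_pdivrMr ?ltr0n// mul1r ler_nat.
have u'0 : 0 < u' by exact: interpolation_target_gt0.
have u1 : u <= 1 by move: v0 v1; set w := v; nra.
have u'1 : u' <= 1 by move: v0 v1; set w := v; nra.
have [K [K0 bound]] := average_bound symA n0 detB theta01 c01 gamma_lt u0.
have un : u != 0 by rewrite gt_eqF.
have u'n : u' != 0 by rewrite gt_eqF.
split; [by rewrite /= (ltW u0)|by rewrite /= (ltW u'0)|].
rewrite /= !inver (negbTE un) (negbTE u'n).
exists (2 * K `^ u') => f mf.
pose F (h : H) := normc (f h).
have mF : measurable_fun setT F by exact: measurable_normc.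
have F0 h : 0 <= F h by exact: normc_ge0.
rewrite /cLnorm -/F => Loo.
pose P h := F h `^ u^-1.
have mP : measurable_fun setT P by exact: measurable_powR_comp.
have P0 h : 0 <= P h by exact: powR_ge0.
have := bound P mP P0.
have -> : (\int[haar]_g (average A (local_weight gamma) (fun h => (P h `^ u)%:E) g `^ u'^-1) =
    \int[haar]_g (norm_average A gamma f g `^ u'^-1))%E.
  apply: eq_integral => g _; congr (_ `^ _)%E; rewrite /norm_average.
  by congr average; apply/funext => h; rewrite /P -powRrM mulVf// powRr1.
set I := (\int[haar]_g (P g)%:E)%E.
have I0 : (0 <= I)%E by apply: integral_ge0 => g _; rewrite lee_fin.
have LE : Lnorm haar (u^-1)%:E (fun h => (F h)%:E) = (I `^ u)%E.
  rewrite Lnorm_EFin invrK; congr (_ `^ _)%E; apply: eq_integral => g _.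
  by rewrite gee0_abs ?lee_fin// poweR_EFin.
move: Loo; rewrite LE => Iu.
have Ioo : (I < +oo)%E by apply: lty_poweRy Iu.
move=> bnd.
pose T := norm_average A gamma f.
have T0 g : (0 <= T g)%E by exact: norm_average_ge0.
have mT : measurable_fun setT T by exact: measurable_norm_average.
have Tq : (\int[haar]_g (T g `^ u'^-1) < +oo)%E.
  apply: le_lt_trans bnd _; rewrite lte_mul_pinfty ?lee_fin ?ge0_fin_numE//.
  - exact: ltry.
  - by rewrite poweR_lty.
have mTq := measurable_poweR_comp u'^-1 mT.
split.
  have : haar.-integrable setT (fun g => T g `^ u'^-1)%E.
    apply/integrableP; split => //.
    by under eq_integral do rewrite gee0_abs ?poweR_ge0//.
  move=> /(integrable_ae measurableT); apply: filterS => g /= /(_ Logic.I).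
  rewrite ge0_fin_numE ?poweR_ge0// => Tg; apply: conv_defined_of_average => //.
  by apply: lty_poweRy Tg; rewrite invr_neq0.
rewrite Lnorm_EFin invrK.
apply: (@le_trans _ _ ((\int[haar]_g ((2%:E * T g) `^ u'^-1)) `^ u')%E).
  apply: le_poweR; [exact: ltW|by apply: integral_ge0 => g _; exact: poweR_ge0|].
  apply: le_ge0_integral => g; first exact: poweR_ge0.
  apply: le_poweR; [by rewrite invr_ge0 ltW|exact: abse_ge0|].
  rewrite gee0_abs ?lee_fin ?normc_ge0//; exact: normc_conv_le.
have -> : (\int[haar]_g ((2%:E * T g) `^ u'^-1) =
    (2 `^ u'^-1)%:E * \int[haar]_g (T g `^ u'^-1))%E.
  rewrite -(ge0_integralZl_EFin haar measurableT (fun g _ => poweR_ge0 _ _) mTq);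
    last exact: powR_ge0.
  by apply: eq_integral => g _; rewrite poweRM// ?poweR_EFin// lee_fin.
rewrite poweRM ?lee_fin ?powR_ge0//; last first.
  by apply: integral_ge0 => g _; exact: poweR_ge0.
rewrite poweR_EFin -powRrM mulVf// powRr1// EFinM -muleA.
apply: lee_wpmul2l; first by rewrite lee_fin.
apply: (@le_trans _ _ ((K%:E * I `^ (u / u')) `^ u')%E).
  apply: le_poweR => //; first exact: ltW.
  by apply: integral_ge0 => g _; exact: poweR_ge0.
by rewrite poweRM ?lee_fin ?poweR_ge0// poweR_EFin -poweRrM divfK.
Qed.

End positive_exponents.
End sufficiency.

(** * Test sets *)

Lemma integral_cst_indic (d : measure_display) (T : measurableType d)
    (R : realType) (mu : {measure set T -> \bar R}) (F : set T) (k : R) :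
  measurable F -> 0 <= k ->
  (\int[mu]_x (k%:E * (\1_F x)%:E) = k%:E * mu F)%E.
Proof.
move=> mF k0; rewrite ge0_integralZl_EFin// ?integral_indic ?setIT//.
by apply/measurable_EFinP; exact: measurable_indic.
Qed.

Section test_sets.
Context {R : realType} {n : nat}.
Variables (A : 'M[R]_(n + n)) (gamma : R) (eta : cutoff R (n + n)).
Hypothesis n0 : (0 < n)%N.
Local Notation m := (n + n)%N.
Hypothesis gamma_lt : 0 < gamma < m%:R.
Local Notation H := (heisenberg R n).
Local Notation leb := (@lebesgue_cV R m).
Local Notation mu := (@lebesgue_measure R).
Local Notation RT := (measurableTypeR R).
Local Notation haar := (@haar R n).
Local Notation nu := (nu_gamma A gamma eta).
Local Notation dens := (density gamma eta).
Local Notation normc := ComplexField.Normc.normc.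

Definition indicator_average (E : set H) (g : H) : \bar R :=
  (\int[leb]_y ((\1_E (graph_shift A g y))%:E * (dens y)%:E))%E.

Lemma indicator_average_lty (E : set H) g : (indicator_average E g < +oo)%E.
Proof.
apply: (@le_lt_trans _ _ (\int[leb]_y (local_weight gamma y)%:E)%E); last first.
  by apply: local_weight_lty => //; rewrite addn_gt0 n0.
apply: le_ge0_integral => y.
  by rewrite mule_ge0// lee_fin density_ge0.
rewrite -EFinM lee_fin -[leRHS]mul1r ler_pM ?density_ge0//.
exact: density_le_local_weight.
Qed.

Lemma conv_indicator (E : set H) (g : H) : measurable E ->
  fine (indicator_average E g) <=
  normc (heis_conv nu (fun h => Complex (\1_E h) 0) g).
Proof.
move=> mE; apply: le_trans (norm_Re_le_normc _).
have ms := measurable_heis_shift g.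
rewrite /heis_conv /cintegral /= [X in _ <= `|X|](_ : _ = fine (indicator_average E g)).
  exact: ler_norm.
rewrite /Rintegral; congr fine.
rewrite (ge0_integral_nu_gamma A gamma eta
  (f := fun h => (\1_E (heis_mul g (heis_inv h)))%:E)).
- by [].
- apply/measurable_EFinP; apply: (measurableT_comp _ ms); exact: measurable_indic.
- by move=> h; rewrite lee_fin.
Qed.

Lemma Lnorm_indicator (E : set H) (u e : R) : measurable E -> 0 <= u ->
  haar E = e%:E ->
  (cLnorm haar (u%:E^-1)%E (fun h => Complex (\1_E h) 0%R) <= (e `^ u)%:E)%E.
Proof.
move=> mE u0 hE; rewrite /cLnorm.
have nE h : normc (Complex (\1_E h : R) 0) = \1_E h.
  by rewrite /= expr0n /= addr0 sqrtr_sqr ger0_norm.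
have [->|un] := eqVneq u 0.
  rewrite inve0 powRr0; apply: Lnorm_oo_le => //.
  by apply: nearW => h; rewrite nE gee0_abs ?lee_fin//.
rewrite inver (negbTE un) Lnorm_EFin invrK.
rewrite (_ : \int[haar]_h _ = haar E)%E ?hE ?poweR_EFin//.
transitivity (\int[haar]_h (\1_E h)%:E)%E; last by rewrite integral_indic// setIT.
apply: eq_integral => h _; rewrite nE gee0_abs ?lee_fin// poweR_EFin indicE.
by case: (_ \in _); rewrite ?powR1// powR0// invr_neq0.
Qed.

(** For [v = 0] the norm is an essential supremum, which cannot be smaller than a
    lower bound on a set of positive measure. *)
Lemma Lnorm_ge_on_set (h : H -> R) (F : set H) (kappa v f : R) :
  measurable F -> 0 <= kappa -> 0 <= v -> haar F = f%:E -> 0 < f ->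
  (forall g, F g -> kappa <= h g) -> (forall g, 0 <= h g) ->
  ((kappa * f `^ v)%:E <= Lnorm haar (v%:E^-1)%E (fun g => (h g)%:E))%E.
Proof.
move=> mF k0 v0 hF f0 kh h0.
have [->|vn] := eqVneq v 0.
  rewrite inve0 powRr0 mulr1 leNgt; apply/negP => Lk.
  have [B [mB B0 hB]] := ae_le_Lnorm_oo haar (fun g => (h g)%:E).
  have : (haar F <= haar B)%E.
    apply: le_measure; rewrite ?inE// => g Fg; apply: hB => /=.
    apply/negP; rewrite -ltNge; apply: lt_le_trans Lk _.
    by rewrite /= lee_fin ger0_norm// kh.
  by rewrite B0 hF lee_fin leNgt f0.
have vi : 0 < v^-1 by rewrite invr_gt0 lt_neqAle eq_sym vn.
rewrite inver (negbTE vn) Lnorm_EFin invrK.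
have -> : (kappa * f `^ v)%:E = (((kappa `^ v^-1)%:E * haar F) `^ v)%E.
  rewrite hF -EFinM poweR_EFin powRM ?powR_ge0 ?ltW// -powRrM mulVf// powRr1//.
apply: le_poweR => //; first by rewrite mule_ge0 ?lee_fin ?powR_ge0.
rewrite -integral_cst_indic ?powR_ge0//.
apply: le_ge0_integral => g; first by rewrite mule_ge0 ?lee_fin ?powR_ge0.
rewrite gee0_abs; last by rewrite lee_fin.
rewrite poweR_EFin -EFinM lee_fin indicE.
case: (boolP (g \in F)) => [|_]; last by rewrite mulr0 powR_ge0.
rewrite inE mulr1 => Fg; rewrite ge0_ler_powR ?nnegrE ?(ltW vi)//.
exact: kh.
Qed.

(** Apply the boundedness of the convolution to the indicator of [E]: its image
    is at least [kappa] on [F]. *)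
Lemma test_sets (u v : R) : type_set nu (u, v) -> exists2 c : R, 0 <= c &
  forall (E F : set H) (kappa e f : R), measurable E -> measurable F ->
    0 <= kappa -> haar E = e%:E -> haar F = f%:E -> 0 < f ->
    (forall g, F g -> (kappa%:E <= indicator_average E g)%E) ->
    kappa * f `^ v <= c * e `^ u.
Proof.
move=> [/= /andP[u0 _] /andP[v0 _] [c bound]].
exists `|c| => // E F kappa e f mE mF k0 hE hF f0 kF.
pose f1 (h : H) : R[i] := Complex (\1_E h) 0.
have mf1 : cmeasurable f1 by split; [exact: measurable_indic|exact: measurable_cst].
have Lf1 := Lnorm_indicator mE u0 hE.
have [_ bnd] := bound f1 mf1 (le_lt_trans Lf1 (ltry _)).
rewrite -lee_fin; apply: (@le_trans _ _ (cLnorm haar (v%:E^-1)%E (heis_conv nu f1))).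
  apply: (Lnorm_ge_on_set mF k0 v0 hF f0) => g; last exact: normc_ge0.
  move=> /kF kg; apply: le_trans (conv_indicator g mE).
  rewrite -lee_fin fineK// ge0_fin_numE ?indicator_average_lty//.
  by apply: integral_ge0 => y _; rewrite mule_ge0 ?lee_fin ?density_ge0.
apply: le_trans bnd _; rewrite EFinM; apply: (@le_trans _ _ (`|c|%:E * cLnorm haar (u%:E^-1)%E f1)%E).
  apply: lee_wpmul2r; first exact: Lnorm_ge0.
  by rewrite lee_fin ler_norm.
by apply: lee_wpmul2l; rewrite ?lee_fin.
Qed.

Definition box (a b : 'I_m -> R) : set 'cV[R]_m :=
  [set y | forall i, `[a i, b i]%classic (y i 0)].

Lemma measurable_box a b : measurable (box a b).
Proof.
rewrite [X in measurable X](_ : _ = \bigcap_(i in [set: 'I_m])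
    ((fun y : 'cV[R]_m => y i 0) @^-1` `[a i, b i]%classic)); last first.
  by apply/seteqP; split => y /= By i; [move=> _; exact: By|exact: (By i)].
apply: fin_bigcap_measurable => // i _; rewrite -[X in measurable X]setTI.
by apply: measurable_coord => //; exact: measurable_itv.
Qed.

Lemma lebesgue_box a b l : (forall i, b i - a i = l) -> 0 < l ->
  leb (box a b) = (l ^+ m)%:E.
Proof.
move=> abl l0.
rewrite /box (lebesgue_cV_box (B := fun i => `[a i, b i]%classic : set RT)); last first.
  by move=> i; exact: measurable_itv.
rewrite (eq_bigr (fun=> l%:E)).
  by rewrite prodEFin prodr_const card_ord.
move=> i _; rewrite [LHS]lebesgue_measure_itv /= lte_fin.
by rewrite -subr_gt0 abl l0 -EFinB abl.
Qed.

Definition slab (a b : 'I_m -> R) (phi : 'cV[R]_m -> R) (tau : R) : set H :=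
  [set g | box a b g.1 /\ `|(g.2 : R) - phi g.1| <= tau].

Section slab.
Variables (a b : 'I_m -> R) (phi : 'cV[R]_m -> R) (tau l : R).
Hypothesis mphi : measurable_fun setT phi.

Lemma measurable_slab : measurable (slab a b phi tau).
Proof.
rewrite [X in measurable X](_ : _ =
  (fst @^-1` box a b) `&`
  ((fun g : H => (g.2 : R) - phi g.1) @^-1` `[- tau, tau]%classic)); last first.
  by apply/seteqP; split => g /=; rewrite in_itv/= -ler_norml.
apply: measurableI; rewrite -[X in measurable X]setTI.
  apply: measurable_fst => //; exact: measurable_box.
have : measurable_fun setT (fun g : H => (g.2 : R) - phi g.1).
  apply: measurable_funB; first exact: measurable_snd.
  by apply: (measurableT_comp mphi); exact: measurable_fst.
by apply => //; exact: measurable_itv.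
Qed.

Lemma haar_slab : (forall i, b i - a i = l) -> 0 < l -> 0 < tau ->
  haar (slab a b phi tau) = (l ^+ m * (2 * tau))%:E.
Proof.
move=> abl l0 tau0; have mS := measurable_slab.
have mI : measurable_fun setT (fun g : H => (\1_(slab a b phi tau) g)%:E : \bar R).
  by apply/measurable_EFinP; exact: measurable_indic.
transitivity (\int[haar]_g (\1_(slab a b phi tau) g)%:E)%E.
  by rewrite integral_indic// setIT.
rewrite haar_integral//.
transitivity (\int[leb]_x ((2 * tau)%:E * (\1_(box a b) x)%:E))%E; last first.
  rewrite integral_cst_indic ?mulr_ge0 ?(ltW tau0)//; last exact: measurable_box.
  transitivity ((2 * tau)%:E * (l ^+ m)%:E)%E; last by rewrite -EFinM mulrC.
  by congr (_ * _)%E; exact: lebesgue_box.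
apply: eq_integral => x _.
have [xB|xB] := pselect (box a b x); last first.
  rewrite [\1_(box a b) x]indicE memNset// mule0; apply: integral0_eq => t _.
  by rewrite indicE memNset// => -[].
rewrite [\1_(box a b) x]indicE mem_set// mule1.
transitivity (\int[mu]_t (\1_(`[phi x - tau, phi x + tau]%classic : set RT) t)%:E)%E.
  apply: eq_integral => t _; congr (_%:E); rewrite !indicE; congr (_%:R); congr nat_of_bool.
  apply/idP/idP; rewrite !inE /slab /= in_itv/=.
    by move=> [_]; rewrite ler_distl.
  by rewrite -ler_distl.
rewrite integral_indic//.
rewrite setIT [LHS]lebesgue_measure_itv /= lte_fin.
rewrite -subr_gt0 (_ : _ - _ = 2 * tau); last by ring.
by rewrite mulr_gt0// -EFinB; congr EFin; ring.
Qed.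

End slab.

Lemma indicator_average_ge (E : set H) (g : H) (a b : 'I_m -> R) (l d : R) :
  measurable E -> (forall i, b i - a i = l) -> 0 < l -> 0 <= d ->
  (forall y, box a b y -> E (graph_shift A g y) /\ d <= dens y) ->
  ((d * l ^+ m)%:E <= indicator_average E g)%E.
Proof.
move=> mE abl l0 d0 Ed; rewrite EFinM -(lebesgue_box abl l0).
have mB := measurable_box a b.
rewrite -integral_cst_indic//.
apply: le_ge0_integral => y; first by rewrite mule_ge0 ?lee_fin.
rewrite -!EFinM lee_fin !indicE.
have [yB|yB] := pselect (box a b y); last first.
  by rewrite [y \in _]memNset// mulr0 mulr_ge0// density_ge0.
have [Ey dy] := Ed y yB.
by rewrite !mem_set// mulr1 mul1r.
Qed.

Lemma euclid_norm_le (y : 'cV[R]_m) (r : R) :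
  (forall i, `|y i 0| <= r) -> euclid_norm y <= m%:R * r.
Proof.
move=> yr; have m0 : (0 < m)%N by rewrite addn_gt0 n0.
have r0 : 0 <= r by apply: le_trans (yr (Ordinal m0)).
rewrite -[leRHS]ger0_norm ?mulr_ge0// -sqrtr_sqr ler_wsqrtr//.
apply: (@le_trans _ _ (\sum_(i < m) r ^+ 2)).
  apply: ler_sum => i _; rewrite -real_normK ?num_real//.
  by rewrite lerXn2r ?nnegrE.
rewrite sumr_const card_ord exprMn -[leLHS]mulr_natl ler_wpM2r ?sqr_ge0//.
by rewrite expr2 ler_peMl// ler1n.
Qed.

Lemma density_ge (y : 'cV[R]_m) (r : R) (i : 'I_m) :
  0 < r -> m%:R * r <= 1 -> y i 0 != 0 -> (forall j, `|y j 0| <= r) ->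
  (m%:R * r) `^ (- gamma) <= dens y.
Proof.
move=> r0 mr yi yr; have m0 : 0 < m%:R :> R by rewrite ltr0n addn_gt0 n0.
have ny := euclid_norm_le yr.
have ny0 : 0 < euclid_norm y.
  by apply: lt_le_trans (norm_coord_le_euclid y i); rewrite normr_gt0.
rewrite /density cutoff1 ?(le_trans ny)// mul1r !powRN.
have /andP[g0 _] := gamma_lt.
rewrite lef_pV2 ?posrE ?powR_gt0 ?mulr_gt0//.
by rewrite ge0_ler_powR ?nnegrE ?(ltW g0)// ?ltW// mulr_gt0.
Qed.

Lemma one_le_density (y : 'cV[R]_m) (r : R) (i : 'I_m) :
  0 < r -> m%:R * r <= 1 -> y i 0 != 0 -> (forall j, `|y j 0| <= r) ->
  1 <= dens y.
Proof.
move=> r0 mr yi yr; apply: le_trans (density_ge r0 mr yi yr).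
have m0 : 0 < m%:R :> R by rewrite ltr0n addn_gt0 n0.
have /andP[g0 _] := gamma_lt.
rewrite powRN invf_ge1 ?powR_gt0 ?mulr_gt0//.
apply: (@le_trans _ _ (1 `^ gamma)); last by rewrite powR1.
by rewrite ge0_ler_powR ?nnegrE ?(ltW g0)// mulr_ge0 ?ltW.
Qed.

End test_sets.

(** * Necessary conditions *)

Section scaling.
Context {R : realType}.

(** Otherwise the left-hand side dominates as [d] tends to [0]. *)
Lemma exponent_le (K1 K2 a b d0 : R) : 0 < K1 -> 0 < d0 ->
  (forall d, 0 < d < d0 -> K1 * d `^ a <= K2 * d `^ b) -> b <= a.
Proof.
move=> K10 d00 H; rewrite leNgt; apply/negP => ab.
pose s := b - a; have s0 : 0 < s by rewrite subr_gt0.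
pose C := `|K2| + 1; have C0 : 0 < C by rewrite ltr_wpDl.
pose q := K1 / (2 * C); have q0 : 0 < q by rewrite divr_gt0 ?mulr_gt0.
pose d := Num.min (d0 / 2) (q `^ s^-1).
have d_gt0 : 0 < d by rewrite lt_min divr_gt0//= powR_gt0.
have dd0 : d < d0.
  by rewrite gt_min; apply/orP; left; rewrite ltr_pdivrMr// ltr_pMr// ltr1n.
have ds : d `^ s <= q.
  have -> : q = (q `^ s^-1) `^ s by rewrite -powRrM mulVf ?gt_eqF// powRr1// ltW.
  by rewrite ge0_ler_powR ?nnegrE ?(ltW s0) ?(ltW d_gt0) ?powR_ge0// ge_min lexx orbT.
have da0 : 0 < d `^ a by rewrite powR_gt0.
have := H d; rewrite d_gt0 dd0 => /(_ isT).
have -> : d `^ b = d `^ a * d `^ s.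
  rewrite -powRD; first by congr (_ `^ _); rewrite /s; ring.
  by rewrite (gt_eqF d_gt0) implybT.
rewrite mulrCA [K1 * _]mulrC ler_pM2l// => K12.
have : K1 <= K1 / 2.
  apply: le_trans K12 _; apply: (@le_trans _ _ (C * q)); last first.
    by rewrite /q; apply: eq_lexx; field; rewrite gt_eqF.
  apply: (@le_trans _ _ (C * d `^ s)); last by rewrite ler_pM2l.
  by rewrite ler_wpM2r ?powR_ge0// (le_trans (ler_norm _))// lerDl.
by rewrite ler_pdivlMr// ger_pMr// leNgt ltr1n.
Qed.

Lemma powR_monomial (k d v : R) (N : nat) : 0 <= k -> 0 <= d ->
  (k * d ^+ N) `^ v = k `^ v * d `^ (N%:R * v).
Proof.
by move=> k0 d0; rewrite powRM ?exprn_ge0// -powR_mulrn// powRrM.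
Qed.

Definition mx_size m (M : 'M[R]_m) : R := \sum_j \sum_k `|M k j|.

Lemma mx_size_ge0 m (M : 'M[R]_m) : 0 <= mx_size M.
Proof. by apply: sumr_ge0 => j _; apply: sumr_ge0 => k _. Qed.

Lemma bilinear_le m (M : 'M[R]_m) (x y : 'cV[R]_m) (X Y : R) :
  (forall i, `|x i 0| <= X) -> (forall i, `|y i 0| <= Y) ->
  `|(x^T *m M *m y) 0 0| <= mx_size M * (X * Y).
Proof.
move=> xX yY; rewrite mxE /mx_size mulr_suml.
apply: le_trans (ler_norm_sum _ _ _) _; apply: ler_sum => j _.
rewrite normrM mulrA; apply: ler_pM => //.
rewrite mxE mulr_suml; apply: le_trans (ler_norm_sum _ _ _) _.
by apply: ler_sum => k _; rewrite mxE normrM mulrC ler_wpM2l.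
Qed.

End scaling.

Section necessity.
Context {R : realType} {n : nat}.
Variables (A : 'M[R]_(n + n)) (gamma : R) (eta : cutoff R (n + n)).
Hypotheses (symA : A^T = A) (n0 : (0 < n)%N).
Local Notation m := (n + n)%N.
Hypothesis gamma_lt : 0 < gamma < m%:R.
Local Notation H := (heisenberg R n).
Local Notation J := (symp_mx R n).
Local Notation RT := (measurableTypeR R).
Local Notation nu := (nu_gamma A gamma eta).
Local Notation dens := (density gamma eta).

Definition shift_const : R := mx_size A + mx_size (2 *: A + J).

Local Notation K := shift_const.

Lemma shift_const_ge0 : 0 <= K.
Proof. by rewrite addr_ge0// mx_size_ge0. Qed.

Lemma quad_le (x : 'cV[R]_m) (X : R) : (forall i, `|x i 0| <= X) ->
  `|quad A x| <= K * X ^+ 2.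
Proof.
move=> xX; apply: le_trans (bilinear_le A xX xX) _.
by rewrite -expr2 ler_wpM2r ?sqr_ge0// lerDl mx_size_ge0.
Qed.

Lemma dot_le (x z : 'cV[R]_m) (X Z : R) :
  (forall i, `|x i 0| <= X) -> (forall i, `|z i 0| <= Z) ->
  `|dot ((2 *: A + J)^T *m x) z| <= K * (X * Z).
Proof.
move=> xX zZ.
have i0 : 'I_m by apply: (Ordinal (n := m) (m := 0)); rewrite addn_gt0 n0.
have XZ : 0 <= X * Z.
  by rewrite mulr_ge0// ?(le_trans _ (xX i0)) ?(le_trans _ (zZ i0)).
rewrite /dot trmx_mul trmxK; apply: le_trans (bilinear_le _ xX zZ) _.
by rewrite ler_wpM2r// lerDr mx_size_ge0.
Qed.

(** In these coordinates every term but the first is quadratic or bilinear in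
    [x] and [x - y], hence small on the sets below. *)
Lemma graph_shift_sub (g : H) (y : 'cV[R]_m) : graph_shift A g y =
  (g.1 - y, ((g.2 : R) - quad A g.1) +
    dot ((2 *: A + J)^T *m g.1) (g.1 - y) - quad A (g.1 - y)).
Proof.
case: g => x t /=; rewrite -(graph_shift_reflect symA x (x - y) t).
by rewrite opprB addrC subrK.
Qed.

Variables u v : R.
Hypothesis Tuv : type_set nu (u, v).

(* Coordinates of size at most [2 * r] make a vector of the Euclidean unit ball,
   where the cut-off is [1]. *)
Local Notation r := ((2 * m%:R)^-1 : R).

Lemma dim_gt0 : 0 < m%:R :> R. Proof. by rewrite ltr0n addn_gt0 n0. Qed.

Lemma radius_gt0 : 0 < r. Proof. by rewrite invr_gt0 mulr_gt0// dim_gt0. Qed.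

Lemma dim_mul_radius : m%:R * r = 2^-1.
Proof. by rewrite invfM mulrCA divff ?mulr1// gt_eqF// dim_gt0. Qed.

Lemma dim_ge1 : 1 <= m%:R :> R. Proof. by rewrite ler1n addn_gt0 n0. Qed.

Let i0 : 'I_m := Ordinal (ltn_addr n n0).

Local Notation cst0 := (fun=> 0 : R).

(** Small cubes: the average of such an indicator is of size [d ^ m] in a
    [d]-neighbourhood of the graph. *)
Lemma necessary_small_cubes : m.+1%:R * u <= m%:R + v.
Proof.
have [c c0 bound] := test_sets n0 gamma_lt Tuv.
have r0 := radius_gt0; have mr := dim_mul_radius; have m0 := dim_gt0; have m1 := dim_ge1.
have K0 := shift_const_ge0.
have r1 : 2 * r <= 1 by nra.
pose L := 1 + 2 * K; have L0 : 0 < L by rewrite ltr_wpDr// mulr_ge0.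
pose k2 := (r / 2) ^+ m * 2.
have k20 : 0 < k2 by rewrite mulr_gt0// exprn_gt0// divr_gt0.
pose k3 := 2 ^+ m * (2 * L); have k30 : 0 < k3 by rewrite !mulr_gt0// exprn_gt0.
apply: (@exponent_le _ (2 ^+ m * k2 `^ v) (c * k3 `^ u) _ _ (r / 4)).
- by rewrite mulr_gt0 ?exprn_gt0// powR_gt0.
- by rewrite divr_gt0.
move=> d /andP[d0 dr].
pose E : set H := slab (fun=> - d) (fun=> d) cst0 (L * d).
pose F : set H := slab (fun=> r / 2) (fun=> r) (quad A) d.
have mq : measurable_fun setT (quad A) by exact: measurable_quad.
have mE : measurable E by apply: measurable_slab; exact: measurable_cst.
have mF : measurable F by exact: measurable_slab.
have hE : haar E = ((2 * d) ^+ m * (2 * (L * d)))%:E.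
  by apply: haar_slab => //; rewrite ?mulr_gt0// => i; ring.
have hF : haar F = ((r / 2) ^+ m * (2 * d))%:E.
  by apply: haar_slab => //; rewrite ?divr_gt0// => i; lra.
have f0 : 0 < (r / 2) ^+ m * (2 * d) by rewrite !mulr_gt0// exprn_gt0// divr_gt0.
have := bound E F ((2 * d) ^+ m) _ _ mE mF _ hE hF f0.
have -> : (2 * d) ^+ m * (2 * (L * d)) = k3 * d ^+ m.+1.
  by rewrite /k3 exprMn exprS; ring.
have -> : (r / 2) ^+ m * (2 * d) = k2 * d ^+ 1 by rewrite /k2 expr1 mulrA.
rewrite !powR_monomial ?(ltW d0) ?(ltW k20) ?(ltW k30)// mul1r.
rewrite exprMn -(powR_mulrn m (ltW d0)).
have -> : 2 ^+ m * k2 `^ v * d `^ (m%:R + v) =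
    2 ^+ m * d `^ m%:R * (k2 `^ v * d `^ v).
  by rewrite powRD; [ring|rewrite (gt_eqF d0) implybT].
rewrite -[c * k3 `^ u * _]mulrA; apply; first by rewrite mulr_ge0 ?exprn_ge0 ?powR_ge0.
move=> [x t] [/= xb xt].
have -> : 2 ^+ m * d `^ m%:R = 1 * (2 * d) ^+ m.
  by rewrite mul1r exprMn powR_mulrn// ltW.
apply: (indicator_average_ge (a := fun i => x i 0 - d) (b := fun i => x i 0 + d)) => //.
- by move=> i; ring.
- by rewrite mulr_gt0.
move=> y yb.
have xb' i : r / 2 <= x i 0 <= r by have := xb i; rewrite /= in_itv/=.
have yb' i : x i 0 - d <= y i 0 <= x i 0 + d by have := yb i; rewrite /= in_itv/=.
have zb i : `|(x - y) i 0| <= d.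
  by rewrite !mxE ler_norml; move: (yb' i) => /andP[]; lra.
have x1 i : `|x i 0| <= 1.
  by rewrite ler_norml; move: (xb' i) => /andP[]; lra.
split.
  rewrite graph_shift_sub /E /slab /=; split.
    by move=> i /=; rewrite in_itv/= -ler_norml.
  have q := quad_le zb; have p := dot_le x1 zb.
  move: xt p q; set q1 := quad A (x - y); set p1 := dot _ _.
  rewrite !ler_norml => /andP[? ?] /andP[? ?] /andP[? ?].
  have d2 : K * d ^+ 2 <= K * d by rewrite ler_wpM2l// expr2; nra.
  by rewrite /L subr0; apply/andP; split; nra.
apply: (one_le_density eta n0 gamma_lt (r := 2 * r) (i := i0)) => //.
- by rewrite mulr_gt0.
- by rewrite mulrCA mr divff.
- by apply/eqP => y0; move: (yb' i0) (xb' i0); rewrite y0 => /andP[? ?] /andP[? ?]; lra.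
- by move=> i; rewrite ler_norml; move: (yb' i) (xb' i) => /andP[? ?] /andP[? ?]; lra.
Qed.

(** Neighbourhoods of the reflected graph: the average of the indicator of a
    set of measure comparable to [d] is bounded below on a cube of side [2 d]. *)
Lemma necessary_graph_neighbourhoods : u <= m.+1%:R * v.
Proof.
have [c c0 bound] := test_sets n0 gamma_lt Tuv.
have r0 := radius_gt0; have mr := dim_mul_radius; have m0 := dim_gt0; have m1 := dim_ge1.
have K0 := shift_const_ge0.
have r1 : 2 * r <= 1 by nra.
pose L := 1 + 2 * K; have L0 : 0 < L by rewrite ltr_wpDr// mulr_ge0.
pose k1 := (r / 2) ^+ m; have k10 : 0 < k1 by rewrite exprn_gt0// divr_gt0.
pose k2 : R := 2 ^+ m * 2; have k20 : 0 < k2 by rewrite mulr_gt0// exprn_gt0.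
pose k3 := (4 * r) ^+ m * (2 * L).
have k30 : 0 < k3 by rewrite !mulr_gt0// exprn_gt0// mulr_gt0.
apply: (@exponent_le _ (k1 * k2 `^ v) (c * k3 `^ u) _ _ r).
- by rewrite mulr_gt0// powR_gt0.
- by [].
move=> d /andP[d0 dr].
pose E : set H := slab (fun=> - (2 * r)) (fun=> 2 * r) (fun x => - quad A x) (L * d).
pose F : set H := slab (fun=> - d) (fun=> d) cst0 d.
have mq : measurable_fun setT (fun x => - quad A x).
  by apply: (measurableT_comp (f := @GRing.opp R)) => //; exact: measurable_quad.
have mE : measurable E by exact: measurable_slab.
have mF : measurable F by apply: measurable_slab; exact: measurable_cst.
have hE : haar E = ((4 * r) ^+ m * (2 * (L * d)))%:E.
  by apply: haar_slab => //; rewrite ?mulr_gt0// => i; ring.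
have hF : haar F = ((2 * d) ^+ m * (2 * d))%:E.
  by apply: haar_slab => //; rewrite ?mulr_gt0// => i; ring.
have f0 : 0 < (2 * d) ^+ m * (2 * d) by rewrite !mulr_gt0// exprn_gt0// mulr_gt0.
have := bound E F k1 _ _ mE mF (ltW k10) hE hF f0.
have -> : (4 * r) ^+ m * (2 * (L * d)) = k3 * d ^+ 1.
  by rewrite /k3 expr1; ring.
have -> : (2 * d) ^+ m * (2 * d) = k2 * d ^+ m.+1.
  by rewrite /k2 exprMn exprS; ring.
rewrite !powR_monomial ?(ltW d0) ?(ltW k20) ?(ltW k30)// mul1r -!mulrA; apply.
move=> [x t] [/= xb xt].
rewrite -[k1]mul1r.
apply: (indicator_average_ge (a := fun=> r / 2) (b := fun=> r)) => //.
- by move=> i; lra.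
- by rewrite divr_gt0.
move=> y yb.
have xd i : `|x i 0| <= d by have := xb i; rewrite /= in_itv/= -ler_norml.
have yb' i : r / 2 <= y i 0 <= r by have := yb i; rewrite /= in_itv/=.
have zb i : `|(x - y) i 0| <= 2 * r.
  rewrite !mxE ler_norml; move: (yb' i) (xd i); rewrite ler_norml.
  by move=> /andP[? ?] /andP[? ?]; lra.
split.
  rewrite graph_shift_sub /E /slab /=; split.
    by move=> i /=; rewrite in_itv/= -ler_norml.
  have q := quad_le xd; have p := dot_le xd zb.
  move: xt p q; rewrite subr0; set q1 := quad A x; set p1 := dot _ _.
  set q2 := quad A _; rewrite !ler_norml => /andP[? ?] /andP[? ?] /andP[? ?].
  have d2 : K * d ^+ 2 <= K * d by rewrite ler_wpM2l// expr2; nra.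
  have d3 : K * (d * (2 * r)) <= K * d by rewrite ler_wpM2l// ler_piMr// ltW.
  by rewrite /L; apply/andP; split; nra.
apply: (one_le_density eta n0 gamma_lt (r := 2 * r) (i := i0)) => //.
- by rewrite mulr_gt0.
- by rewrite mulrCA mr divff.
- by apply/eqP => y0; move: (yb' i0); rewrite y0 => /andP[? ?]; lra.
- by move=> i; rewrite ler_norml; move: (yb' i) => /andP[? ?]; lra.
Qed.

(** Parabolic boxes of size [s]; only the part of the graph at distance [rho]
    from the origin is used. *)
Lemma parabolic_boxes : exists2 c : R, 0 <= c & forall s rho : R,
  0 < rho -> rho <= s -> m%:R * rho <= 1 ->
  (m%:R * rho) `^ (- gamma) * (rho / 2) ^+ m * s `^ (m.+2%:R * v) <=
  c * s `^ (m.+2%:R * u).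
Proof.
have [c c0 bound] := test_sets n0 gamma_lt Tuv.
have m0 := dim_gt0; have K0 := shift_const_ge0.
pose L := 1 + 7 * K; have L0 : 0 < L by rewrite ltr_wpDr// mulr_ge0.
pose k2 : R := 2 ^+ m * 2; have k20 : 0 < k2 by rewrite mulr_gt0// exprn_gt0.
pose k3 := 4 ^+ m * (2 * L); have k30 : 0 < k3 by rewrite !mulr_gt0// exprn_gt0.
exists (c * k3 `^ u / k2 `^ v); first by rewrite divr_ge0 ?mulr_ge0 ?powR_ge0.
move=> s rho rho0 rs mrho; have s0 : 0 < s by exact: lt_le_trans rs.
pose E : set H := slab (fun=> - (2 * s)) (fun=> 2 * s) cst0 (L * s ^+ 2).
pose F : set H := slab (fun=> - s) (fun=> s) cst0 (s ^+ 2).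
have mE : measurable E by apply: measurable_slab; exact: measurable_cst.
have mF : measurable F by apply: measurable_slab; exact: measurable_cst.
have hE : haar E = ((4 * s) ^+ m * (2 * (L * s ^+ 2)))%:E.
  by apply: haar_slab => //; rewrite ?mulr_gt0 ?exprn_gt0// => i; ring.
have hF : haar F = ((2 * s) ^+ m * (2 * s ^+ 2))%:E.
  by apply: haar_slab => //; rewrite ?mulr_gt0 ?exprn_gt0// => i; ring.
have f0 : 0 < (2 * s) ^+ m * (2 * s ^+ 2) by rewrite !mulr_gt0 ?exprn_gt0// mulr_gt0.
set kappa := (m%:R * rho) `^ (- gamma) * (rho / 2) ^+ m.
have kappa0 : 0 <= kappa by rewrite mulr_ge0 ?powR_ge0// exprn_ge0// divr_ge0// ltW.
have := bound E F kappa _ _ mE mF kappa0 hE hF f0.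
have -> : (4 * s) ^+ m * (2 * (L * s ^+ 2)) = k3 * s ^+ m.+2.
  by rewrite /k3 exprMn !exprS expr0; ring.
have -> : (2 * s) ^+ m * (2 * s ^+ 2) = k2 * s ^+ m.+2.
  by rewrite /k2 exprMn !exprS expr0; ring.
rewrite !powR_monomial ?(ltW s0) ?(ltW k20) ?(ltW k30)//.
have k2v : 0 < k2 `^ v by rewrite powR_gt0.
have -> : c * k3 `^ u / k2 `^ v * s `^ (m.+2%:R * u) =
    c * (k3 `^ u * s `^ (m.+2%:R * u)) / k2 `^ v by ring.
rewrite ler_pdivlMr// => H.
have -> : kappa * s `^ (m.+2%:R * v) * k2 `^ v =
    kappa * (k2 `^ v * s `^ (m.+2%:R * v)) by ring.
apply: H => -[x t] [/= xb xt].
apply: (indicator_average_ge (a := fun=> rho / 2) (b := fun=> rho)) => //.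
- by move=> i; lra.
- by rewrite divr_gt0.
- exact: powR_ge0.
move=> y yb.
have xs i : `|x i 0| <= s by have := xb i; rewrite /= in_itv/= -ler_norml.
have yb' i : rho / 2 <= y i 0 <= rho by have := yb i; rewrite /= in_itv/=.
have zb i : `|(x - y) i 0| <= 2 * s.
  rewrite !mxE ler_norml; move: (yb' i) (xs i); rewrite ler_norml.
  by move=> /andP[? ?] /andP[? ?]; lra.
split.
  rewrite graph_shift_sub /E /slab /=; split.
    by move=> i /=; rewrite in_itv/= -ler_norml.
  have q := quad_le xs; have p := dot_le xs zb; have q' := quad_le zb.
  move: xt p q q'; rewrite !subr0; set q1 := quad A x; set p1 := dot _ _.
  set q2 := quad A (x - y).
  have -> : (2 * s) ^+ 2 = 4 * s ^+ 2 by ring.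
  have -> : s * (2 * s) = 2 * s ^+ 2 by ring.
  rewrite !ler_norml => /andP[? ?] /andP[? ?] /andP[? ?] /andP[? ?].
  by rewrite /L; apply/andP; split; lra.
apply: (density_ge eta n0 gamma_lt (i := i0)) => //.
- by apply/eqP => y0; move: (yb' i0); rewrite y0 => /andP[? ?]; lra.
- by move=> i; rewrite ler_norml; move: (yb' i) => /andP[? ?]; lra.
Qed.

(** Let [s = rho = d] tend to [0]; the singularity of the density gives
    [d ^ (m - gamma)]. *)
Lemma necessary_small_parabolic : m.+2%:R * u <= m%:R - gamma + m.+2%:R * v.
Proof.
have [c c0 bound] := parabolic_boxes; have m0 := dim_gt0.
apply: (@exponent_le _ (m%:R `^ (- gamma) * 2^-1 ^+ m) c _ _ m%:R^-1).
- by rewrite mulr_gt0 ?powR_gt0// exprn_gt0// invr_gt0.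
- by rewrite invr_gt0.
move=> d /andP[d0 dm].
have md : m%:R * d <= 1 by rewrite -ler_pdivlMl// mulr1 ltW.
apply: le_trans (bound d d d0 (lexx d) md).
apply: eq_lexx.
rewrite powRM ?(ltW m0) ?(ltW d0)// exprMn -(powR_mulrn m (ltW d0)).
rewrite powRD; last by rewrite (gt_eqF d0) implybT.
rewrite addrC powRD; last by rewrite (gt_eqF d0) implybT.
ring.
Qed.

(** Let [s = 1 / d] tend to infinity with [rho] fixed. *)
Lemma necessary_large_parabolic : v <= u.
Proof.
have [c c0 bound] := parabolic_boxes; have m0 := dim_gt0; have m1 := dim_ge1.
suff : - (m.+2%:R * u) <= - (m.+2%:R * v) by rewrite lerN2 ler_pM2l// ltr0n.
apply: (@exponent_le _ ((m%:R^-1 / 2) ^+ m) c _ _ 1) => //.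
  by rewrite exprn_gt0// divr_gt0// invr_gt0.
move=> d /andP[d0 d1].
have mV : m%:R * m%:R^-1 = 1 :> R by rewrite divff// gt_eqF.
have := bound d^-1 m%:R^-1; rewrite mV invr_gt0 lexx powR1 mul1r => H.
have inv_powR (a : R) : d^-1 `^ a = d `^ (- a).
  by rewrite -powR_inv1 ?ltW// -powRrM mulN1r.
rewrite -!inv_powR; apply: H => //.
apply: (@le_trans _ _ 1); first by rewrite invf_le1.
by rewrite invf_ge1// ltW.
Qed.

End necessity.

(** * The trapezoid *)

Section geometry.
Context {R : realType}.
Variables (n : nat) (gamma : R).
Hypotheses (n0 : (0 < n)%N) (gamma_lt : 0 < gamma < (n + n)%:R).
Local Notation m := (n + n)%N.
Local Notation v := (m.+1%:R / m.+2%:R : R).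
Local Notation theta0 := (1 - gamma / m%:R).

Lemma convex_hull4P (a b c e x : R * R) :
  convex_hull4 a b c e x <-> exists t0 t1 t2 t3 : R,
    [/\ [/\ 0 <= t0, 0 <= t1, 0 <= t2 & 0 <= t3], t0 + t1 + t2 + t3 = 1,
      x.1 = t0 * a.1 + t1 * b.1 + t2 * c.1 + t3 * e.1 &
      x.2 = t0 * a.2 + t1 * b.2 + t2 * c.2 + t3 * e.2].
Proof.
split=> [[t [tge0 t1 ->]]|[t0 [t1 [t2 [t3 [[p0 p1 p2 p3] t1' x1 x2]]]]]].
  exists (t (inord 0)), (t (inord 1)), (t (inord 2)), (t (inord 3)).
  have E (V : nmodType) (F : 'I_4 -> V) : \sum_i F i =
      F (inord 0) + F (inord 1) + F (inord 2) + F (inord 3).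
    rewrite !big_ord_recr big_ord0 /= add0r.
    by congr (F _ + F _ + F _ + F _); apply/val_inj; rewrite /= inordK.
  split; first by split; exact: tge0.
  - by rewrite -t1 E.
  - by rewrite E !(tnth_nth 0) !inordK.
  - by rewrite E !(tnth_nth 0) !inordK.
exists (fun i : 'I_4 => nth 0 [:: t0; t1; t2; t3] i); split.
- by case=> [[|[|[|[|]]]]] //=.
- by rewrite !big_ord_recr big_ord0 /= add0r.
rewrite !big_ord_recr big_ord0 /= add0r !(tnth_nth 0) /=.
by case: x x1 x2 => x x' /= -> ->.
Qed.

Lemma natr_double : m%:R = 2 * n%:R :> R. Proof. by rewrite natrD; ring. Qed.

Lemma natr_double2 : m.+2%:R = m%:R + 2 :> R. Proof. by rewrite -addn2 natrD. Qed.

Lemma natr_double1 : m.+1%:R = m%:R + 1 :> R. Proof. by rewrite -addn1 natrD. Qed.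

(** [D] and [D'] lie on the two lines that join the point [(v, 1 - v)] to the
    vertices [(1, 1)] and [(0, 0)], at the same proportion. *)
Lemma vertexDE : vertexD n gamma =
  (1 - theta0 + theta0 * v, 1 - theta0 + theta0 * (1 - v)).
Proof.
have m0 := @dim_gt0 R n n0; have m2 : 0 < m%:R + 2 :> R by rewrite addr_gt0.
rewrite /vertexD natr_double2 natr_double1 -natr_double.
have -> : 4 * n%:R ^+ 2 = m%:R ^+ 2 :> R by rewrite natr_double; ring.
move: (m%:R : R) m0 m2 => M M0 M2.
by congr pair; field; rewrite !gt_eqF.
Qed.

Lemma vertexD'E : vertexD' n gamma = (theta0 * v, theta0 * (1 - v)).
Proof. by rewrite /vertexD' vertexDE /=; congr pair; ring. Qed.

Lemma theta0_bounds : 0 < theta0 < 1.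
Proof.
have m0 := @dim_gt0 R n n0; have /andP[g0 g1] := gamma_lt.
by rewrite subr_gt0 ltr_pdivrMr// mul1r g1/= ltrBlDr ltrDl divr_gt0.
Qed.

(** With [theta] read off from [u - w], the second and the first inequality say
    that the remainder [s] of [u] after [theta V] lies between [0] and
    [1 - theta], and the third that [theta <= theta0].  The barycentric
    coordinates are products: [tau = theta / theta0] is the position between the
    side on the diagonal and the side [D' D], [la] the position along the
    sides. *)
Lemma trapezoid_of_inequalities (u w : R) :
  m.+1%:R * u <= m%:R + w -> u <= m.+1%:R * w ->
  m.+2%:R * u <= m%:R - gamma + m.+2%:R * w -> w <= u ->
  trapezoid n gamma (u, w).
Proof.
move=> h1 h2 h3 h4; have m0 := @dim_gt0 R n n0.
have /andP[th0 th1] := theta0_bounds; have /andP[g0 g1] := gamma_lt.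
have m2 : 0 < m%:R + 2 :> R by rewrite addr_gt0.
rewrite natr_double1 in h1 h2; rewrite natr_double2 in h3.
pose theta := (u - w) * (m%:R + 2) / m%:R.
have thge0 : 0 <= theta by rewrite divr_ge0 ?mulr_ge0 ?subr_ge0// ltW.
have thle : theta <= theta0.
  have -> : theta0 = (m%:R - gamma) / m%:R by rewrite mulrBl divff// gt_eqF.
  by rewrite ler_pM2r ?invr_gt0//; lra.
have th1' : 0 < 1 - theta by rewrite subr_gt0 (le_lt_trans thle).
pose tau := theta / theta0; pose s := ((m%:R + 1) * w - u) / m%:R.
have s0 : 0 <= s by rewrite divr_ge0 ?subr_ge0// ltW.
have s1 : s <= 1 - theta.
  rewrite -subr_ge0 (_ : _ - _ = (m%:R + w - (m%:R + 1) * u) / m%:R).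
    by rewrite divr_ge0 ?subr_ge0// ltW.
  by rewrite /theta /s; move: (m%:R : R) m0 => M M0; field; rewrite gt_eqF.
pose la := s / (1 - theta).
have la0 : 0 <= la by rewrite divr_ge0// ltW.
have la1 : la <= 1 by rewrite ler_pdivrMr// mul1r.
have ta0 : 0 <= tau by rewrite divr_ge0// ltW.
have ta1 : tau <= 1 by rewrite ler_pdivrMr// mul1r.
have tauE : tau * theta0 = theta by rewrite divfK// gt_eqF.
have laE : la * (1 - theta) = s by rewrite divfK// gt_eqF.
apply/convex_hull4P; exists ((1 - la) * (1 - tau)), (la * (1 - tau)), (la * tau),
  ((1 - la) * tau); rewrite vertexD'E vertexDE /=.
have key b : (1 - la) * (1 - tau) * 0 + la * (1 - tau) * 1 +
    la * tau * (1 - theta0 + theta0 * b) + (1 - la) * tau * (theta0 * b) =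
    la * (1 - tau * theta0) + tau * theta0 * b by ring.
split; [|by ring| |].
- by split; rewrite mulr_ge0 ?subr_ge0.
- rewrite key tauE laE /s /theta natr_double2 natr_double1.
  by move: (m%:R : R) m0 m2 => M M0 M2; field; rewrite !gt_eqF.
- rewrite key tauE laE /s /theta natr_double2 natr_double1.
  by move: (m%:R : R) m0 m2 => M M0 M2; field; rewrite !gt_eqF.
Qed.

(** Conversely [theta = (t2 + t3) theta0], which reaches [theta0] only when
    [t2 + t3 = 1], that is, on the segment. *)
Lemma trapezoid_parameters (x : R * R) :
  trapezoid n gamma x -> ~ segment (vertexD n gamma) (vertexD' n gamma) x ->
  exists theta c : R, [/\ 0 <= theta < 1, 0 <= c <= 1,
    gamma < (1 - theta) * m%:R &
    x = ((1 - theta) * c + theta * v, (1 - theta) * c + theta * (1 - v))].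
Proof.
move=> /convex_hull4P[t0 [t1 [t2 [t3 [[p0 p1 p2 p3] t1' x1 x2]]]]] xs.
have m0 := @dim_gt0 R n n0; have /andP[th0 th1] := theta0_bounds.
have t23 : t2 + t3 < 1.
  rewrite ltNge; apply/negP => t23; apply: xs.
  have t00 : t0 = 0 by lra.
  have t10 : t1 = 0 by lra.
  have t2E : t2 = 1 - t3 by lra.
  exists t3; first by rewrite /= in_itv/= p3; lra.
  move: x1 x2; rewrite t00 t10 t2E !mul0r !add0r.
  by case: x => a b /= -> ->.
pose theta := (t2 + t3) * theta0.
have thge0 : 0 <= theta by apply: mulr_ge0; [exact: addr_ge0|exact: ltW].
have thlt : theta < theta0 by rewrite -[ltRHS]mul1r ltr_pM2r.
have thlt1 : theta < 1 by exact: lt_trans th1.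
have th1' : 0 < 1 - theta by rewrite subr_gt0.
pose s := t1 + t2 * (1 - theta0).
have s0 : 0 <= s by rewrite addr_ge0// mulr_ge0// subr_ge0 ltW.
have s1 : s <= 1 - theta.
  rewrite -subr_ge0 (_ : _ - _ = t0 + t3 * (1 - theta0)).
    by rewrite addr_ge0// mulr_ge0// subr_ge0 ltW.
  by rewrite /s /theta -[X in X - _ - _]t1'; ring.
exists theta, (s / (1 - theta)); split.
- by rewrite thge0.
- by rewrite divr_ge0 ?(ltW th1')//= ler_pdivrMr// mul1r.
- have : gamma / m%:R < 1 - theta by lra.
  by rewrite ltr_pdivrMr.
rewrite [_ * (s / _)]mulrCA divff ?gt_eqF// mulr1.
move: x1 x2; rewrite vertexD'E vertexDE /=; case: x xs => a b _ /= -> ->.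
by congr pair; rewrite /s /theta; ring.
Qed.

End geometry.


Theorem theorem6 (R : realType) (n : nat) (A : 'M[R]_(n + n)) (gamma : R)
    (eta : cutoff R (n + n)) :
  (1 <= n)%N ->
  A^T = A ->
  0 < gamma < 2 * n%:R ->
  \det (2 *: A + symp_mx R n) != 0 ->
  \det (2 *: A - symp_mx R n) != 0 ->
  type_set (nu_gamma A gamma eta) `<=` trapezoid n gamma /\
  trapezoid n gamma `\` segment (vertexD n gamma) (vertexD' n gamma)
    `<=` type_set (nu_gamma A gamma eta).
Proof.
move=> n0 symA; rewrite -natr_double => gamma_lt detB _; split.
  move=> [u w] Tuw; apply: trapezoid_of_inequalities => //.
  - exact: necessary_small_cubes Tuw.
  - exact: necessary_graph_neighbourhoods Tuw.
  - exact: necessary_small_parabolic Tuw.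
  - exact: necessary_large_parabolic Tuw.
move=> x [xt xs].
have [theta [c [theta01 c01 gth ->]]] := trapezoid_parameters n0 gamma_lt xt xs.
have /andP[g0 _] := gamma_lt; have /andP[t0 t1] := theta01; have /andP[c0 c1] := c01.
set v : R := _%:R / _%:R.
have v0 : 0 < v by rewrite divr_gt0 ?ltr0n.
have t1' : 0 < 1 - theta by rewrite subr_gt0.
have u0 : 0 <= (1 - theta) * c + theta * v by rewrite addr_ge0 ?mulr_ge0 ?(ltW t1') ?(ltW v0).
(* The first coordinate vanishes at the origin only, where [p] is infinite. *)
have [u_eq0|un0] := eqVneq ((1 - theta) * c + theta * v) 0; last first.
  have gth' : 0 < gamma < (1 - theta) * (n + n)%:R by rewrite g0.
  by apply: type_set_interpolation => //; rewrite lt_neqAle eq_sym un0.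
have [tc0 tv0] : (1 - theta) * c = 0 /\ theta * v = 0.
  have q0 : 0 <= (1 - theta) * c by rewrite mulr_ge0 ?(ltW t1').
  have q1 : 0 <= theta * v by rewrite mulr_ge0 ?(ltW v0).
  by split; lra.
have th0 : theta = 0 by move/eqP: tv0; rewrite mulf_eq0 [v == 0]gt_eqF// orbF => /eqP.
rewrite u_eq0 tc0 th0 mul0r addr0; exact: type_set_origin.
Qed.
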